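(* Let $n\ge0$. For $\Lambda\in L^2(\mathbb R^2,\mathbb H)$ and for all $y\in\mathbb R$, the full-poly adjoint operator $\mathbb V_{\vec\psi}^*:L^2(\mathbb R^2,\mathbb H)\to L^2(\mathbb R,\mathbb H^{n+1})$ (the adjoint of $\mathbb V_{\vec\psi}$) is given by $$\mathbb V_{\vec\psi}^*\Lambda=\left(\mathcal V_{\psi_0}^*\Lambda,\dots,\mathcal V_{\psi_n}^*\Lambda\right),$$ where $$\mathcal V_{\psi_j}^*\Lambda(y)=\sqrt2\int_{\mathbb R^2}e^{2\pi I\omega y}\Lambda(x,\omega)\psi_j(x-y)\,dx\,d\omega,\qquad 0\le j\le n.$$ Moreover, $$\mathbb V_{\vec\psi}^*\mathbb V_{\vec\psi}=2\,\mathrm{Id}_{L^2(\mathbb R,\mathbb H^{n+1})}.$$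
   Context: $\mathbb H$ is the skew field of quaternions; fix an imaginary unit $I\in\mathbb H$, $I^2=-1$. $\langle f,g\rangle_{L^2(X,\mathbb H)}=\int_X\overline g\,f$ for $X=\mathbb R,\mathbb R^2$, and $\langle\vec f,\vec g\rangle_{L^2(\mathbb R,\mathbb H^{n+1})}=\sum_{j=0}^n\langle f_j,g_j\rangle_{L^2(\mathbb R,\mathbb H)}$. The operator $\mathbb V_{\vec\psi}$ maps $L^2(\mathbb R,\mathbb H^{n+1})$ to $L^2(\mathbb R^2,\mathbb H)$; being its adjoint means $\langle\mathbb V_{\vec\psi}^*\Lambda,\vec h\rangle_{L^2(\mathbb R,\mathbb H^{n+1})}=\langle\Lambda,\mathbb V_{\vec\psi}\vec h\rangle_{L^2(\mathbb R^2,\mathbb H)}$ for all $\vec h\in L^2(\mathbb R,\mathbb H^{n+1})$. $\vec\psi=(\psi_0,\dots,\psi_n)$ where $\psi_j=h_j/\|h_j\|_{L^2(\mathbb R)}$ with $h_j(t)=(-1)^je^{\pi t^2}\frac{d^j}{dt^j}e^{-2\pi t^2}$ (normalized weighted Hermite functions, real-valued). The quaternionic Segal–Bargmann transform is $\mathcal B\varphi(q)=2^{3/4}\int_{\mathbb R}e^{-\pi(q^2+t^2)+2\pi\sqrt2\,qt}\varphi(t)\,dt$ (slice regular in $q\in\mathbb H$); the slice derivative is $\partial_sf(x+Jy)=\frac12(\partial_x-J\partial_y)f(x+Jy)$ for $J\in\mathbb H$, $J^2=-1$, $y\ne0$, and $\partial_sf(x)=\partial_xf(x)$ at real points. The true quaternionic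 polyanalytic Bargmann transform is $B^{j+1}\varphi(q)=(-1)^j\sqrt{\frac{1}{(2\pi)^jj!}}\sum_{k=0}^j\binom jk(-2\pi\bar q)^k\partial_s^{j-k}\mathcal B\varphi(q)$, and the full-polyanalytic one is $\mathfrak B\vec\varphi=\sum_{j=0}^nB^{j+1}\varphi_j$. With $q=x+I\omega$, the full-poly QSTFT (full polyanalytic quaternion short-time Fourier transform) is the $\mathbb H$-valued function $\mathbb V_{\vec\psi}\vec\varphi(x,\omega)=e^{-I\pi x\omega}\mathfrak B(\vec\varphi)\left(\frac{\bar q}{\sqrt2}\right)e^{-\frac{|q|^2\pi}{2}}$, $(x,\omega)\in\mathbb R^2$.
   Formalization: For general Λ in L² the integral over R² need not converge; it is read as the L²(dy)-limit of integrals over any increasing finite-measure sets exhausting R², equal to the ordinary integral at each y where that converges absolutely; equalities of L² functions hold for almost every y. *)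

(* Defs.v *)
From HB Require Import structures.
From mathcomp Require Import all_boot all_order all_algebra.
From mathcomp Require Import all_classical all_reals all_analysis.
From mathcomp Require Import ring.

Set Implicit Arguments.
Unset Strict Implicit.
Unset Printing Implicit Defensive.

Import Order.TTheory GRing.Theory Num.Theory.
Import numFieldNormedType.Exports.

Local Open Scope classical_set_scope.
Local Open Scope ring_scope.

(* Quat a b c d stands for a + b i + c j + d k. *)
Record quat (R : realType) := Quat { qre : R; qi : R; qj : R; qk : R }.

Section QuaternionRing.
Variable R : realType.
Implicit Types (p q : quat R) (a : R).

Definition quat_tuple q := (qre q, qi q, qj q, qk q).
Definition tuple_quat (x : R * R * R * R) :=
  Quat x.1.1.1 x.1.1.2 x.1.2 x.2.

Lemma quat_tupleK : cancel quat_tuple tuple_quat.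
Proof. by case. Qed.

HB.instance Definition _ := Choice.copy (quat R) (can_type quat_tupleK).

Definition addq p q :=
  Quat (qre p + qre q) (qi p + qi q) (qj p + qj q) (qk p + qk q).
Definition oppq q := Quat (- qre q) (- qi q) (- qj q) (- qk q).
Definition zeroq : quat R := Quat 0 0 0 0.
Definition oneq : quat R := Quat 1 0 0 0.
Definition mulq p q :=
  let: Quat a1 b1 c1 d1 := p in
  let: Quat a2 b2 c2 d2 := q in
  Quat (a1 * a2 - b1 * b2 - c1 * c2 - d1 * d2)
       (a1 * b2 + b1 * a2 + c1 * d2 - d1 * c2)
       (a1 * c2 - b1 * d2 + c1 * a2 + d1 * b2)
       (a1 * d2 + b1 * c2 - c1 * b2 + d1 * a2).
Definition scaleq a q := Quat (a * qre q) (a * qi q) (a * qj q) (a * qk q).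

Fact addqA : associative addq.
Proof. by case=> ? ? ? ? [? ? ? ?] [? ? ? ?]; congr Quat; rewrite /=; ring. Qed.
Fact addqC : commutative addq.
Proof. by case=> ? ? ? ? [? ? ? ?]; congr Quat; rewrite /=; ring. Qed.
Fact add0q : left_id zeroq addq.
Proof. by case=> ? ? ? ?; congr Quat; rewrite /=; ring. Qed.
Fact addNq : left_inverse zeroq oppq addq.
Proof. by case=> ? ? ? ?; congr Quat; rewrite /=; ring. Qed.

HB.instance Definition _ :=
  GRing.isZmodule.Build (quat R) addqA addqC add0q addNq.

Fact mulqA : associative mulq.
Proof. by case=> ? ? ? ? [? ? ? ?] [? ? ? ?]; congr Quat; rewrite /=; ring. Qed.
Fact mul1q : left_id oneq mulq.
Proof. by case=> ? ? ? ?; congr Quat; rewrite /=; ring. Qed.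
Fact mulq1 : right_id oneq mulq.
Proof. by case=> ? ? ? ?; congr Quat; rewrite /=; ring. Qed.
Fact mulqDl : left_distributive mulq +%R.
Proof. by case=> ? ? ? ? [? ? ? ?] [? ? ? ?]; congr Quat; rewrite /=; ring. Qed.
Fact mulqDr : right_distributive mulq +%R.
Proof. by case=> ? ? ? ? [? ? ? ?] [? ? ? ?]; congr Quat; rewrite /=; ring. Qed.
Fact oneq_neq0 : oneq != 0.
Proof. by apply/eqP => -[] /eqP; rewrite oner_eq0. Qed.

HB.instance Definition _ :=
  GRing.Zmodule_isNzRing.Build (quat R) mulqA mul1q mulq1 mulqDl mulqDr oneq_neq0.

Fact scaleqA a b q : scaleq a (scaleq b q) = scaleq (a * b) q.
Proof. by case: q => ? ? ? ?; congr Quat; rewrite /=; ring. Qed.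
Fact scale1q : left_id 1 scaleq.
Proof. by case=> ? ? ? ?; congr Quat; rewrite /=; ring. Qed.
Fact scaleqDr : right_distributive scaleq +%R.
Proof. by move=> ? [? ? ? ?] [? ? ? ?]; congr Quat; rewrite /=; ring. Qed.
Fact scaleqDl q : {morph scaleq^~ q : a b / a + b}.
Proof. by case: q => ? ? ? ? ? ?; congr Quat; rewrite /=; ring. Qed.

HB.instance Definition _ :=
  GRing.Zmodule_isLmodule.Build R (quat R) scaleqA scale1q scaleqDr scaleqDl.

Fact scaleqAl a p q : a *: (p * q) = (a *: p) * q.
Proof. by case: p q => ? ? ? ? [? ? ? ?]; congr Quat; rewrite /=; ring. Qed.

HB.instance Definition _ :=
  GRing.Lmodule_isLalgebra.Build R (quat R) scaleqAl.

Definition qconj q := Quat (qre q) (- qi q) (- qj q) (- qk q).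
Definition qim q := Quat 0 (qi q) (qj q) (qk q).
Definition qabs q : R :=
  Num.sqrt (qre q ^+ 2 + qi q ^+ 2 + qj q ^+ 2 + qk q ^+ 2).

End QuaternionRing.

(* H is identified with R^4: limits, derivatives and integrals of H-valued
   functions are taken componentwise. *)
Section QuaternionAnalysis.
Variable R : realType.

Definition qlim (u : nat -> quat R) : quat R :=
  Quat (limn (fun n => qre (u n))) (limn (fun n => qi (u n)))
       (limn (fun n => qj (u n))) (limn (fun n => qk (u n))).

Definition qexp (q : quat R) : quat R :=
  qlim (fun n => \sum_(0 <= k < n) (k`!%:R^-1 : R) *: q ^+ k).

Definition qderive1 (f : R -> quat R) (t : R) : quat R :=
  Quat (derive1 (fun s => qre (f s) : R^o) t) (derive1 (fun s => qi (f s) : R^o) t)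
       (derive1 (fun s => qj (f s) : R^o) t) (derive1 (fun s => qk (f s) : R^o) t).

(* At a non-real q = x + J y, J is taken to be the unit imaginary part of q and
   y > 0; the other decomposition x + (- J) (- y) gives the same value. *)
Definition slice_derive (f : quat R -> quat R) (q : quat R) : quat R :=
  let x := qre q in
  let y := qabs (qim q) in
  if y == 0 then qderive1 (fun s => f s%:A) x
  else
    let J := y^-1 *: qim q in
    (2^-1 : R) *: (qderive1 (fun s => f (s%:A + y *: J)) x
                   - J * qderive1 (fun s => f (x%:A + s *: J)) y).

Section Integral.
Context d (T : measurableType d) (mu : {measure set T -> \bar R}).
Implicit Types (D : set T) (f g : T -> quat R).

Definition qintegrable D f : Prop :=
  [/\ mu.-integrable D (fun x => (qre (f x))%:E),
      mu.-integrable D (fun x => (qi (f x))%:E),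
      mu.-integrable D (fun x => (qj (f x))%:E) &
      mu.-integrable D (fun x => (qk (f x))%:E)].

Definition qintegral D f : quat R :=
  Quat (\int[mu]_(x in D) qre (f x)) (\int[mu]_(x in D) qi (f x))
       (\int[mu]_(x in D) qj (f x)) (\int[mu]_(x in D) qk (f x)).

Definition qmeasurable f : Prop :=
  [/\ measurable_fun setT (fun x => qre (f x)),
      measurable_fun setT (fun x => qi (f x)),
      measurable_fun setT (fun x => qj (f x)) &
      measurable_fun setT (fun x => qk (f x))].

Definition L2norm f : \bar R := ('N[mu]_2%:E[EFin \o (fun x => qabs (f x))])%E.

Definition L2 f : Prop := qmeasurable f /\ (L2norm f < +oo)%E.

Definition L2dot f g : quat R := qintegral setT (fun x => qconj (g x) * f x).

End Integral.
End QuaternionAnalysis.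

Section FullPolyQSTFT.
Variable R : realType.

(* Lebesgue measures on the Borel sets of R and of R^2. *)
Definition leb1 : {measure set (measurableTypeR R) -> \bar R} :=
  lebesgue_measure.
Definition leb2 :
    {measure set (measurableTypeR R * measurableTypeR R) -> \bar R} :=
  (lebesgue_measure \x lebesgue_measure)%E.

(* The elements of L^2(R, H^(n+1)), given by their n + 1 components. *)
Definition L2vec n (f : 'I_n.+1 -> R -> quat R) : Prop :=
  forall j, L2 leb1 (f j).

Definition L2vec_dot n (f g : 'I_n.+1 -> R -> quat R) : quat R :=
  \sum_(j < n.+1) L2dot leb1 (f j) (g j).

Definition hermite_fun (j : nat) (t : R) : R :=
  (-1) ^+ j * expR (pi * t ^+ 2)
  * derive1n j (fun s : R => expR (- (2 * pi * s ^+ 2)) : R^o) t.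

Definition psi (j : nat) (t : R) : R :=
  hermite_fun j t / fine ('N[leb1]_2%:E[EFin \o hermite_fun j]%E).

Definition bargmann (phi : R -> quat R) (q : quat R) : quat R :=
  (2 `^ (3 / 4)) *:
  qintegral leb1 setT (fun t : R =>
    qexp (- (pi *: (q ^+ 2 + (t ^+ 2)%:A)) + (2 * pi * Num.sqrt 2 * t) *: q)
    * phi t).

(* true_bargmann j is the transform of order j + 1. *)
Definition true_bargmann (j : nat) (phi : R -> quat R) (q : quat R) : quat R :=
  ((-1) ^+ j * Num.sqrt (1 / ((2 * pi) ^+ j * j`!%:R))) *:
  \sum_(0 <= k < j.+1)
    'C(j, k)%:R * (- (2 * pi) *: qconj q) ^+ k
    * iter (j - k) (@slice_derive R) (bargmann phi) q.

Definition full_bargmann n (phi : 'I_n.+1 -> R -> quat R) (q : quat R) : quat R :=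
  \sum_(j < n.+1) true_bargmann j (phi j) q.

Definition full_qstft (I : quat R) n (phi : 'I_n.+1 -> R -> quat R)
    (p : R * R) : quat R :=
  let x := p.1 in
  let omega := p.2 in
  let q := x%:A + omega *: I in
  expR (- (qabs q ^+ 2 * pi / 2)) *:
  (qexp (- (pi * x * omega) *: I)
   * full_bargmann phi ((Num.sqrt 2)^-1 *: qconj q)).

Definition is_adjoint n (V : ('I_n.+1 -> R -> quat R) -> R * R -> quat R)
    (Vstar : (R * R -> quat R) -> 'I_n.+1 -> R -> quat R) : Prop :=
  forall Lambda, L2 leb2 Lambda ->
    L2vec (Vstar Lambda) /\
    forall h, L2vec h ->
      L2vec_dot (Vstar Lambda) h = L2dot leb2 Lambda (V h).

Definition exhaustion
    (E : nat -> set (measurableTypeR R * measurableTypeR R)) : Prop :=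
  [/\ forall N, measurable (E N), forall N, (leb2 (E N) < +oo)%E,
      nondecreasing_seq E & \bigcup_N E N = setT].

(* G is the function y |-> \int_(R^2) K y.  For Lambda in L^2 the integral of
   the adjoint formula need not converge absolutely (already its omega-integral
   is a Fourier integral of an L^2 function).  As for the L^2 Fourier transform,
   it denotes the limit in L^2(dy) of the absolutely convergent integrals over
   any exhaustion of R^2 by sets of finite measure, and it is the Lebesgue
   integral at every y where K y is Lebesgue integrable. *)
Definition is_L2_integral (K : R -> R * R -> quat R) (G : R -> quat R) : Prop :=
  [/\ L2 leb1 G,
      forall E, exhaustion E ->
        [/\ forall N y, qintegrable leb2 (E N) (K y),
            forall N, L2 leb1 (fun y => qintegral leb2 (E N) (K y)) &
            L2norm leb1 (fun y => G y - qintegral leb2 (E N) (K y))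
              @[N --> \oo] --> 0%E] &
      forall y, qintegrable leb2 setT (K y) -> G y = qintegral leb2 setT (K y)].

Definition adjoint_kernel (I : quat R) (j : nat) (Lambda : R * R -> quat R)
    (y : R) (p : R * R) : quat R :=
  psi j (p.1 - y) *: (qexp ((2 * pi * p.2 * y) *: I) * Lambda p).

End FullPolyQSTFT.

(* Main.v *)
(* Expanding the Hermite polynomials by Taylor's formula, the sum over k in the
   true polyanalytic Bargmann transforms collapses, and
     V phi (x, w) = sqrt 2 * sum_j int e^(- 2 pi I w t) psi_j(x - t) phi_j(t) dt.
   For fixed x this is a Fourier transform in t, so Plancherel's theorem in w,
   Tonelli's theorem and the orthonormality of the psi_j give
   |V phi|^2 = 2 |phi|^2, hence V* V = 2 Id.  For Lambda in L^1 and L^2, Fubini's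
   theorem identifies V* Lambda with the stated integrals.  Taking h = f in
   <f, h> = <Lambda, V h> shows |f|^2 <= 2 |Lambda|^2, so cutting Lambda off along
   an exhaustion makes the integrals converge in L^2; this gives both the
   existence of V* and the formula for it. *)

Require Import Defs.
From HB Require Import structures.
From mathcomp Require Import all_boot all_order all_algebra.
From mathcomp Require Import all_classical all_reals all_analysis.
From mathcomp Require Import measurable_realfun.
From mathcomp Require Import complex ring lra.

Set Implicit Arguments.
Unset Strict Implicit.
Unset Printing Implicit Defensive.

Import Order.TTheory GRing.Theory Num.Theory.
Import numFieldNormedType.Exports.

Local Open Scope classical_set_scope.
Local Open Scope ring_scope.

(** * Square-integrable real functions *)

(** All analysis is carried out on real functions. A quaternion is written [\sum_c qc c q *: qe R c]
    with the basis units on the right. The phases e^(- 2 pi I w t) multiply from the left, so each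
    coefficient stays in the slice R + R I and is an ordinary complex integral. A vector of L^2(R,
    H^(n+1)) becomes a family of 4 (n+1) real functions, and V becomes an additive operator [rop]
    between such families. The real inner product suffices: V commutes with right multiplication by
    quaternions, and testing against h e for the four units e recovers the four coordinates of the
    quaternionic inner product. The factor 2 is sqrt 2 squared; sqrt 2 is what remains of 2^(3/4),
    of the factors of the true polyanalytic transforms and of the norms of the Hermite functions
    ([psi_const]). Values of an adjoint are determined only up to null sets, whereas the integral
    formula also has to hold pointwise wherever the Lebesgue integral exists. Hence a representative
    of the L^2 limit must be chosen, and Fatou's lemma is used to show that the two descriptions are
    compatible. *)

Lemma measurable_fun_cos {R : realType} d (T : measurableType d) (g : T -> R) :
  measurable_fun setT g -> measurable_fun setT (fun x => cos (g x)).
Proof.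
by apply: measurableT_comp; exact: (continuous_measurable_fun (@continuous_cos R)).
Qed.

Lemma measurable_fun_sin {R : realType} d (T : measurableType d) (g : T -> R) :
  measurable_fun setT g -> measurable_fun setT (fun x => sin (g x)).
Proof.
by apply: measurableT_comp; exact: (continuous_measurable_fun (@continuous_sin R)).
Qed.

Lemma measurable_fun_expR {R : realType} d (T : measurableType d) (g : T -> R) :
  measurable_fun setT g -> measurable_fun setT (fun x => expR (g x)).
Proof. by apply: measurableT_comp; exact: measurable_expR. Qed.

Lemma measurable_fun_comp_hyp {R : realType} d (T : measurableType d)
    (F : measurableTypeR R -> R) (g : T -> R) :
  measurable_fun setT F -> measurable_fun setT g ->
  measurable_fun setT (fun x => F (g x)).
Proof. exact: measurableT_comp. Qed.

Lemma measurable_fun_norm {R : realType} d (T : measurableType d) (g : T -> R) :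
  measurable_fun setT g -> measurable_fun setT (fun x => `|g x|).
Proof. exact: measurableT_comp. Qed.

(** Syntax-directed measurability. Subtraction is matched before addition because it is a sum with
    an opposite; unknown functions are resolved by measurability hypotheses of the context. *)
Ltac meas_step := lazymatch goal with
  | |- measurable_fun _ (fun=> ?c) => exact: measurable_cst
  | |- measurable_fun _ (fun x => x) => exact: measurable_id
  | |- measurable_fun _ (fun x => fst x) => exact: measurable_fst
  | |- measurable_fun _ (fun x => snd x) => exact: measurable_snd
  | |- measurable_fun _ (fun x => GRing.add (@?f x) (GRing.opp (@?g x))) =>
      apply (@measurable_funB _ _ _ _ f g)
  | |- measurable_fun _ (fun x => GRing.add (@?f x) (@?g x)) =>
      apply (@measurable_funD _ _ _ _ f g)
  | |- measurable_fun _ (fun x => GRing.mul (@?f x) (@?g x)) =>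
      apply (@measurable_funM _ _ _ _ f g)
  | |- measurable_fun _ (fun x => GRing.opp (@?f x)) =>
      apply (@measurable_funN _ _ _ _ f)
  | |- measurable_fun _ (fun x => GRing.exp (@?f x) ?n) =>
      apply (@measurable_funX _ _ _ _ f n)
  | |- measurable_fun _ (fun x => Num.norm (@?f x)) =>
      apply (@measurable_fun_norm _ _ _ f)
  | |- measurable_fun _ (fun x => cos (@?f x)) =>
      apply (@measurable_fun_cos _ _ _ f)
  | |- measurable_fun _ (fun x => sin (@?f x)) =>
      apply (@measurable_fun_sin _ _ _ f)
  | |- measurable_fun _ (fun x => expR (@?f x)) =>
      apply (@measurable_fun_expR _ _ _ f)
  | H : measurable_fun _ ?F |- measurable_fun _ (fun x => ?F (@?g x)) =>
      first [exact H | apply (@measurable_fun_comp_hyp _ _ _ F g)]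
  | H : measurable_fun _ ?F |- measurable_fun _ ?F => exact H
  | _ => assumption
  end.
Ltac meas := cbv beta; repeat meas_step.

(** * Affine changes of variable for Lebesgue measure *)

Section AffineChange.
Variable R : realType.
Local Notation mu := (@lebesgue_measure R).

Let affine (c d : R) : measurableTypeR R -> measurableTypeR R := fun x => c * x + d.

Let measurable_affine c d : measurable_fun setT (affine c d).
Proof. by rewrite /affine; meas. Qed.

(** The pushforward under x -> c x + d, scaled by [|c|], agrees with Lebesgue measure on half-open
    intervals, which determine the measure. For [c < 0] the preimage of an interval is closed on the
    other side. *)
Lemma lebesgue_measure_affine (c d : R) (A : set (measurableTypeR R)) :
  c != 0 -> measurable A ->
  (mu ((fun x => c * x + d)%R @^-1` A) = `|c|^-1%:E * mu A)%E.
Proof.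
move=> c0 mA.
have c0' : 0 <= `|c| by [].
pose m := measure_function_pushforward__canonical__measure_function_Measure mu (@measurable_affine c d).
have -> : mu A = mscale (NngNum c0') m A.
  apply: lebesgue_measure_unique => //= _ [[a b]] _ <-.
  rewrite /mscale/= /pushforward lebesgue_measure_itv/= lte_fin.
  have [cp|cn] : 0 < c \/ c < 0 by move: c0; rewrite neq_lt => /orP[]; [right|left].
    have -> : affine c d @^-1` `]a, b] = `](a - d) / c, (b - d) / c]%classic.
      apply/seteqP; split => x /=; rewrite !in_itv/= /affine ltr_pdivrMr// ler_pdivlMr// ltrBlDr lerBrDr mulrC//.
    rewrite lebesgue_measure_itv/= lte_fin ltr_pM2r ?invr_gt0// ltrD2r.
    case: ifPn => // ab; last by rewrite mule0.
    by rewrite -!EFinD -EFinM gtr0_norm//; congr EFin; field.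
  have -> : affine c d @^-1` `]a, b] = `[(b - d) / c, (a - d) / c[%classic.
    by apply/seteqP; split => x /=; rewrite !in_itv/= /affine ltr_ndivlMr// ler_ndivrMr// ltrBlDr lerBrDr mulrC andbC.
  rewrite lebesgue_measure_itv/= lte_fin ltr_nM2r ?invr_lt0// ltrD2r.
  case: ifPn => // ab; last by rewrite mule0.
  by rewrite -!EFinD -EFinM ltr0_norm//; congr EFin; field.
by rewrite /mscale/= /pushforward muleA -EFinM mulVf ?normr_eq0// mul1e.
Qed.

Lemma ge0_integral_affine (c d : R) (f : R -> \bar R) :
  c != 0 -> measurable_fun setT f -> (forall x, 0 <= f x)%E ->
  (\int[mu]_x f (c * x + d)%R = `|c|^-1%:E * \int[mu]_x f x)%E.
Proof.
move=> c0 mf f0.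
have c0' : 0 <= `|c|^-1 by rewrite invr_ge0.
rewrite -[RHS](@ge0_integral_mscale _ _ _ mu _ measurableT (NngNum c0'))//.
transitivity (\int[@pushforward _ _ _ _ _ mu (affine c d)]_x f x)%E.
  by rewrite ge0_integral_pushforward.
apply: eq_measure_integral => A mA _.
exact: lebesgue_measure_affine.
Qed.

Lemma integrable_affine (c d : R) (f : R -> R) :
  c != 0 -> mu.-integrable setT (EFin \o f) ->
  mu.-integrable setT (EFin \o (fun x => f (c * x + d))).
Proof.
move=> c0 /integrableP[mf fy]; apply/integrableP; split.
  exact: (measurableT_comp mf (@measurable_affine c d)).
rewrite (@ge0_integral_affine c d (fun x => `|(f x)%:E|)%E)//.
  by apply: lte_mul_pinfty => //; rewrite lee_fin invr_ge0.
exact: measurableT_comp.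
Qed.

(** Positive and negative parts scale separately by a positive factor. The final case analysis
    covers infinite parts, for which [fine] returns 0 on both sides. *)
Lemma Rintegral_affine (c d : R) (f : R -> R) : c != 0 ->
  measurable_fun setT f ->
  \int[mu]_x f (c * x + d) = `|c|^-1 * \int[mu]_x f x.
Proof.
move=> c0 mf; have mf' : measurable_fun setT (EFin \o f) by exact/measurable_EFinP.
rewrite /Rintegral integralE [in RHS]integralE.
have -> : (\int[mu]_x (fun x0 : R => (f (c * x0 + d))%:E)^\+ x = `|c|^-1%:E * \int[mu]_x (EFin \o f)^\+ x)%E.
  rewrite -(@ge0_integral_affine c d _ c0 (measurable_funepos mf') (fun=> funepos_ge0 _ _)).
  by apply: eq_integral => x _; rewrite !funeposE.
have -> : (\int[mu]_x (fun x0 : R => (f (c * x0 + d))%:E)^\- x = `|c|^-1%:E * \int[mu]_x (EFin \o f)^\- x)%E.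
  rewrite -(@ge0_integral_affine c d _ c0 (measurable_funeneg mf') (fun=> funeneg_ge0 _ _)).
  by apply: eq_integral => x _; rewrite !funenegE.
rewrite -[X in _ = _ * fine X]/(\int[mu]_x (EFin \o f)^\+ x - \int[mu]_x (EFin \o f)^\- x)%E.
have c1 : `|c|^-1 != 0 by rewrite invr_eq0 normr_eq0.
have c2 : 0 < `|c|^-1 by rewrite lt_neqAle eq_sym c1 invr_ge0/=.
have A0 : (0 <= \int[mu]_x (EFin \o f)^\+ x)%E by exact: integral_ge0.
have B0 : (0 <= \int[mu]_x (EFin \o f)^\- x)%E by exact: integral_ge0.
move: A0 B0; set A := (\int[mu]_x (_^\+)%E x)%E; set B := (\int[mu]_x (_^\-)%E x)%E; move: A B => A B; clear -c2.
case: A => [a| |]//; case: B => [b| |]//= _ _; rewrite ?(gt0_muley,lte_fin)//= ?mulr0//.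
by rewrite mulrBr.
Qed.

End AffineChange.

Section RealIntegrable.
Context d (T : measurableType d) (R : realType).
Variable mu : {measure set T -> \bar R}.
Implicit Types f g h : T -> R.

Lemma integrableRZ a f : mu.-integrable setT (EFin \o f) ->
  mu.-integrable setT (EFin \o (fun x => a * f x)).
Proof. by move=> H; exact: (integrableZl measurableT a H). Qed.

Lemma integrableRD f g : mu.-integrable setT (EFin \o f) ->
  mu.-integrable setT (EFin \o g) ->
  mu.-integrable setT (EFin \o (fun x => f x + g x)).
Proof. by move=> H K; exact: (integrableD measurableT H K). Qed.

Lemma integrableRB f g : mu.-integrable setT (EFin \o f) ->
  mu.-integrable setT (EFin \o g) ->
  mu.-integrable setT (EFin \o (fun x => f x - g x)).
Proof. by move=> H K; exact: (integrableB measurableT H K). Qed.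

Lemma integrableR_le f g : measurable_fun setT f ->
  (forall x, `|f x| <= g x) -> mu.-integrable setT (EFin \o g) ->
  mu.-integrable setT (EFin \o f).
Proof.
move=> mf fg ig; apply: le_integrable ig => //; first exact/measurable_EFinP.
by move=> x _; rewrite /= lee_fin (le_trans (fg x))// ler_norm.
Qed.

Lemma integrableR_bounded f g M : measurable_fun setT g ->
  (forall x, `|g x| <= M) -> mu.-integrable setT (EFin \o f) ->
  mu.-integrable setT (EFin \o (fun x => g x * f x)).
Proof.
move=> mg gM iff.
have mf : measurable_fun setT f by exact/measurable_EFinP/(measurable_int mu iff).
apply: (@integrableR_le _ (fun x => M * `|f x|)); first by meas.
  by move=> x; rewrite normrM ler_wpM2r.
by apply: integrableRZ; exact: integrable_norm.
Qed.

End RealIntegrable.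

Section SquareIntegrable.
Context d (T : measurableType d) (R : realType).
Variable mu : {measure set T -> \bar R}.
Implicit Types f g h : T -> R.

(** Measurability of [f] is listed separately because that of its square does not imply it. *)
Definition sqint f := measurable_fun setT f /\
  mu.-integrable setT (EFin \o (fun x => f x ^+ 2)).

Lemma sqintP f : measurable_fun setT f ->
  (\int[mu]_x (f x ^+ 2)%:E < +oo)%E -> sqint f.
Proof.
move=> mf fy; split => //; apply/integrableP; split.
  by apply/measurable_EFinP; meas.
by under eq_integral do rewrite /= ger0_norm ?sqr_ge0//.
Qed.

Lemma sqint_lty f : sqint f -> (\int[mu]_x (f x ^+ 2)%:E < +oo)%E.
Proof. by move=> [_ /integrable_lty]; apply. Qed.

Lemma sqint_le f g : measurable_fun setT f -> sqint g ->
  (forall x, f x ^+ 2 <= g x ^+ 2) -> sqint f.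
Proof.
move=> mf [mg ig] fg; split => //; apply: le_integrable ig => //.
  by apply/measurable_EFinP; meas.
by move=> x _ /=; rewrite lee_fin !ger0_norm ?sqr_ge0.
Qed.

(** Dominated by [f ^+ 2 + g ^+ 2], as the square of [|f| - |g|] is nonnegative. *)
Lemma sqint_mul f g : sqint f -> sqint g ->
  mu.-integrable setT (EFin \o (fun x => f x * g x)).
Proof.
move=> [mf iff] [mg ig].
apply: (@le_integrable _ _ _ mu setT _ _
  (fun x => (f x ^+ 2)%:E + (g x ^+ 2)%:E)%E) => //.
- by apply/measurable_EFinP; meas.
- move=> x _ /=; rewrite lee_fin normrM.
  rewrite (ger0_norm (_ : 0 <= f x ^+ 2 + g x ^+ 2)) ?addr_ge0 ?sqr_ge0//.
  rewrite -(real_normK (num_real (f x))) -(real_normK (num_real (g x))).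
  have := sqr_ge0 (`|f x| - `|g x|); have := normr_ge0 (f x); have := normr_ge0 (g x).
  by nra.
- exact: integrableD.
Qed.

Lemma sqint0 : sqint (fun=> 0).
Proof.
split=> //; apply: (eq_integrable _ (cst 0%E)) => //; last exact: integrable0.
by move=> x _ /=; rewrite expr0n.
Qed.

Lemma sqintZ a f : sqint f -> sqint (fun x => a * f x).
Proof.
move=> [mf iff]; split; first by meas.
apply: (eq_integrable _ (fun x => (a ^+ 2)%:E * (f x ^+ 2)%:E)%E) => //.
  by move=> x _ /=; rewrite -EFinM exprMn.
exact: integrableZl.
Qed.

Lemma sqintD f g : sqint f -> sqint g -> sqint (fun x => f x + g x).
Proof.
move=> sf sg; have [mf iff] := sf; have [mg ig] := sg; split; first by meas.
apply: (eq_integrable _ (fun x => (f x ^+ 2)%:E + ((2%:E * (f x * g x)%:E) + (g x ^+ 2)%:E))%E) => //.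
  by move=> x _ /=; rewrite -EFinM -!EFinD; congr EFin; ring.
apply: integrableD => //; apply: integrableD => //.
apply: integrableZl => //; exact: sqint_mul.
Qed.

Lemma sqintB f g : sqint f -> sqint g -> sqint (fun x => f x - g x).
Proof.
move=> sf sg; under eq_fun do rewrite -mulN1r.
by apply: sqintD => //; exact: sqintZ.
Qed.

Lemma sqint_sum (I : Type) (s : seq I) (h : I -> T -> R) :
  (forall i, sqint (h i)) -> sqint (fun x => \sum_(i <- s) h i x).
Proof.
move=> sh; elim: s => [|i s IH].
  by under eq_fun do rewrite big_nil; exact: sqint0.
by under eq_fun do rewrite big_cons; exact: sqintD.
Qed.

Lemma sqint_bounded f g M : measurable_fun setT g -> (forall x, `|g x| <= M) ->
  sqint f -> sqint (fun x => g x * f x).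
Proof.
move=> mg gM sf; have [mf _] := sf.
apply: (sqint_le (g := fun x => M * f x)); [by meas|exact: sqintZ|].
move=> x; rewrite !exprMn ler_wpM2r ?sqr_ge0// -(real_normK (num_real (g x))).
by rewrite ler_pXn2r ?nnegrE// (le_trans _ (gM x)).
Qed.

Definition nrm2 f : R := \int[mu]_x (f x ^+ 2).

Lemma nrm2_ge0 f : 0 <= nrm2 f.
Proof. by apply: Rintegral_ge0 => x _; exact: sqr_ge0. Qed.

Lemma nrm2E f : sqint f -> (\int[mu]_x (f x ^+ 2)%:E)%E = (nrm2 f)%:E.
Proof.
move=> sf; rewrite /nrm2 /Rintegral fineK//.
by rewrite ge0_fin_numE; [exact: sqint_lty|apply: integral_ge0 => x _; rewrite lee_fin sqr_ge0].
Qed.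

Lemma nrm2_comb a b f g : sqint f -> sqint g ->
  nrm2 (fun x => a * f x + b * g x) =
  a ^+ 2 * nrm2 f + a * b *+ 2 * \int[mu]_x (f x * g x) + b ^+ 2 * nrm2 g.
Proof.
move=> sf sg; have ifg := sqint_mul sf sg.
have [mf iff] := sf; have [mg ig] := sg.
rewrite /nrm2 -!RintegralZl// -!RintegralD//; last 4 first.
- by apply: integrableRD; exact: integrableRZ.
- exact: integrableRZ.
- exact: integrableRZ.
- exact: integrableRZ.
by apply: eq_Rintegral => x _; ring.
Qed.

(** The form [H] is nonnegative. If |g|^2 > 0, take a = |g|^2 and b = - C; if |g|^2 = 0, the choice
    a = C and b = - (|f|^2 + 1) forces C = 0. *)
Lemma cauchy_schwarz f g : sqint f -> sqint g ->
  (\int[mu]_x (f x * g x)) ^+ 2 <= nrm2 f * nrm2 g.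
Proof.
move=> sf sg; set C := \int[mu]_x _.
have H a b : 0 <= a ^+ 2 * nrm2 f + a * b *+ 2 * C + b ^+ 2 * nrm2 g.
  by rewrite -nrm2_comb//; exact: nrm2_ge0.
have A0 := nrm2_ge0 f; have := nrm2_ge0 g; rewrite le_eqVlt => /predU1P[B0|B0].
  rewrite -B0 mulr0; have := H C (- (nrm2 f + 1)); rewrite -B0.
  have := sqr_ge0 C; move: (nrm2 f) A0 => A A0; rewrite mulr2n.
  by move=> C2; have := mulr_ge0 A0 C2; nra.
have := H (nrm2 g) (- C); rewrite sqrrN mulr2n => H1.
rewrite -(ler_pM2l B0) -subr_ge0; apply: le_trans H1 _; rewrite le_eqVlt; apply/orP; left; apply/eqP; ring.
Qed.

End SquareIntegrable.

(** * Completeness of L^2 and Fubini's theorem *)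

Lemma limn_einf_le {R : realType} (u : (\bar R)^nat) (c : \bar R) :
  (\forall m \near \oo, (u m <= c)%E) -> (limn_einf u <= c)%E.
Proof.
move=> [N _ uc]; rewrite limn_einf_lim; apply: lime_le; first exact: is_cvg_einfs.
apply: nearW => n; apply: (@le_trans _ _ (u (maxn n N))).
  by apply: ereal_inf_lbound; exists (maxn n N) => //=; exact: leq_maxl.
by apply: uc; exact: leq_maxr.
Qed.

Section L2complete.
Context d (T : measurableType d) (R : realType).
Variable mu : {measure set T -> \bar R}.

(** Fatou's lemma for almost everywhere limits and an eventual bound. It carries L^2 estimates over
    to pointwise limits, here for completeness and later for the integral formula. *)
Lemma fatou_sqr (h : nat -> T -> R) (g : T -> R) (c : R) :
  (forall m, measurable_fun setT (h m)) -> measurable_fun setT g ->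
  {ae mu, forall x, h m x @[m --> \oo] --> g x} ->
  (\forall m \near \oo, (\int[mu]_x ((h m x) ^+ 2)%:E <= c%:E)%E) ->
  (\int[mu]_x (g x ^+ 2)%:E <= c%:E)%E.
Proof.
move=> mh mg hg hc.
apply: (@le_trans _ _ (\int[mu]_x limn_einf (fun m => (h m x ^+ 2)%:E))%E).
  apply: ae_ge0_le_integral => //.
  - by move=> x _; rewrite lee_fin sqr_ge0.
  - by apply/measurable_EFinP; meas.
  - move=> x _; rewrite limn_einf_lim; apply: lime_ge; first exact: is_cvg_einfs.
    by apply: nearW => n; apply/ereal_infP => _ [m _ <-]; rewrite lee_fin sqr_ge0.
  - rewrite (_ : (fun x => _) = (fun x => - limn_esup (fun m => - (h m x ^+ 2)%:E))%E)//.
    apply: measurableT_comp => //; apply: measurable_fun_limn_esup => m.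
    by apply: measurableT_comp => //; apply/measurable_EFinP; meas.
  - apply: filterS hg => x hx _; have H : ((h m x ^+ 2)%:E @[m --> \oo] --> (g x ^+ 2)%:E)%E.
      by apply: cvg_EFin; [exact: nearW|exact: (cvgM hx hx)].
    by rewrite (cvg_limn_einf_sup H).
apply: le_trans (limn_einf_le hc).
apply: fatou => //.
- by move=> n; apply/measurable_EFinP; meas.
- by move=> n x _; rewrite lee_fin sqr_ge0.
Qed.

Lemma nrm2_eq0 (f : T -> R) : sqint mu f -> nrm2 mu f = 0 ->
  {ae mu, forall x, f x = 0}.
Proof.
move=> sf f0; have [mf _] := sf.
have H : ae_eq mu setT (fun x => (f x ^+ 2)%:E) (cst 0%E).
  apply/ae_eq_integral_abs => //; first by apply/measurable_EFinP; meas.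
  under eq_integral do rewrite gee0_abs ?lee_fin ?sqr_ge0//.
  by rewrite nrm2E// f0.
apply: filterS H => x /= /(_ Logic.I) [] /eqP; rewrite expf_eq0/= => /eqP.
done.
Qed.

(* A subsequence with rapidly decreasing increments converges almost everywhere. *)
Lemma sqint_complete (f : nat -> T -> R) : (forall n, sqint mu (f n)) ->
  (forall e, 0 < e -> exists N, forall m n, (N <= m)%N -> (N <= n)%N ->
    nrm2 mu (fun x => f m x - f n x) <= e) ->
  exists2 g, sqint mu g & nrm2 mu (fun x => f n x - g x) @[n --> \oo] --> 0.
Proof.
move=> sf cf.
(* With these tolerances the weight 4^k in [S] leaves at most 2^-(k+1) for the k-th term, so [S] is
   integrable and hence finite almost everywhere. *)
pose e (k : nat) : R := (4 ^ k)%N%:R^-1 * (1 / (2 ^ k.+1)%N%:R).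
have e0 k : 0 < e k by rewrite mulr_gt0// ?invr_gt0 ?divr_gt0// ltr0n expn_gt0.
have /choice[N_ N_P] k := cf (e k) (e0 k).
pose n_ k := (\max_(i < k.+1) N_ i)%N.
have Nn k m : (k <= m)%N -> (N_ k <= n_ m)%N.
  by move=> km; rewrite /n_; exact: (leq_bigmax (Ordinal (km : k < m.+1)%N)).
pose u k := f (n_ k).
have su k : sqint mu (u k) by exact: sf.
have mu_ k : measurable_fun setT (u k) by have [] := su k.
pose dd k x := u k.+1 x - u k x.
have sd k : sqint mu (dd k) by exact: sqintB.
have md k : measurable_fun setT (dd k) by have [] := sd k.
have nd k : nrm2 mu (dd k) <= e k by apply: N_P; exact: Nn.
pose S x := (\sum_(0 <= k <oo) ((4 ^ k)%N%:R * dd k x ^+ 2)%:E)%E.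
have mt k : measurable_fun setT (fun x => ((4 ^ k)%N%:R * dd k x ^+ 2)%:E).
  by apply/measurable_EFinP; meas.
have t0 k x : (0 <= ((4 ^ k)%N%:R * dd k x ^+ 2)%:E)%E.
  by rewrite lee_fin mulr_ge0// sqr_ge0.
have S0 x : (0 <= S x)%E by apply: nneseries_ge0 => k _ _; exact: t0.
have mS : measurable_fun setT S by exact: ge0_emeasurable_sum.
have intS : mu.-integrable setT S.
  apply/integrableP; split => //; under eq_integral do rewrite gee0_abs//.
  rewrite integral_nneseries//; apply: (@le_lt_trans _ _ 1%:E); last exact: ltry.
  apply: le_trans (epsilon_trick0 xpredT (ler01 : 0 <= 1 :> R)).
  apply: lee_nneseries => [k _ _|k _]; first by apply: integral_ge0 => x _; exact: t0.
  under eq_integral do rewrite EFinM.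
  have md2 : measurable_fun setT (fun x => (dd k x ^+ 2)%:E).
    by apply/measurable_EFinP; meas.
  rewrite ge0_integralZl//; last by move=> x _; rewrite lee_fin sqr_ge0.
  rewrite nrm2E// -EFinM lee_fin.
  apply: le_trans (ler_wpM2l _ (nd k)) _; first by [].
  by rewrite /e mulVKf// pnatr_eq0 -lt0n expn_gt0.
pose A := [set x | (S x < +oo)%E].
have mA : measurable A by rewrite -[A]setTI; exact: emeasurable_fun_infty_o.
have aeA : {ae mu, forall x, A x}.
  have := integrable_ae measurableT intS; apply: filterS => x /(_ Logic.I).
  by rewrite /A/= ltey => /fin_numPlt/andP[_]; rewrite lt_neqAle => /andP[].
have uA x : A x -> cvgn (u ^~ x).
  move=> Ax.
  have c1 : cvgn (series (fun k => (4 ^ k)%N%:R * dd k x ^+ 2)).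
    by apply: nnseries_is_cvg => // k; have := t0 k x; rewrite lee_fin.
  have c2 : cvgn (series (geometric (1:R) (4^-1))).
    by apply: is_cvg_geometric_series; rewrite ger0_norm ?invr_ge0// invf_lt1// ltr1n.
  (* [|d| <= 4^-k + 4^k d^2] for every real d, so finiteness of [S x] makes the increments
     absolutely summable. *)
  have c3 : cvgn (series (dd ^~ x)).
    apply: normed_cvg; apply: series_le_cvg (is_cvg_seriesD c2 c1) => k //=.
      apply: addr_ge0; first by rewrite /geometric/= mul1r exprn_ge0// invr_ge0.
      by have := t0 k x; rewrite lee_fin.
    rewrite -[leRHS]/(1 * 4^-1 ^+ k + (4 ^ k)%:R * dd k x ^+ 2) mul1r natrX exprVn.
    have q0 : 0 < (4 : R) ^+ k by rewrite exprn_gt0.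
    have q : (2 ^+ k) ^+ 2 = (4 : R) ^+ k by rewrite exprAC; congr (_ ^+ _); ring.
    rewrite -(ler_pM2l q0) mulrDr mulfV ?gt_eqF// -q -(real_normK (num_real (dd k x))).
    have := sqr_ge0 ((2 ^+ k : R) ^+ 2 * `|dd k x| - 1).
    have := normr_ge0 (dd k x); have := sqr_ge0 ((2 ^+ k : R) ^+ 2 * `|dd k x|).
    by rewrite -exprM; nra.
  rewrite (_ : u ^~ x = fun k => u 0%N x + series (dd ^~ x) k).
    by apply: is_cvgD => //; exact: is_cvg_cst.
  apply/funext => k; elim: k => [|k IH]; first by rewrite /series/= big_geq// addr0.
  by rewrite seriesSr addrA -IH /dd addrC subrK.
(* Multiplication by the indicator gives convergence at every point, so that the limit is
   measurable. *)
pose v k x := \1_A x * u k x.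
have mv k : measurable_fun setT (v k) by apply: measurable_funM => //; exact: measurable_indic.
pose g x := limn (v ^~ x).
have vg x : v k x @[k --> \oo] --> g x.
  rewrite /g; have [Ax|Ax] := pselect (A x).
    suff : cvgn (v ^~ x) by [].
    apply: is_cvgM; [exact: is_cvg_cst|exact: uA].
  have -> : v ^~ x = fun=> 0.
    by apply/funext => k; rewrite /v indicE memNset// mul0r.
  by rewrite lim_cst//; exact: cvg_cst.
have mg : measurable_fun setT g.
  by apply: (@measurable_fun_cvg _ _ _ _ v) => // x _.
have ug : {ae mu, forall x, u k x @[k --> \oo] --> g x}.
  apply: filterS aeA => x Ax; have := vg x.
  by under eq_fun do rewrite /v indicE mem_set// mul1r.
(* Letting m tend to infinity in [f n - u m], Fatou's lemma turns the Cauchy estimate into an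
   estimate of [f n - g]. *)
have key k n : (N_ k <= n)%N -> (\int[mu]_x ((f n x - g x) ^+ 2)%:E <= (e k)%:E)%E.
  move=> kn; apply: (@fatou_sqr (fun m x => f n x - u m x)).
  - by move=> m; have [? _] := sf n; meas.
  - by have [? _] := sf n; meas.
  - by apply: filterS ug => x ux; apply: cvgB => //; exact: cvg_cst.
  - exists k => // m /= km; rewrite nrm2E ?lee_fin; last exact: sqintB.
    by apply: N_P => //; exact: Nn.
have sB n : (exists k, (N_ k <= n)%N) -> sqint mu (fun x => f n x - g x).
  move=> [k kn]; apply: sqintP; first by have [? _] := sf n; meas.
  by apply: le_lt_trans (key _ _ kn) _; exact: ltry.
have sg : sqint mu g.
  have := sqintB (sf (N_ 0%N)) (sB (N_ 0%N) (ex_intro _ 0%N (leqnn _))).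
  by under eq_fun do rewrite opprB addrC subrK.
exists g => //; apply/cvgrPdist_le => eps eps0.
have [k ke] : exists k, e k <= eps.
  have H : (4^-1 : R) ^+ n @[n --> \oo] --> 0.
    by apply: cvg_expr; rewrite ger0_norm ?invr_ge0// invf_lt1// ltr1n.
  have /cvgrPdist_le/(_ _ eps0)[k _ /(_ k (leqnn k))/=] := H.
  rewrite sub0r normrN ger0_norm ?exprn_ge0 ?invr_ge0// => H1; exists k.
  apply: le_trans H1; rewrite /e natrX exprVn ler_piMr ?invr_ge0 ?exprn_ge0//.
  by rewrite div1r invf_le1 ?ltr0n ?expn_gt0// ler1n expn_gt0.
exists (N_ k) => // n /= kn; rewrite sub0r normrN ger0_norm ?nrm2_ge0//.
apply: le_trans ke; rewrite -lee_fin -nrm2E; last by apply: sB; exists k.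
exact: key.
Qed.

End L2complete.

Section FubiniReal.
Context d1 d2 (T1 : measurableType d1) (T2 : measurableType d2) (R : realType).
Variable m1 : {sigma_finite_measure set T1 -> \bar R}.
Variable m2 : {sigma_finite_measure set T2 -> \bar R}.
Implicit Type f : T1 * T2 -> R.

(** Tonelli's theorem applies to the positive and to the negative part; where the integral is
    infinite, [fine] supplies the value 0. *)
Lemma measurable_Rintegral_param f : measurable_fun setT f ->
  measurable_fun setT (fun x => \int[m2]_y f (x, y)).
Proof.
move=> mf; have mf' : measurable_fun setT (EFin \o f) by exact/measurable_EFinP.
rewrite /Rintegral; apply: (measurableT_comp (fine_measurable measurableT)).
under eq_fun do rewrite integralE.
apply: emeasurable_funB.
  have := measurable_fun_fubini_tonelli_F (m2 := m2) _ (measurable_funepos mf') (fun=> funepos_ge0 _ _).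
  by apply: eq_measurable_fun => x _; apply: eq_integral => y _; rewrite !funeposE.
have := measurable_fun_fubini_tonelli_F (m2 := m2) _ (measurable_funeneg mf') (fun=> funeneg_ge0 _ _).
by apply: eq_measurable_fun => x _; apply: eq_integral => y _; rewrite !funenegE.
Qed.

Lemma integrable_prod_le f (C : T1 -> R) : measurable_fun setT f ->
  m1.-integrable setT (EFin \o C) ->
  (forall x, (\int[m2]_y `|f (x, y)|%:E <= (C x)%:E)%E) ->
  (m1 \x m2)%E.-integrable setT (EFin \o f).
Proof.
move=> mf iC fC; have mf' : measurable_fun setT (EFin \o f) by exact/measurable_EFinP.
apply/integrable12ltyP => //.
apply: le_lt_trans (integrable_lty measurableT iC).
apply: ge0_le_integral => //.
- by move=> x _; apply: integral_ge0.
- have := measurable_fun_fubini_tonelli_F (m2 := m2) (abse \o (EFin \o f)) (measurableT_comp (abse_measurable (D := setT)) mf') (fun=> abse_ge0 _).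
  by apply: eq_measurable_fun => x _.
- exact: measurable_int iC.
- by move=> x _; exact: fC.
Qed.

Lemma integrable_prod_mul f (u : T1 -> R) (v : T2 -> R) M : measurable_fun setT f ->
  m1.-integrable setT (EFin \o u) -> m2.-integrable setT (EFin \o v) ->
  (forall p, `|f p| <= M * (`|u p.1| * `|v p.2|)) ->
  (m1 \x m2)%E.-integrable setT (EFin \o f).
Proof.
move=> mf iu iv fuv.
have mv : measurable_fun setT v by exact/measurable_EFinP/(measurable_int _ iv).
apply: (@integrable_prod_le _ (fun x => M * `|u x| * \int[m2]_y `|v y|)) => //.
  have -> : EFin \o (fun x => M * `|u x| * \int[m2]_y `|v y|) =
     EFin \o (fun x => (M * \int[m2]_y `|v y|) * `|u x|).
    by apply/funext => x /=; rewrite -mulrA mulrCA [in RHS]mulrC mulrA mulrC.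
  by apply: integrableRZ; exact: integrable_norm.
move=> x.
have iv' := integrable_norm iv.
have i2 : m2.-integrable setT (EFin \o (fun y => (M * `|u x|) * `|v y|)).
  exact: integrableRZ.
rewrite -RintegralZl// /Rintegral fineK; last exact: integrable_fin_num.
apply: ge0_le_integral => //.
- apply/measurable_EFinP; apply: measurableT_comp => //.
  exact: measurableT_comp mf (pair1_measurable x).
- exact: measurable_int i2.
- by move=> y _; rewrite lee_fin -mulrA; exact: fuv.
Qed.

(** [Rintegral] is [fine] of an extended integral. Integrability of every section, and not just of
    almost every one, lets the inner [fine] be removed pointwise. *)
Lemma Rfubini f : (m1 \x m2)%E.-integrable setT (EFin \o f) ->
  (forall x, m2.-integrable setT (EFin \o (fun y => f (x, y)))) ->
  (forall y, m1.-integrable setT (EFin \o (fun x => f (x, y)))) ->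
  \int[m1]_x \int[m2]_y f (x, y) = \int[m2]_y \int[m1]_x f (x, y).
Proof.
move=> iff i2 i1; have := Fubini iff => H.
rewrite [LHS]/Rintegral [RHS]/Rintegral; congr fine.
transitivity (\int[m1]_x \int[m2]_y (EFin \o f) (x, y))%E.
  by apply: eq_integral => x _; rewrite /Rintegral fineK//; exact: (integrable_fin_num _ (i2 x)).
rewrite H; apply: eq_integral => y _; rewrite /Rintegral fineK//; exact: (integrable_fin_num _ (i1 y)).
Qed.

End FubiniReal.

(** * Differentiation rules and Gaussian integrals *)

Section DeriveRules.
Variable R : realType.
Implicit Types f g : R -> R.

(** These rules are phrased for explicit abstractions and real multiplication, so that the
    derivative of a composite expression can be assembled as one term. *)
Lemma is_derive_add f g (x a b : R) : is_derive x 1 f a -> is_derive x 1 g b ->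
  is_derive x 1 (fun y => f y + g y) (a + b).
Proof. by move=> ? ?; exact: is_deriveD. Qed.

Lemma is_derive_sub f g (x a b : R) : is_derive x 1 f a -> is_derive x 1 g b ->
  is_derive x 1 (fun y => f y - g y) (a - b).
Proof. by move=> ? ?; exact: is_deriveB. Qed.

Lemma is_derive_opp f (x a : R) : is_derive x 1 f a ->
  is_derive x 1 (fun y => - f y) (- a).
Proof. by move=> ?; exact: is_deriveN. Qed.

Lemma is_derive_mul f g (x a b : R) : is_derive x 1 f a -> is_derive x 1 g b ->
  is_derive x 1 (fun y => f y * g y) (a * g x + f x * b).
Proof.
move=> H1 H2; have H := @is_deriveM _ _ f g x 1 a b H1 H2.
by apply: is_derive_eq H _; rewrite addrC [g x *: _]mulrC.
Qed.

Lemma is_derive_scale (c : R) f (x a : R) : is_derive x 1 f a ->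
  is_derive x 1 (fun y => c * f y) (c * a).
Proof.
move=> H; have := is_derive_mul (is_derive_cst c x 1) H.
by rewrite mul0r add0r.
Qed.

Lemma is_derive_comp f g (x a b : R) : is_derive (g x) 1 f a ->
  is_derive x 1 g b -> is_derive x 1 (fun y => f (g y)) (a * b).
Proof. exact: is_derive1_comp. Qed.

Lemma is_derive_exp f (x a : R) : is_derive x 1 f a ->
  is_derive x 1 (fun y => expR (f y)) (expR (f x) * a).
Proof. exact: is_derive_comp. Qed.

Lemma is_derive_cosf f (x a : R) : is_derive x 1 f a ->
  is_derive x 1 (fun y => cos (f y)) (- sin (f x) * a).
Proof. exact: is_derive_comp. Qed.

Lemma is_derive_sinf f (x a : R) : is_derive x 1 f a ->
  is_derive x 1 (fun y => sin (f y)) (cos (f x) * a).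
Proof. exact: is_derive_comp. Qed.

Lemma is_derive_sqr (x : R) : is_derive x 1 (fun y => y ^+ 2) (2 * x).
Proof.
have := is_derive_mul (is_derive_id x 1) (is_derive_id x 1).
by move=> H; apply: (is_derive_eq H); rewrite mul1r mulr1 mulr_natl mulr2n.
Qed.

Lemma is_derive_continuous f (x a : R) : is_derive x 1 f a -> {for x, continuous f}.
Proof. by move=> [d _]; apply: differentiable_continuous; exact/derivable1_diffP. Qed.

End DeriveRules.

Section IntegralDerivative.
Variable R : realType.
Local Notation mu := (@lebesgue_measure R).

Lemma cvg_Rintegral_itv (f : R -> R) : mu.-integrable setT (EFin \o f) ->
  \int[mu]_(x in `[- n%:R, n%:R]) f x @[n --> \oo] --> \int[mu]_x f x.
Proof.
move=> iff.
have mf : measurable_fun setT f by apply/measurable_EFinP; exact: measurable_int iff.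
under eq_fun do rewrite Rintegral_mkcond.
pose f_ n := (EFin \o (f \_ `[- n%:R, n%:R])) : measurableTypeR R -> \bar R.
have mf_ n : measurable_fun setT (f_ n).
  by apply/measurable_EFinP/measurable_restrict => //; exact: measurable_funTS.
have cf_ : {ae mu, forall x : measurableTypeR R, setT x -> f_ ^~ x @ \oo --> (EFin \o f) x}.
  apply/aeW => x _; apply: cvg_EFin; first exact: nearW.
  apply: cvg_near_cst; near=> n; rewrite /f_/= patchE mem_set//= in_itv/=.
  by rewrite -ler_norml; near: n; exact: nbhs_infty_ger.
have [||] := @dominated_convergence _ _ _ mu _ measurableT f_ (EFin \o f) (abse \o (EFin \o f))
  mf_ (measurable_int _ iff) cf_.
- exact: integrable_abse.
- apply/aeW => x n _; rewrite /f_/= patchE; case: ifP => // _.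
  by rewrite (_ : point = 0 :> R)// normr0 lee_fin.
move=> _ _ H; apply: fine_cvg; rewrite fineK//.
exact: (integrable_fin_num measurableT iff).
Unshelve. all: by end_near. Qed.

(** By the fundamental theorem the integral over [[-n, n]] is [F n - F (- n)]. This is the form in
    which integration by parts is used. *)
Lemma Rintegral_derive0 (F f : R -> R) : (forall x : R, is_derive x 1 F (f x)) ->
  continuous f -> mu.-integrable setT (EFin \o f) ->
  F n%:R @[n --> \oo] --> 0 -> F (- n%:R) @[n --> \oo] --> 0 ->
  \int[mu]_x f x = 0.
Proof.
move=> dF cf iff F1 F2.
have H := cvg_Rintegral_itv iff.
suff K : \int[mu]_(x in `[- n%:R, n%:R]) f x @[n --> \oo] --> 0.
  exact: (cvg_unique _ H K).
have : F n%:R - F (- n%:R) @[n --> \oo] --> 0.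
  by rewrite -[X in _ --> X](subrr 0); exact: cvgB.
apply: cvg_trans; apply: near_eq_cvg; near=> n.
have n0 : (0 < n)%N by near: n; exact: nbhs_infty_gt.
rewrite /Rintegral (@continuous_FTC2 _ f F)//.
- by rewrite -subr_gt0 opprK addr_gt0// ltr0n.
- exact: continuous_subspaceT.
- have cF x : {for x, continuous F} by exact: is_derive_continuous (dF x).
  split.
  + by move=> x _; have [] := dF x.
  + by apply: cvg_at_right_filter; exact: cF.
  + by apply: cvg_at_left_filter; exact: cF.
- by move=> x _; rewrite derive1E; have [_ ->] := dF x.
Unshelve. all: by end_near. Qed.

End IntegralDerivative.

Section GaussianBounds.
Variable R : realType.
Local Notation mu := (@lebesgue_measure R).

(** [|x|^k <= 1 + (x^2)^(k+1)], and the term of order k+1 of the exponential series bounds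
    [(b x^2)^(k+1) / (k+1)!] by [expR (b x^2)]. *)
Lemma norm_pow_le_exp (k : nat) (b : R) : 0 < b ->
  exists2 C, 0 <= C & forall x, `|x| ^+ k <= C * expR (b * x ^+ 2).
Proof.
move=> b0; exists (1 + k.+1`!%:R / b ^+ k.+1).
  by rewrite addr_ge0// divr_ge0// exprn_ge0// ltW.
move=> x.
have H1 : `|x| ^+ k <= 1 + (x ^+ 2) ^+ k.+1.
  have x2 : (x ^+ 2) ^+ k.+1 = (`|x| ^+ k.+1) ^+ 2 by rewrite -(real_normK (num_real x)) exprAC.
  rewrite x2; have [x1|x1] := leP `|x| 1.
    apply: (le_trans (exprn_ile1 _ _ _)) => //; by rewrite lerDl sqr_ge0.
  have H : `|x| ^+ k <= `|x| ^+ k.+1 by rewrite ler_weXn2l// ltW.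
  apply: (le_trans H); have := sqr_ge0 (`|x| ^+ k.+1 - 1); have : 0 <= `|x| ^+ k.+1 by rewrite exprn_ge0.
  by nra.
have H2 : (x ^+ 2) ^+ k.+1 <= k.+1`!%:R / b ^+ k.+1 * expR (b * x ^+ 2).
  have y0 : 0 <= b * x ^+ 2 by rewrite mulr_ge0 ?sqr_ge0// ltW.
  have := expR_ge1Dxn k y0; rewrite exprMn => H.
  have bk : 0 < b ^+ k.+1 by rewrite exprn_gt0.
  rewrite mulrAC ler_pdivlMr// mulrC.
  rewrite -ler_pdivrMl ?ltr0n ?fact_gt0// mulrC.
  by apply: le_trans H; rewrite [leLHS]mulrC [X in X / _]mulrC lerDr.
rewrite mulrDl mul1r; apply: (le_trans H1); apply: lerD => //.
by rewrite -expR0 ler_expR mulr_ge0 ?sqr_ge0// ltW.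
Qed.

Lemma poly_le_exp (p : {poly R}) (b : R) : 0 < b ->
  exists2 C, 0 <= C & forall x, `|p.[x]| <= C * expR (b * x ^+ 2).
Proof.
move=> b0; have /choice[C CP] (k : nat) : exists C, 0 <= C /\ forall x, `|x| ^+ k <= C * expR (b * x ^+ 2).
  by have [C C0 CP] := norm_pow_le_exp k b0; exists C.
exists (\sum_(i < size p) `|p`_i| * C i).
  by apply: sumr_ge0 => i _; rewrite mulr_ge0//; have [] := CP i.
move=> x; rewrite horner_coef mulr_suml (le_trans (ler_norm_sum _ _ _))//.
apply: ler_sum => i _; rewrite normrM normrX -mulrA ler_wpM2l//.
by have [] := CP i.
Qed.

Lemma integral_gauss_scaled (b : R) : 0 < b ->
  (\int[mu]_x (expR (- (b * x ^+ 2)))%:E)%E = (Num.sqrt (pi / b))%:E.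
Proof.
move=> b0; have sb0 : 0 < Num.sqrt b by rewrite sqrtr_gt0.
transitivity (\int[mu]_x (gauss_fun (Num.sqrt b * x + 0))%:E)%E.
  by apply: eq_integral => x _; rewrite /gauss_fun addr0 exprMn sqr_sqrtr// ltW.
rewrite (@ge0_integral_affine _ _ _ (EFin \o gauss_fun)) ?gt_eqF//; last 2 first.
- by apply/measurable_EFinP; exact: measurable_gauss_fun.
- by move=> x; rewrite lee_fin gauss_fun_ge0.
rewrite integralT_gauss -EFinM gtr0_norm// mulrC sqrtrM ?pi_ge0//.
by rewrite sqrtrV// ltW.
Qed.

Lemma integrable_gauss_scaled (b : R) : 0 < b ->
  mu.-integrable setT (EFin \o (fun x => expR (- (b * x ^+ 2)))).
Proof.
move=> b0; apply/integrableP; split; first by apply/measurable_EFinP; meas.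
under eq_integral do rewrite /= ger0_norm ?expR_ge0//.
by rewrite integral_gauss_scaled// ltry.
Qed.

Lemma Rintegral_gauss (b : R) : 0 < b ->
  \int[mu]_x expR (- (b * x ^+ 2)) = Num.sqrt (pi / b).
Proof. by move=> b0; rewrite /Rintegral integral_gauss_scaled. Qed.

(** Half of the Gaussian exponent absorbs the polynomial. *)
Lemma poly_gauss_le (p : {poly R}) (b : R) : 0 < b ->
  exists2 C, 0 <= C & forall x, `|p.[x] * expR (- (b * x ^+ 2))| <= C * expR (- (b / 2 * x ^+ 2)).
Proof.
move=> b0; have b2 : 0 < b / 2 by rewrite divr_gt0.
have [C C0 CP] := poly_le_exp p b2; exists C => // x.
rewrite normrM (ger0_norm (expR_ge0 _)).
apply: (le_trans (ler_wpM2r (expR_ge0 _) (CP x))).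
by rewrite -[leLHS]mulrA -expRD; apply: ler_wpM2l => //; rewrite ler_expR; nra.
Qed.

Lemma measurable_horner (p : {poly R}) : measurable_fun setT (fun x : R => p.[x]).
Proof.
apply: continuous_measurable_fun => x.
exact: (is_derive_continuous (is_derive_poly p x)).
Qed.

Lemma integrable_poly_gauss (p : {poly R}) (b : R) : 0 < b ->
  mu.-integrable setT (EFin \o (fun x => p.[x] * expR (- (b * x ^+ 2)))).
Proof.
move=> b0; have [C C0 CP] := poly_gauss_le p b0.
apply: (@integrableR_le _ _ _ mu _ (fun x => C * expR (- (b / 2 * x ^+ 2)))) => //.
  by have := measurable_horner p => ?; meas.
by apply: integrableRZ; apply: integrable_gauss_scaled; rewrite divr_gt0.
Qed.

(** The hypothesis on [u] covers both ends of the line, [n] and [- n], at once. *)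
Lemma cvg_gauss_scaled (b : R) (u : nat -> R) : 0 < b -> (forall n, `|u n| = n%:R) ->
  expR (- (b * u n ^+ 2)) @[n --> \oo] --> 0.
Proof.
move=> b0 un; apply/cvgrPdist_lt => e e0; near=> n.
rewrite sub0r normrN ger0_norm ?expR_ge0// expRN -[ltRHS]invrK ltf_pV2 ?posrE ?expR_gt0 ?invr_gt0//.
apply: (@lt_le_trans _ _ (1 + b * u n ^+ 2)); last exact: expR_ge1Dx.
rewrite -(real_normK (num_real (u n))) un.
have n1 : (1 <= n%:R :> R) by rewrite ler1n; near: n; exact: nbhs_infty_gt.
have n2 : e^-1 / b <= n%:R by near: n; exact: nbhs_infty_ger.
have : e^-1 <= b * n%:R by rewrite mulrC -ler_pdivrMr.
by have := mulr_ge0 (ltW b0) (ltW (lt_le_trans ltr01 n1)); nra.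
Unshelve. all: by end_near. Qed.

Lemma cvg_poly_gauss (p : {poly R}) (b : R) (u : nat -> R) : 0 < b ->
  (forall n, `|u n| = n%:R) ->
  p.[u n] * expR (- (b * u n ^+ 2)) @[n --> \oo] --> 0.
Proof.
move=> b0 un; have [C C0 CP] := poly_gauss_le p b0.
have b2 : 0 < b / 2 by rewrite divr_gt0.
apply: norm_cvg0.
have H : C * expR (- (b / 2 * u n ^+ 2)) @[n --> \oo] --> 0.
  by rewrite -(mulr0 C); apply: cvgM; [exact: cvg_cst|exact: cvg_gauss_scaled].
apply: (@squeeze_cvgr _ _ _ _ (cst 0) _ _ _ _ _ H); last exact: cvg_cst.
by apply: nearW => n; rewrite normr_ge0/= CP.
Qed.

(** The integrand is the derivative of p(x) e^(- b x^2). The operator p -> p' - 2 b X p is the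
    recursion step of [hpoly (b *+ 2)]. *)
Lemma Rintegral_poly_gauss_by_parts (p : {poly R}) (b : R) : 0 < b ->
  \int[mu]_x ((p^`() - b *+ 2 *: 'X * p).[x] * expR (- (b * x ^+ 2))) = 0.
Proof.
move=> b0; pose F x := p.[x] * expR (- (b * x ^+ 2)).
apply: (@Rintegral_derive0 _ F).
- move=> x; rewrite /F.
  have H := is_derive_mul (is_derive_poly p x) (is_derive_exp (is_derive_opp (is_derive_scale b (is_derive_sqr x)))).
  apply: is_derive_eq H _.
  by rewrite hornerD hornerN hornerM hornerZ hornerX; ring.
- move=> x; apply: cvgM.
    exact: (is_derive_continuous (is_derive_poly _ x)).
  exact: (is_derive_continuous (is_derive_exp (is_derive_opp (is_derive_scale b (is_derive_sqr x))))).
- exact: integrable_poly_gauss.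
- by apply: (cvg_poly_gauss p b0) => n; rewrite normr_nat.
- by apply: (cvg_poly_gauss p b0) => n; rewrite normrN normr_nat.
Qed.

End GaussianBounds.

(** * Fourier transform of a Gaussian *)

(** The domination is only required near [a]: the Bargmann kernel is unbounded in its parameter, and
    only a local bound is available for it. *)
Lemma is_derive_under_integral {R : realType} d (T : measurableType d)
    (mu : {measure set T -> \bar R}) (f df : R -> T -> R) (G : T -> R) (a : R) :
  (forall x, `|x - a| < 1 -> mu.-integrable setT (EFin \o f x)) ->
  (forall x y, `|x - a| < 1 -> is_derive x (1 : R) (f ^~ y) (df x y)) ->
  (forall y, 0 <= G y) -> mu.-integrable setT (EFin \o G) ->
  (forall x y, `|x - a| < 1 -> `|df x y| <= G y) ->
  is_derive a (1 : R) (fun x => \int[mu]_y f x y) (\int[mu]_y df a y).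
Proof.
move=> iff dfd G0 iG dG.
have ab x : `]a - 1, a + 1[%classic x -> `|x - a| < 1.
  by rewrite /= in_itv/= => /andP[? ?]; rewrite ltr_norml; apply/andP; split; lra.
have Ia : `]a - 1, a + 1[%classic a by rewrite /= in_itv/=; apply/andP; split; lra.
have dE x y : `|x - a| < 1 -> partial1of2 f x y = df x y.
  by move=> xa; rewrite partial1of2E; have [_ ->] := dfd x y xa.
have H1 x : `]a - 1, a + 1[%classic x -> mu.-integrable setT (EFin \o f x) by move=> /ab /iff.
have H2 x y : `]a - 1, a + 1[%classic x -> setT y -> derivable (f ^~ y) x 1.
  by move=> /ab xa _; have [] := dfd x y xa.
have H3 x y : `]a - 1, a + 1[%classic x -> setT y -> `|partial1of2 f x y| <= G y.
  by move=> /ab xa _; rewrite dE//; exact: dG.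
apply: DeriveDef.
  exact: (derivable_under_integral measurableT Ia H1 H2 G0 iG H3).
rewrite -derive1E (differentiation_under_integral measurableT Ia H1 H2 G0 iG H3).
by apply: eq_Rintegral => y _; rewrite dE// subrr normr0.
Qed.

Section GaussianFourier.
Variable R : realType.
Local Notation mu := (@lebesgue_measure R).
Variable a : R.
Hypothesis a0 : 0 < a.

Let Phi (u : R) := \int[mu]_w (expR (- (a * w ^+ 2)) * cos (2 * pi * w * u)).
Let Psi (u : R) := \int[mu]_w ((2 * pi * w) * expR (- (a * w ^+ 2)) * sin (2 * pi * w * u)).

Let iG : mu.-integrable setT (EFin \o (fun w : R => (2 * pi) * `|w * expR (- (a * w ^+ 2))|)).
Proof.
apply: integrableRZ; apply: integrable_norm.
by have := integrable_poly_gauss 'X a0; under eq_fun do rewrite hornerX.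
Qed.

Let i1 (u : R) : mu.-integrable setT
  (EFin \o (fun w : R => (2 * pi * w) * expR (- (a * w ^+ 2)) * sin (2 * pi * w * u))).
Proof.
apply: (integrableR_le _ _ iG); first by meas.
move=> w; rewrite !normrM (ger0_norm (pi_ge0 R)) (ger0_norm (ler0n R 2)) -!mulrA.
by rewrite !ler_wpM2l ?pi_ge0// ler_piMr ?sin_max.
Qed.

Let p0 : (pi : R) != 0.
Proof. by rewrite gt_eqF// pi_gt0. Qed.

Let dPhi (u : R) : is_derive u (1 : R) Phi (- Psi u).
Proof.
have -> : - Psi u = \int[mu]_w (expR (- (a * w ^+ 2)) * (- sin (2 * pi * w * u) * (2 * pi * w))).
  rewrite /Psi -mulN1r -RintegralZl//; first by apply: eq_Rintegral => w _; ring.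
apply: (@is_derive_under_integral _ _ _ mu (fun u w => expR (- (a * w ^+ 2)) * cos (2 * pi * w * u)) (fun u w => expR (- (a * w ^+ 2)) * (- sin (2 * pi * w * u) * (2 * pi * w))) (fun w : R => (2 * pi) * `|w * expR (- (a * w ^+ 2))|)) => //.
- move=> x _; apply: (integrableR_le _ _ (integrable_gauss_scaled a0)); first by meas.
  by move=> w; rewrite normrM (ger0_norm (expR_ge0 _)) ler_piMr ?cos_max ?expR_ge0.
- move=> x w _; apply: is_derive_scale; apply: is_derive_cosf.
  by apply: is_derive_eq (is_derive_scale (2 * pi * w) (is_derive_id x 1)) _; rewrite mulr1.
- by move=> w; rewrite mulr_ge0// mulr_ge0// pi_ge0.
- move=> x w _; rewrite !normrM normrN (ger0_norm (pi_ge0 R)) (ger0_norm (ler0n R 2)).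
  rewrite [leLHS](_ : _ = `|sin (2 * pi * w * x)| * (2 * pi * (`|w| * `|expR (- (a * w ^+ 2))|))); last by ring.
  by rewrite ler_piMl ?sin_max// !mulr_ge0 ?pi_ge0.
Qed.

(** Integration of the derivative of e^(- a w^2) sin(2 pi w u), which vanishes at both ends. *)
Let Psi_Phi (u : R) : Psi u = 2 * (pi ^+ 2 / a) * u * Phi u.
Proof.
pose F w := expR (- (a * w ^+ 2)) * sin (2 * pi * w * u).
pose f w := expR (- (a * w ^+ 2)) * (- (a * (2 * w))) * sin (2 * pi * w * u) + expR (- (a * w ^+ 2)) * (cos (2 * pi * w * u) * (2 * pi * u)).
have i2 : mu.-integrable setT (EFin \o (fun w : R => expR (- (a * w ^+ 2)) * cos (2 * pi * w * u))).
  apply: (integrableR_le _ _ (integrable_gauss_scaled a0)); first by meas.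
  by move=> w; rewrite normrM (ger0_norm (expR_ge0 _)) ler_piMr ?cos_max ?expR_ge0.
have fE : f = fun w => (- (a / pi)) * ((2 * pi * w) * expR (- (a * w ^+ 2)) * sin (2 * pi * w * u)) +
    (2 * pi * u) * (expR (- (a * w ^+ 2)) * cos (2 * pi * w * u)).
  by apply/funext => w; rewrite /f; move: (p0); move: (pi : R) => P P0; field.
have if_ : mu.-integrable setT (EFin \o f).
  by rewrite fE; apply: integrableRD; exact: integrableRZ.
have cs (x : R) : is_derive x (1:R) (fun w => 2 * pi * w * u) (2 * pi * u).
  have := is_derive_mul (is_derive_scale (2 * pi) (is_derive_id x 1)) (is_derive_cst u x 1).
  by move=> H; apply: is_derive_eq H _; rewrite mulr1 mulr0 addr0.
have ce (x : R) : is_derive x (1:R) (fun w => expR (- (a * w ^+ 2))) (expR (- (a * x ^+ 2)) * (- (a * (2 * x)))).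
  by apply: is_derive_exp; apply: is_derive_opp; apply: is_derive_scale; exact: is_derive_sqr.
have dF (x : R) : is_derive x (1:R) F (f x).
  by apply: is_derive_mul => //; exact: is_derive_sinf.
have sq (v : nat -> R) : (forall n, `|v n| = n%:R) -> F (v n) @[n --> \oo] --> 0.
  move=> vn; apply: norm_cvg0.
  apply: (@squeeze_cvgr _ _ _ _ (cst 0) _ _ _ _ _ (cvg_gauss_scaled a0 vn)); last exact: cvg_cst.
  apply: nearW => n; rewrite normr_ge0/= normrM (ger0_norm (expR_ge0 _)).
  by rewrite ler_piMr ?sin_max ?expR_ge0.
have : \int[mu]_w f w = 0.
  apply: (Rintegral_derive0 dF) => //.
  - move=> x; rewrite fE; apply: cvgD; apply: cvgM; try exact: cvg_cst.
      apply: cvgM; last exact: (is_derive_continuous (is_derive_sinf (cs x))).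
      apply: cvgM; last exact: (is_derive_continuous (ce x)).
      by apply: cvgM; [exact: cvg_cst|exact: cvg_id].
    apply: cvgM; first exact: (is_derive_continuous (ce x)).
    exact: (is_derive_continuous (is_derive_cosf (cs x))).
  - by apply: (sq (fun n => n%:R)) => n; rewrite normr_nat.
  - by apply: (sq (fun n => - n%:R)) => n; rewrite normrN normr_nat.
rewrite fE RintegralD//; [|exact: integrableRZ|exact: integrableRZ].
rewrite !RintegralZl// -/(Phi u) -/(Psi u) => H.
have a1 : a != 0 by rewrite gt_eqF.
have : (a / pi) * Psi u = 2 * pi * u * Phi u by lra.
move=> /(congr1 (fun x => (pi / a) * x)) H2.
have -> : Psi u = pi / a * (a / pi * Psi u) by move: (p0); move: (pi : R) (Psi u) => P Q P0; field; rewrite a1 P0.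
by rewrite H2; move: (pi : R) (Phi u) => P Q; field.
Qed.

(* The transform Phi satisfies Phi' = - 2 (pi^2 / a) u Phi. *)
Lemma fourier_gauss (u : R) :
  \int[mu]_w (expR (- (a * w ^+ 2)) * cos (2 * pi * w * u)) =
  Num.sqrt (pi / a) * expR (- (pi ^+ 2 / a * u ^+ 2)).
Proof.
(* [E] is [Phi] divided by the expected Gaussian; the differential equation makes it constant. *)
pose E u := expR (pi ^+ 2 / a * u ^+ 2) * Phi u.
have dE (x : R) : is_derive x (1:R) E 0.
  have H := is_derive_mul (is_derive_exp (is_derive_scale (pi ^+ 2 / a) (is_derive_sqr x))) (dPhi x).
  by apply: is_derive_eq H _; rewrite Psi_Phi; ring.
have EE : E u = E 0 by exact: is_derive_0_is_cst.
have E0 : E 0 = Num.sqrt (pi / a).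
  rewrite /E expr0n mulr0 expR0 mul1r -(Rintegral_gauss a0).
  by apply: eq_Rintegral => w _; rewrite mulr0 cos0 mulr1.
rewrite -/(Phi u) -E0 -EE /E mulrC mulrA -expRD addNr expR0 mul1r//.
Qed.

End GaussianFourier.

(** * Plancherel's theorem *)

Lemma Rdominated_cvg d (T : measurableType d) (R : realType)
    (mu : {measure set T -> \bar R}) (f_ : nat -> T -> R) (f g : T -> R) :
  (forall n, measurable_fun setT (f_ n)) -> measurable_fun setT f ->
  {ae mu, forall x, f_ n x @[n --> \oo] --> f x} ->
  mu.-integrable setT (EFin \o g) -> (forall n x, `|f_ n x| <= g x) ->
  \int[mu]_x f_ n x @[n --> \oo] --> \int[mu]_x f x.
Proof.
move=> mf_ mf cf ig fg.
have mf_' n : measurable_fun setT (EFin \o f_ n) by exact/measurable_EFinP.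
have mf' : measurable_fun setT (EFin \o f) by exact/measurable_EFinP.
have [||] := @dominated_convergence _ _ _ mu _ measurableT (fun n => EFin \o f_ n)
  (EFin \o f) (EFin \o g) mf_' mf' _ ig.
- by apply: filterS cf => x cx _; apply: cvg_EFin; [exact: nearW|].
- by apply/aeW => x n _; rewrite /= lee_fin.
move=> iff _ H; apply: fine_cvg; rewrite fineK//.
exact: (integrable_fin_num measurableT iff).
Qed.

Section Plancherel.
Variable R : realType.
Local Notation mu := (@lebesgue_measure R).
Implicit Types F G : R -> R.

(** The Fourier transform of F at w is [cosT F w - i sinT F w]. *)
Definition cosT F (w : R) : R := \int[mu]_t (F t * cos (2 * pi * w * t)).
Definition sinT F (w : R) : R := \int[mu]_t (F t * sin (2 * pi * w * t)).

Local Notation integrableR F := (mu.-integrable setT (EFin \o F)).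

Lemma integrable_measurable F : integrableR F -> measurable_fun setT F.
Proof. by move=> iF; apply/measurable_EFinP; exact: measurable_int iF. Qed.

Lemma measurable_cosT F : measurable_fun setT F -> measurable_fun setT (cosT F).
Proof.
move=> mF; pose K (p : measurableTypeR R * measurableTypeR R) := F p.2 * cos (2 * pi * p.1 * p.2).
have mK : measurable_fun setT K by rewrite /K; meas.
exact: (measurable_Rintegral_param mu mK).
Qed.

Lemma measurable_sinT F : measurable_fun setT F -> measurable_fun setT (sinT F).
Proof.
move=> mF; pose K (p : measurableTypeR R * measurableTypeR R) := F p.2 * sin (2 * pi * p.1 * p.2).
have mK : measurable_fun setT K by rewrite /K; meas.
exact: (measurable_Rintegral_param mu mK).
Qed.

Lemma integrable_mul_cos F (w : R) : integrableR F ->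
  integrableR (fun t => F t * cos (2 * pi * w * t)).
Proof.
move=> iF; under eq_fun do rewrite mulrC.
by apply: (integrableR_bounded (M := 1)) => //; [meas|move=> t; exact: cos_max].
Qed.

Lemma integrable_mul_sin F (w : R) : integrableR F ->
  integrableR (fun t => F t * sin (2 * pi * w * t)).
Proof.
move=> iF; under eq_fun do rewrite mulrC.
by apply: (integrableR_bounded (M := 1)) => //; [meas|move=> t; exact: sin_max].
Qed.

Lemma cosT_bound F w : integrableR F -> `|cosT F w| <= \int[mu]_t `|F t|.
Proof.
move=> iF; have iFc := integrable_mul_cos w iF.
apply: (le_trans (le_normr_Rintegral measurableT iFc)).
apply: le_Rintegral => //; [exact: integrable_norm|exact: integrable_norm|].
by move=> t _; rewrite normrM ler_piMr ?cos_max.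
Qed.

Lemma sinT_bound F w : integrableR F -> `|sinT F w| <= \int[mu]_t `|F t|.
Proof.
move=> iF; have iFc := integrable_mul_sin w iF.
apply: (le_trans (le_normr_Rintegral measurableT iFc)).
apply: le_Rintegral => //; [exact: integrable_norm|exact: integrable_norm|].
by move=> t _; rewrite normrM ler_piMr ?sin_max.
Qed.

Lemma cosTB F G w : integrableR F -> integrableR G ->
  cosT (fun t => F t - G t) w = cosT F w - cosT G w.
Proof.
move=> iF iG; rewrite /cosT -RintegralB//; [|exact: integrable_mul_cos..].
by apply: eq_Rintegral => t _; ring.
Qed.

Lemma sinTB F G w : integrableR F -> integrableR G ->
  sinT (fun t => F t - G t) w = sinT F w - sinT G w.
Proof.
move=> iF iG; rewrite /sinT -RintegralB//; [|exact: integrable_mul_sin..].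
by apply: eq_Rintegral => t _; ring.
Qed.

(** Squared modulus of the Fourier transform. *)
Definition power F w := cosT F w ^+ 2 + sinT F w ^+ 2.

Lemma power_ge0 F w : 0 <= power F w.
Proof. by rewrite addr_ge0 ?sqr_ge0. Qed.

Lemma measurable_power F : measurable_fun setT F -> measurable_fun setT (power F).
Proof.
by move=> mF; have ? := measurable_cosT mF; have ? := measurable_sinT mF; rewrite /power; meas.
Qed.

(* gker a is the Fourier transform of exp(- a w^2). *)
Definition gker (a u : R) := Num.sqrt (pi / a) * expR (- (pi ^+ 2 / a * u ^+ 2)).
Definition gconv (a : R) F (t : R) := \int[mu]_s (F s * gker a (t - s)).

(** * Plancherel's identity regularized by a Gaussian of fixed width *)

Section FixedWidth.
Variable a : R.
Hypothesis a0 : 0 < a.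

Lemma gker_ge0 u : 0 <= gker a u.
Proof. by rewrite mulr_ge0 ?sqrtr_ge0 ?expR_ge0. Qed.

Lemma gker_le u : `|gker a u| <= Num.sqrt (pi / a).
Proof.
rewrite ger0_norm ?gker_ge0// ler_piMr ?sqrtr_ge0// -expR0 ler_expR oppr_le0.
by rewrite mulr_ge0 ?sqr_ge0// divr_ge0 ?sqr_ge0// ltW.
Qed.

Let b0 : 0 < pi ^+ 2 / a. Proof. by rewrite divr_gt0// exprn_gt0// pi_gt0. Qed.

Lemma integrable_gker : integrableR (gker a).
Proof. by apply: integrableRZ; exact: integrable_gauss_scaled. Qed.

Lemma measurable_gker : measurable_fun setT (gker a).
Proof. by rewrite /gker; meas. Qed.

Lemma integral_gker : \int[mu]_u gker a u = 1.
Proof.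
rewrite RintegralZl//; last exact: integrable_gauss_scaled.
rewrite Rintegral_gauss// -sqrtrM ?divr_ge0 ?pi_ge0 ?ltW//.
rewrite (_ : _ * _ = 1) ?sqrtr1//.
have a1 : a != 0 by rewrite gt_eqF.
have : (pi : R) != 0 by rewrite gt_eqF// pi_gt0.
by move: (pi : R) => P P0; field; rewrite a1 P0.
Qed.

Lemma gker_shift t : (fun s => gker a (t - s)) = (fun s => gker a (-1 * s + t)).
Proof. by apply/funext => s; congr gker; rewrite mulN1r addrC. Qed.

Lemma integrable_gker_shift t : integrableR (fun s => gker a (t - s)).
Proof.
rewrite gker_shift; apply: integrable_affine; last exact: integrable_gker.
by rewrite oppr_eq0 oner_eq0.
Qed.

Lemma integral_gker_shift t : \int[mu]_s gker a (t - s) = 1.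
Proof.
rewrite (_ : \int[mu]_s gker a (t - s) = \int[mu]_s gker a (-1 * s + t)); last first.
  by apply: eq_Rintegral => s _; congr gker; rewrite mulN1r addrC.
rewrite Rintegral_affine ?oppr_eq0 ?oner_eq0//; last exact: measurable_gker.
by rewrite integral_gker mulr1 normrN normr1 invr1.
Qed.

Lemma measurable_gker_shift t : measurable_fun setT (fun s : R => gker a (t - s)).
Proof. by rewrite /gker; meas. Qed.

Lemma integrable_gconv_integrand F t : integrableR F ->
  integrableR (fun s => F s * gker a (t - s)).
Proof.
move=> iF; under eq_fun do rewrite mulrC.
apply: (integrableR_bounded (M := Num.sqrt (pi / a))) => //.
  exact: measurable_gker_shift.
by move=> s; exact: gker_le.
Qed.

Lemma measurable_gconv F : measurable_fun setT F -> measurable_fun setT (gconv a F).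
Proof.
move=> mF; pose K (p : measurableTypeR R * measurableTypeR R) := F p.2 * gker a (p.1 - p.2).
have mK : measurable_fun setT K by rewrite /K /gker; meas.
exact: (measurable_Rintegral_param mu mK).
Qed.

(** The squared modulus is the double integral of F(t) F(s) cos(2 pi w (t - s)). The Gaussian weight
    makes the triple integral absolutely convergent; integrating in w first produces
    [gker a (t - s)]. *)
Lemma power_gauss F : integrableR F ->
  \int[mu]_w (expR (- (a * w ^+ 2)) * power F w) = \int[mu]_t (F t * gconv a F t).
Proof.
move=> iF; have mF := integrable_measurable iF.
have mC := measurable_cosT mF; have mS := measurable_sinT mF.
have ie := integrable_gauss_scaled a0.
set N1 := \int[mu]_t `|F t|.
have N10 : 0 <= N1 by apply: Rintegral_ge0.
(* The integral over s alone. Expanding cos(u - v) expresses it through [cosT] and [sinT], which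
   gives a bound uniform in w and t. *)
pose D w t := cosT F w * cos (2 * pi * w * t) + sinT F w * sin (2 * pi * w * t).
have DE w t : D w t = \int[mu]_s (F s * cos (2 * pi * w * (t - s))).
  rewrite /D -!RintegralZr//; [|exact: integrable_mul_sin|exact: integrable_mul_cos].
  rewrite -RintegralD//; last 2 first.
  - by under eq_fun do rewrite mulrC; apply: integrableRZ; exact: integrable_mul_cos.
  - by under eq_fun do rewrite mulrC; apply: integrableRZ; exact: integrable_mul_sin.
  by apply: eq_Rintegral => s _; rewrite mulrBr cosB; ring.
have Dle w t : `|D w t| <= 2 * N1.
  rewrite mulr_natl mulr2n; apply: (le_trans (ler_normD _ _)); rewrite !normrM.
  by apply: lerD; rewrite -[leRHS]mulr1 ler_pM ?cosT_bound ?sinT_bound ?cos_max ?sin_max.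
pose K (p : measurableTypeR R * measurableTypeR R) := expR (- (a * p.1 ^+ 2)) * (F p.2 * D p.1 p.2).
have mK : measurable_fun setT K by rewrite /K /D; meas.
have KE w : expR (- (a * w ^+ 2)) * power F w = \int[mu]_t K (w, t).
  rewrite /K/= RintegralZl//; last first.
    under eq_fun do rewrite mulrC.
    by apply: (integrableR_bounded (M := 2 * N1)) => //; rewrite /D; meas.
  congr (_ * _); rewrite /power !expr2 {1}/cosT {1}/sinT.
  rewrite -!RintegralZr//; [|exact: integrable_mul_sin|exact: integrable_mul_cos].
  rewrite -RintegralD//; last 2 first.
  - by under eq_fun do rewrite mulrC; apply: integrableRZ; exact: integrable_mul_cos.
  - by under eq_fun do rewrite mulrC; apply: integrableRZ; exact: integrable_mul_sin.
  by apply: eq_Rintegral => t _; rewrite /D; ring.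
under eq_Rintegral do rewrite KE.
have iKw w : integrableR (fun t => K (w, t)).
  rewrite /K/=; apply: integrableRZ; under eq_fun do rewrite mulrC.
  by apply: (integrableR_bounded (M := 2 * N1)) => //; rewrite /D; meas.
have iKt t : integrableR (fun w => K (w, t)).
  rewrite /K/=; under eq_fun do rewrite mulrC.
  apply: (integrableR_bounded (M := `|F t| * (2 * N1))) => //; first by rewrite /D; meas.
  by move=> w; rewrite normrM ler_wpM2l.
rewrite (@Rfubini _ _ _ _ _ mu mu K)//; last first.
  apply: (@integrable_prod_mul _ _ _ _ _ mu mu K (fun w => expR (- (a * w ^+ 2))) F (2 * N1)) => //.
  by move=> p; rewrite !normrM [leRHS]mulrC -mulrA ler_wpM2l// ler_wpM2l.
apply: eq_Rintegral => t _; rewrite /K/=.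
under eq_Rintegral do rewrite mulrCA.
rewrite RintegralZl//; last first.
  under eq_fun do rewrite mulrC.
  by apply: (integrableR_bounded (M := 2 * N1)) => //; rewrite /D; meas.
congr (_ * _); rewrite /gconv.
pose L (p : measurableTypeR R * measurableTypeR R) := expR (- (a * p.1 ^+ 2)) * (F p.2 * cos (2 * pi * p.1 * (t - p.2))).
have mL : measurable_fun setT L by rewrite /L; meas.
have ic w : integrableR (fun s => F s * cos (2 * pi * w * (t - s))).
  under eq_fun do rewrite mulrC.
  by apply: (integrableR_bounded (M := 1)) => //; [meas|move=> s; exact: cos_max].
have iec s : integrableR (fun w => expR (- (a * w ^+ 2)) * cos (2 * pi * w * (t - s))).
  under eq_fun do rewrite mulrC.
  by apply: (integrableR_bounded (M := 1)) => //; [meas|move=> w; exact: cos_max].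
transitivity (\int[mu]_w \int[mu]_s L (w, s)).
  by apply: eq_Rintegral => w _; rewrite DE /L/= RintegralZl.
rewrite (@Rfubini _ _ _ _ _ mu mu L)//; last 3 first.
- apply: (@integrable_prod_mul _ _ _ _ _ mu mu L (fun w => expR (- (a * w ^+ 2))) F 1) => //.
  by move=> p; rewrite !normrM mul1r ler_wpM2l// ler_piMr// cos_max.
- by move=> w; rewrite /L/=; apply: integrableRZ; exact: ic.
- move=> s; rewrite /L/=; under eq_fun do rewrite mulrCA.
  by apply: integrableRZ; exact: iec.
apply: eq_Rintegral => s _; rewrite /L/=.
under eq_Rintegral do rewrite mulrCA.
by rewrite RintegralZl// fourier_gauss.
Qed.

Lemma gconv_bound F t : integrableR F ->
  `|gconv a F t| <= Num.sqrt (pi / a) * \int[mu]_s `|F s|.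
Proof.
move=> iF; have ig := integrable_gconv_integrand t iF.
apply: (le_trans (le_normr_Rintegral measurableT ig)).
rewrite -RintegralZl//; last exact: integrable_norm.
apply: le_Rintegral => //.
- exact: integrable_norm.
- by apply: integrableRZ; exact: integrable_norm.
- by move=> s _; rewrite normrM mulrC ler_wpM2r// gker_le.
Qed.

Lemma integrable_mul_gconv F : integrableR F -> integrableR (fun t => F t * gconv a F t).
Proof.
move=> iF; under eq_fun do rewrite mulrC.
apply: (integrableR_bounded (M := Num.sqrt (pi / a) * \int[mu]_s `|F s|)) => //.
  by apply: measurable_gconv; exact: integrable_measurable iF.
by move=> t; exact: gconv_bound.
Qed.

(** Averaging against the probability density [gker a] preserves the integral, by Tonelli's
    theorem. *)
Lemma gconv_sqr F : sqint mu F ->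
  integrableR (gconv a (fun s => F s ^+ 2)) /\
  \int[mu]_t gconv a (fun s => F s ^+ 2) t = nrm2 mu F.
Proof.
move=> sF; have [mF iF2] := sF.
pose K (p : measurableTypeR R * measurableTypeR R) := F p.2 ^+ 2 * gker a (p.1 - p.2).
have mK : measurable_fun setT K by rewrite /K /gker; meas.
have K0 p : (0 <= (K p)%:E)%E by rewrite lee_fin mulr_ge0 ?sqr_ge0 ?gker_ge0.
have hE t : (gconv a (fun s => F s ^+ 2) t)%:E = (\int[mu]_s (K (t, s))%:E)%E.
  rewrite /gconv /Rintegral fineK//.
  exact: (integrable_fin_num measurableT (integrable_gconv_integrand t iF2)).
have hI : (\int[mu]_t (gconv a (fun s => F s ^+ 2) t)%:E = (nrm2 mu F)%:E)%E.
  under eq_integral do rewrite hE.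
  rewrite (@fubini_tonelli _ _ _ _ _ mu mu (EFin \o K))//; last exact/measurable_EFinP.
  rewrite -(nrm2E sF); apply: eq_integral => s _ /=.
  under eq_integral do rewrite /K/= EFinM.
  rewrite ge0_integralZl//; last 3 first.
  - apply/measurable_EFinP; rewrite /gker; meas.
  - by move=> t _; rewrite lee_fin gker_ge0.
  - by rewrite lee_fin sqr_ge0.
  have -> : (\int[mu]_t (gker a (t - s))%:E = 1)%E.
    rewrite -[X in X = _]fineK; last first.
      rewrite ge0_fin_numE; last by apply: integral_ge0 => t _; rewrite lee_fin gker_ge0.
      have := integrable_lty measurableT (@integrable_affine _ 1 (- s) (gker a) (oner_neq0 _) integrable_gker).
      rewrite [X in (X < _)%E -> _](_ : _ = \int[mu]_t (gker a (t - s))%:E)%E//.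
      by apply: eq_integral => t _; rewrite /= mul1r.
    congr EFin; rewrite -[LHS]/(\int[mu]_t gker a (t - s)) -(integral_gker_shift s).
    by apply: eq_Rintegral => t _; rewrite /gker -[in RHS]opprB sqrrN.
  by rewrite mule1.
have h0 t : 0 <= gconv a (fun s => F s ^+ 2) t.
  by apply: Rintegral_ge0 => s _; rewrite mulr_ge0 ?sqr_ge0 ?gker_ge0.
split; last by rewrite /Rintegral hI.
apply/integrableP; split.
  by apply/measurable_EFinP; apply: (measurable_gconv (F := fun s => F s ^+ 2)); meas.
by under eq_integral do rewrite /= ger0_norm//; rewrite hI ltry.
Qed.

(** F(t) F(s) is at most (F(t)^2 + F(s)^2) / 2, and [gker a (t - s)] has mass one in each
    variable. *)
Lemma integral_mul_gconv_le F : integrableR F -> sqint mu F ->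
  \int[mu]_t (F t * gconv a F t) <= nrm2 mu F.
Proof.
move=> iF sF; have [ih hE] := gconv_sqr sF; have [mF iF2] := sF.
have -> : nrm2 mu F = \int[mu]_t (2^-1 * F t ^+ 2 + 2^-1 * gconv a (fun s => F s ^+ 2) t).
  rewrite RintegralD//; [|exact: integrableRZ..].
  rewrite !RintegralZl// hE /nrm2; lra.
apply: le_Rintegral => //.
- exact: integrable_mul_gconv.
- by apply: integrableRD; exact: integrableRZ.
move=> t _; have ig := integrable_gconv_integrand t iF.
have ig2 := integrable_gconv_integrand t iF2.
rewrite -RintegralZl// -RintegralZl//.
have -> : 2^-1 * F t ^+ 2 = \int[mu]_s ((2^-1 * F t ^+ 2) * gker a (t - s)).
  by rewrite RintegralZl ?integral_gker_shift ?mulr1//; exact: integrable_gker_shift.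
rewrite -RintegralD//; last 2 first.
- by apply: integrableRZ; exact: integrable_gker_shift.
- exact: integrableRZ.
apply: le_Rintegral => //.
- exact: integrableRZ.
- by apply: integrableRD; apply: integrableRZ => //; exact: integrable_gker_shift.
move=> s _; have := gker_ge0 (t - s); move: (gker a _) => g g0.
have := mulr_ge0 (sqr_ge0 (F t - F s)) g0; nra.
Qed.

(** The substitution s = t - sqrt a v moves the width from the kernel into the argument of [F],
    where continuity can be used as the width tends to 0. *)
Lemma gconv_subst F t : integrableR F ->
  gconv a F t = \int[mu]_v (F (t - Num.sqrt a * v) * gker 1 v).
Proof.
move=> iF; have s0 : 0 < Num.sqrt a by rewrite sqrtr_gt0.
have mF := integrable_measurable iF.
have sn : - Num.sqrt a != 0 by rewrite oppr_eq0 gt_eqF.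
pose f s := F s * gker a (t - s).
have if_ : integrableR f by exact: integrable_gconv_integrand.
have mf : measurable_fun setT f by exact: integrable_measurable.
transitivity (Num.sqrt a * \int[mu]_x f (- Num.sqrt a * x + t)).
  by rewrite (Rintegral_affine t sn mf) normrN gtr0_norm// mulrA mulfV ?gt_eqF// mul1r.
rewrite -RintegralZl//; last exact: (integrable_affine t sn if_).
apply: eq_Rintegral => v _; rewrite /f mulrCA.
have -> : - Num.sqrt a * v + t = t - Num.sqrt a * v by rewrite mulNr addrC.
congr (_ * _); rewrite opprB addrC subrK /gker exprMn sqr_sqrtr ?ltW// divr1.
have -> : Num.sqrt pi = Num.sqrt a * Num.sqrt (pi / a).
  by rewrite -sqrtrM ?ltW// mulrCA mulfV ?mulr1// gt_eqF.
by rewrite mulrA [pi ^+ 2 / a * _]mulrA divfK ?gt_eqF// divr1.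
Qed.

End FixedWidth.

(** * The limit of vanishing width *)

Definition width (n : nat) : R := n.+1%:R^-1.

Lemma width_gt0 n : 0 < width n. Proof. by rewrite invr_gt0. Qed.

Lemma cvg_width : width n @[n --> \oo] --> 0.
Proof. exact: cvg_harmonic. Qed.

(** Monotone convergence as the widths decrease. It is stated in the extended reals because the
    limit could a priori be infinite. *)
Lemma cvg_power F : measurable_fun setT F ->
  (\int[mu]_w (expR (- (width n * w ^+ 2)) * power F w)%:E)%E @[n --> \oo] -->
  (\int[mu]_w (power F w)%:E)%E.
Proof.
move=> mF; have mP := measurable_power mF.
have -> : (\int[mu]_w (power F w)%:E)%E =
    (\int[mu]_w limn (fun n => (expR (- (width n * w ^+ 2)) * power F w)%:E))%E.
  apply: eq_integral => w _; apply/esym/cvg_lim => //; apply: cvg_EFin; first exact: nearW.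
  rewrite /= -[X in _ --> X]mul1r; apply: cvgM; last exact: cvg_cst.
  rewrite -expR0; apply: continuous_cvg; first exact: continuous_expR.
  rewrite -oppr0; apply: cvgN; rewrite -(mul0r (w ^+ 2)).
  by apply: cvgM; [exact: cvg_width|exact: cvg_cst].
apply: (@cvg_monotone_convergence _ _ _ mu setT measurableT (fun n w => (expR (- (width n * w ^+ 2)) * power F w)%:E)).
- by move=> n; apply/measurable_EFinP; meas.
- by move=> n w _; rewrite lee_fin mulr_ge0 ?expR_ge0 ?power_ge0.
- move=> w _ m n mn; rewrite lee_fin ler_wpM2r ?power_ge0// ler_expR lerN2.
  by rewrite ler_wpM2r ?sqr_ge0// /width lef_pV2 ?posrE// ler_nat.
Qed.

Lemma integral_power_gauss n F : integrableR F ->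
  (\int[mu]_w (expR (- (width n * w ^+ 2)) * power F w)%:E)%E =
  (\int[mu]_t (F t * gconv (width n) F t))%:E.
Proof.
move=> iF; have mF := integrable_measurable iF; have mP := measurable_power mF.
rewrite -(power_gauss (width_gt0 n) iF) [in RHS]/Rintegral fineK//.
apply: (integrable_fin_num measurableT).
pose M := (\int[mu]_t `|F t|) ^+ 2.
have -> : (fun w => (expR (- (width n * w ^+ 2)) * power F w)%:E) =
   EFin \o (fun w => power F w * expR (- (width n * w ^+ 2))).
  by apply/funext => w /=; rewrite mulrC.
apply: (integrableR_bounded (M := M + M)) => //; last exact: (integrable_gauss_scaled (width_gt0 n)).
move=> w; rewrite ger0_norm ?power_ge0//; apply: lerD.
  by rewrite -(real_normK (num_real _)) ler_pXn2r ?nnegrE ?cosT_bound// (le_trans _ (cosT_bound w iF)).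
by rewrite -(real_normK (num_real _)) ler_pXn2r ?nnegrE ?sinT_bound// (le_trans _ (sinT_bound w iF)).
Qed.

Lemma power_le F : integrableR F -> sqint mu F ->
  (\int[mu]_w (power F w)%:E <= (nrm2 mu F)%:E)%E.
Proof.
move=> iF sF; have H := cvg_power sF.1.
rewrite -(cvg_lim _ H)//; apply: lime_le; first by apply/cvg_ex; eexists; exact: H.
apply: nearW => n; rewrite integral_power_gauss// lee_fin.
by apply: integral_mul_gconv_le => //; exact: width_gt0.
Qed.

(** For bounded continuous [F] the averages [gconv (width n) F] tend to [F] at every point, so the
    regularized identities converge to an equality. *)
Lemma power_continuous F M : integrableR F -> sqint mu F -> continuous F ->
  (forall t, `|F t| <= M) ->
  (\int[mu]_w (power F w)%:E)%E = (nrm2 mu F)%:E.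
Proof.
move=> iF sF cF FM; have mF := integrable_measurable iF.
have H := cvg_power mF.
suff K : (\int[mu]_w (expR (- (width n * w ^+ 2)) * power F w)%:E)%E @[n --> \oo] --> (nrm2 mu F)%:E.
  exact: (cvg_unique _ H K).
under eq_fun do rewrite integral_power_gauss//.
apply: cvg_EFin; first exact: nearW.
rewrite /=; apply: (@Rdominated_cvg _ _ _ mu _ _ (fun t => M * `|F t|)).
- move=> n; have := measurable_gconv (width n) mF => ?; meas.
- by meas.
- apply/aeW => t; rewrite expr2; apply: cvgM; first exact: cvg_cst.
  under eq_fun do rewrite gconv_subst ?width_gt0//.
  have -> : F t = \int[mu]_v (F t * gker 1 v).
    by rewrite RintegralZl ?integral_gker ?mulr1//; exact: integrable_gker.
  apply: (@Rdominated_cvg _ _ _ mu _ _ (fun v => M * gker 1 v)).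
  + by move=> n; rewrite /gker; meas.
  + by rewrite /gker; meas.
  + apply/aeW => v; apply: cvgM; last exact: cvg_cst.
    apply: continuous_cvg; first exact: cF.
    rewrite -[X in _ --> X]subr0; apply: cvgB; first exact: cvg_cst.
    rewrite -(mul0r v); apply: cvgM; last exact: cvg_cst.
    rewrite -sqrtr0; apply: continuous_cvg; last exact: cvg_width.
    exact: sqrt_continuous.
  + by apply: integrableRZ; exact: integrable_gker.
  + by move=> n v; rewrite normrM (ger0_norm (gker_ge0 _ _)) ler_wpM2r ?gker_ge0.
- by apply: integrableRZ; exact: integrable_norm.
- move=> n t; rewrite normrM mulrC ler_wpM2r//.
  have M0 : 0 <= M by exact: (le_trans (normr_ge0 _) (FM t)).
  have ig := integrable_gconv_integrand (width_gt0 n) t iF.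
  apply: (le_trans (le_normr_Rintegral measurableT ig)).
  rewrite -[leRHS]mulr1 -(integral_gker_shift (width_gt0 n) t) -RintegralZl//; last first.
    exact: (integrable_gker_shift (width_gt0 n)).
  apply: le_Rintegral => //.
  + exact: integrable_norm.
  + by apply: integrableRZ; exact: (integrable_gker_shift (width_gt0 n)).
  + by move=> s _; rewrite normrM (ger0_norm (gker_ge0 _ _)) ler_wpM2r ?gker_ge0.
Qed.

(** * Density of bounded continuous functions in L^2 *)

Definition trunc (k : nat) F (t : R) := \1_[set s | `|s| <= k%:R /\ `|F s| <= k%:R] t * F t.

Lemma measurable_trunc_set k F : measurable_fun setT F ->
  measurable ([set s | `|s| <= k%:R /\ `|F s| <= k%:R] : set (measurableTypeR R)).
Proof.
move=> mF; have -> : [set s | `|s| <= k%:R /\ `|F s| <= k%:R] =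
  [set s : R | `|s| <= k%:R] `&` [set s | `|F s| <= k%:R] by [].
apply: measurableI.
  rewrite -[X in measurable X]setTI.
  have mN : measurable_fun setT (fun s : measurableTypeR R => `|s|) by meas.
  by have := mN measurableT `]-oo, k%:R]%classic (measurable_itv _).
rewrite -[X in measurable X]setTI.
have mN : measurable_fun setT (fun s : measurableTypeR R => `|F s|) by meas.
by have := mN measurableT `]-oo, k%:R]%classic (measurable_itv _).
Qed.

Lemma measurable_trunc k F : measurable_fun setT F -> measurable_fun setT (trunc k F).
Proof.
move=> mF; have mI : measurable_fun setT (\1_[set s | `|s| <= k%:R /\ `|F s| <= k%:R] : measurableTypeR R -> R).
  by apply: measurable_indic; exact: measurable_trunc_set.
by rewrite /trunc; meas.
Qed.

Lemma trunc_le k F t : `|trunc k F t| <= k%:R.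
Proof.
rewrite /trunc indicE; case: (boolP (t \in _)) => [|_]; last by rewrite mul0r normr0.
by rewrite inE /= mul1r => -[].
Qed.

Lemma trunc_out k F t : k%:R < `|t| -> trunc k F t = 0.
Proof.
move=> kt; rewrite /trunc indicE memNset ?mul0r//= => -[].
by rewrite leNgt kt.
Qed.

Lemma cvg_trunc F : sqint mu F ->
  nrm2 mu (fun t => F t - trunc n F t) @[n --> \oo] --> 0.
Proof.
move=> [mF iF2]; have -> : 0 = \int[mu]_x (0 : R) by rewrite /Rintegral integral0.
apply: (@Rdominated_cvg _ _ _ mu _ _ (fun t => F t ^+ 2)) => //.
- by move=> n; have := measurable_trunc n mF => ?; meas.
- apply/aeW => t; apply: cvg_near_cst; near=> n.
  rewrite /trunc indicE mem_set/=; first by rewrite mul1r subrr expr0n.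
  by split; near: n; exact: nbhs_infty_ger.
- move=> n t; rewrite ger0_norm ?sqr_ge0// /trunc indicE.
  case: (t \in _); first by rewrite mul1r subrr expr0n sqr_ge0.
  by rewrite mul0r subr0.
Unshelve. all: by end_near. Qed.

Lemma integrable_supported F (K M : R) : measurable_fun setT F ->
  (forall t, `|F t| <= M) -> (forall t, K < `|t| -> F t = 0) -> integrableR F /\ sqint mu F.
Proof.
move=> mF FM F0.
have M0 : 0 <= M by exact: (le_trans (normr_ge0 _) (FM 0)).
have iI : integrableR (\1_(`[- K, K] : set R)).
  exact: (@integrable_indic_itv R (- K) K true false).
have le1 t : `|F t| <= M * \1_(`[- K, K] : set R) t.
  rewrite indicE; case: (boolP (t \in _)) => [_|]; first by rewrite mulr1.
  rewrite notin_setE/= in_itv/= -ler_norml => /negP; rewrite -ltNge => /F0 ->.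
  by rewrite normr0 mulr0.
split.
  by apply: (@integrableR_le _ _ _ mu F _ mF le1); exact: integrableRZ.
split => //; apply: (@integrableR_le _ _ _ mu _ (fun t => M ^+ 2 * \1_(`[- K, K] : set R) t)).
- by meas.
- move=> t; rewrite normrX; apply: (@le_trans _ _ ((M * \1_(`[- K, K] : set R) t) ^+ 2)).
    by rewrite ler_pXn2r ?nnegrE// (le_trans _ (le1 t)).
  by rewrite exprMn indicE; case: (_ \in _); rewrite ?expr1n ?expr0n.
- exact: integrableRZ.
Qed.

(** [clamp k] is the projection onto [[-k, k]] and does not increase the distance to points of that
    interval. [cutoff k] is a continuous bump, equal to 1 on [[-k, k]] and to 0 outside
    [[-k-1, k+1]]. *)
Let clamp (k : nat) (x : R) := Order.max (- k%:R) (Order.min k%:R x).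
Let cutoff (k : nat) (x : R) := Order.max 0 (Order.min 1 (k.+1%:R - `|x|)).

Let clamp_le k x : `|clamp k x| <= k%:R.
Proof.
rewrite ler_norml /clamp le_max lexx/= ge_max ge_min lexx/= andbT.
by rewrite (le_trans _ (ler0n _ _))// oppr_le0.
Qed.

Let clamp_dist k x y : `|x| <= k%:R -> `|x - clamp k y| <= `|x - y|.
Proof.
rewrite ler_norml => /andP[x1 x2]; rewrite /clamp.
by rewrite /Order.max /Order.min; case: ifPn; case: ifPn; rewrite -?leNgt => ? ?;
  rewrite ler_norml; apply/andP; split; have := ler_norm (x - y); have := ler_norm (y - x); rewrite (distrC y); lra.
Qed.

Let continuous_clamp k (h : R -> R) : continuous h -> continuous (fun x => clamp k (h x)).
Proof.
move=> ch x; have c1 : {for x, continuous (fun=> - k%:R : R^o)} by exact: cvg_cst.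
have c2 : {for x, continuous (fun=> k%:R : R^o)} by exact: cvg_cst.
exact: (continuous_max c1 (continuous_min c2 (ch x))).
Qed.

Let continuous_cutoff k : continuous (cutoff k).
Proof.
move=> x; have c1 : {for x, continuous (fun=> 0 : R^o)} by exact: cvg_cst.
have c2 : {for x, continuous (fun=> 1 : R^o)} by exact: cvg_cst.
have c3 : {for x, continuous (fun y : R => k.+1%:R - `|y| : R^o)}.
  by apply: cvgB; [exact: cvg_cst|exact: norm_continuous].
exact: (continuous_max c1 (continuous_min c2 c3)).
Qed.

Let cutoff_01 k x : 0 <= cutoff k x <= 1.
Proof. by rewrite /cutoff le_max lexx/= ge_max ge_min lexx/= ler01. Qed.

Lemma sqint_dense F e : sqint mu F -> 0 < e -> exists G M, [/\ integrableR G,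
  sqint mu G, continuous G, (forall t, `|G t| <= M) &
  nrm2 mu (fun t => F t - G t) <= e].
Proof.
move=> sF e0; have [mF _] := sF.
have e4 : 0 < e / 4 by rewrite divr_gt0.
have /cvgrPdist_le/(_ _ e4)[k _ /(_ k (leqnn k))/=] := cvg_trunc sF.
rewrite sub0r normrN ger0_norm ?nrm2_ge0// => ke.
set T := trunc k F in ke *.
have mT : measurable_fun setT T by exact: measurable_trunc.
have Tle t : `|T t| <= k%:R by exact: trunc_le.
have T0 t : k%:R < `|t| -> T t = 0 by exact: trunc_out.
have [iT sT] := integrable_supported mT Tle T0.
pose E : set (measurableTypeR R) := `[- k.+1%:R, k.+1%:R]%classic.
have mE : measurable E by exact: measurable_itv.
have Ey : (mu E < +oo)%E.
  by rewrite lebesgue_measure_itv/=; case: ifP => _; rewrite ?ltry// -EFinB ltry.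
have iTE : mu.-integrable E (EFin \o T) by exact: integrableS iT.
have [g_ [cg ig gT]] := approximation_continuous_integrable mE Ey iTE.
(* Multiplied by the bound [2 * k.+1%:R] of [|T - G|], this tolerance becomes [e / 4]. *)
have e8 : 0 < e / (8 * k.+1%:R) by rewrite divr_gt0// mulr_gt0.
have [h [ch ih hT]] : exists h, [/\ continuous h, mu.-integrable E (EFin \o h) &
    (\int[mu]_(z in E) `|(T z - h z)%:E| <= (e / (8 * k.+1%:R))%:E)%E].
  have /fine_cvgP[[N1 _ gf] /cvgrPdist_le/(_ _ e8)[N2 _ gN]] := gT.
  exists (g_ (maxn N1 N2)); split => //.
  have := gN _ (leq_maxr N1 N2); have := gf _ (leq_maxl N1 N2) => /= fin.
  rewrite sub0r normrN ger0_norm ?fine_ge0 ?integral_ge0// -lee_fin fineK//.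
pose G t := cutoff k t * clamp k (h t).
have cG : continuous G by move=> t; apply: cvgM; [exact: continuous_cutoff|exact: continuous_clamp].
have mG : measurable_fun setT G by exact: continuous_measurable_fun.
have Gle t : `|G t| <= k%:R.
  have /andP[c0 c1] := cutoff_01 k t.
  by rewrite normrM (ger0_norm c0) (le_trans _ (clamp_le k (h t)))// ler_piMl.
have G0 t : k.+1%:R < `|t| -> G t = 0.
  move=> kt; rewrite /G /cutoff (max_idPl _) ?mul0r//.
  by rewrite ge_min subr_le0 (ltW kt) orbT.
have [iG sG] := integrable_supported mG Gle G0.
exists G, k%:R; split => //.
have TG t : (T t - G t) ^+ 2 <= (2 * k.+1%:R) * ((fun z => `|T z - h z|) \_ E) t.
  rewrite patchE; case: ifPn => [|]; last first.
    rewrite notin_setE /E/= in_itv/= -ler_norml => /negP; rewrite -ltNge => kt.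
    rewrite G0// T0 ?subrr ?expr0n//; last by apply: lt_trans kt; rewrite ltr_nat.
    by rewrite mulr_ge0// normr0.
  move=> _.
  have H1 : `|T t - G t| <= 2 * k.+1%:R.
    have kk : k%:R <= k.+1%:R :> R by rewrite ler_nat.
    rewrite (le_trans (ler_normB _ _))// mulr_natl mulr2n.
    by apply: lerD; [exact: le_trans (Tle t) kk|exact: le_trans (Gle t) kk].
  have H2 : `|T t - G t| <= `|T t - h t|.
    have /andP[c0 c1] := cutoff_01 k t.
    have [tk|tk] := leP `|t| k%:R.
      have -> : G t = clamp k (h t).
        rewrite /G /cutoff (_ : Order.min _ _ = 1) ?(max_idPr _) ?mul1r//.
        by apply/min_idPl; rewrite lerBrDr -natr1 addrC lerD2r.
      exact: clamp_dist.
    rewrite T0// !sub0r !normrN /G normrM (ger0_norm c0) (le_trans (ler_piMl _ c1))//.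
    have := @clamp_dist k 0 (h t); rewrite !sub0r !normrN; apply.
    by rewrite normr0.
  rewrite -(real_normK (num_real (T t - G t))) expr2.
  exact: ler_pM.
have iTh : mu.-integrable E (EFin \o (fun z => T z - h z)).
  by have := integrableB mE iTE ih.
have iTh' : mu.-integrable E (EFin \o (fun z => `|T z - h z|)) by exact: integrable_norm.
have TGn : nrm2 mu (fun t => T t - G t) <= e / 4.
  have i2 : integrableR ((fun z => `|T z - h z|) \_ E).
    by have := (integrable_mkcond _ mE).1 iTh'; rewrite restrict_EFin.
  apply: (@le_trans _ _ (\int[mu]_t ((2 * k.+1%:R) * ((fun z => `|T z - h z|) \_ E) t))).
    apply: le_Rintegral => //; first by have [] := sqintB sT sG.
    exact: integrableRZ.
  rewrite RintegralZl// -Rintegral_mkcond.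
  have H : \int[mu]_(z in E) `|T z - h z| <= e / (8 * k.+1%:R).
    rewrite -lee_fin /Rintegral fineK//; exact: (integrable_fin_num mE iTh').
  have k0 : 0 < k.+1%:R :> R by rewrite ltr0n.
  apply: (le_trans (ler_wpM2l _ H)); first by rewrite mulr_ge0.
  rewrite le_eqVlt; apply/orP; left; apply/eqP.
  by move: (k.+1%:R) k0 => q q0; field; rewrite gt_eqF.
have sFT := sqintB sF sT; have sTG := sqintB sT sG.
apply: (@le_trans _ _ (2 * nrm2 mu (fun t => F t - T t) + 2 * nrm2 mu (fun t => T t - G t))).
  rewrite /nrm2 -!RintegralZl//; [|by have [] := sTG|by have [] := sFT].
  rewrite -RintegralD//; [|by apply: integrableRZ; have [] := sFT|by apply: integrableRZ; have [] := sTG].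
  apply: le_Rintegral => //; first by have [] := sqintB sF sG.
    by apply: integrableRD; apply: integrableRZ; [have [] := sFT|have [] := sTG].
  by move=> t _; have := sqr_ge0 ((F t - T t) - (T t - G t)); nra.
lra.
Qed.

(** One inequality is [power_le]. For the other, F is approximated by bounded continuous functions,
    for which equality is known, and [power_le] controls the transform of the error. *)
Theorem plancherel F : integrableR F -> sqint mu F ->
  (\int[mu]_w (power F w)%:E)%E = (nrm2 mu F)%:E.
Proof.
move=> iF sF; apply/eqP; rewrite eq_le power_le//=.
have mF := integrable_measurable iF; have mP := measurable_power mF.
have fP : (\int[mu]_w (power F w)%:E)%E \is a fin_num.
  rewrite ge0_fin_numE; first by apply: le_lt_trans (power_le iF sF) _; exact: ltry.
  by apply: integral_ge0 => w _; rewrite lee_fin power_ge0.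
rewrite -(fineK fP) lee_fin; set N := fine _.
have NE : (\int[mu]_w (power F w)%:E)%E = N%:E by rewrite /N fineK.
have N0 : 0 <= N by rewrite fine_ge0// integral_ge0// => w _; rewrite lee_fin power_ge0.
have key d e : 0 < d -> 0 < e ->
    nrm2 mu F <= (1 + d) * ((1 + d) * N + (1 + d^-1) * e) + (1 + d^-1) * e.
  move=> d0 e0; have [G [M [iG sG cG GM FGe]]] := sqint_dense sF e0.
  have di0 : 0 < d^-1 by rewrite invr_gt0.
  have ddi : d * d^-1 = 1 by rewrite mulfV// gt_eqF.
  have mG := integrable_measurable iG.
  have sFG := sqintB sF sG; have iFG := integrableRB iF iG.
  have mQ := measurable_power mG; have mQ2 := measurable_power sFG.1.
  (* A weighted triangle inequality for squares; it compares squared norms directly, the loss 1 + d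
     being arbitrarily close to 1. *)
  have ineq (x y : R) : x ^+ 2 <= (1 + d) * y ^+ 2 + (1 + d^-1) * (x - y) ^+ 2.
    have H : 0 <= d * (y - d^-1 * (x - y)) ^+ 2 by rewrite mulr_ge0 ?sqr_ge0// ltW.
    have -> : (1 + d) * y ^+ 2 + (1 + d^-1) * (x - y) ^+ 2 =
      x ^+ 2 + d * (y - d^-1 * (x - y)) ^+ 2.
      by field; rewrite gt_eqF.
    by rewrite lerDl.
  have H1 : nrm2 mu F <= (1 + d) * nrm2 mu G + (1 + d^-1) * e.
    apply: (@le_trans _ _ ((1 + d) * nrm2 mu G + (1 + d^-1) * nrm2 mu (fun t => F t - G t))).
      rewrite /nrm2 -!RintegralZl//; [|by have [] := sFG|by have [] := sG].
      rewrite -RintegralD//; [|by apply: integrableRZ; have [] := sG|by apply: integrableRZ; have [] := sFG].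
      apply: le_Rintegral => //; first by have [] := sF.
        by apply: integrableRD; apply: integrableRZ; [have [] := sG|have [] := sFG].
    by rewrite lerD2l ler_wpM2l// addr_ge0// ltW.
  have H2 : nrm2 mu G <= (1 + d) * N + (1 + d^-1) * e.
    rewrite -lee_fin -(power_continuous iG sG cG GM).
    apply: (@le_trans _ _ (\int[mu]_w ((1 + d) * power F w + (1 + d^-1) * power (fun t => F t - G t) w)%:E)%E).
      apply: ge0_le_integral => //.
      - by move=> w _; rewrite lee_fin power_ge0.
      - exact/measurable_EFinP.
      - by apply/measurable_EFinP; meas.
      - move=> w _; rewrite lee_fin /power cosTB// sinTB//.
        have := ineq (cosT G w) (cosT F w); have := ineq (sinT G w) (sinT F w).
        rewrite -(sqrrN (cosT G w - _)) -(sqrrN (sinT G w - _)) !opprB; lra.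
    under eq_integral do rewrite EFinD 2!EFinM.
    rewrite ge0_integralD//; last 4 first.
    - by move=> w _; rewrite -EFinM lee_fin mulr_ge0 ?power_ge0// addr_ge0// ltW.
    - by apply: measurable_funeM; exact/measurable_EFinP.
    - by move=> w _; rewrite -EFinM lee_fin mulr_ge0 ?power_ge0// addr_ge0// ltW.
    - by apply: measurable_funeM; exact/measurable_EFinP.
    rewrite !ge0_integralZl//; try (by move=> w _; rewrite lee_fin power_ge0);
      try (by rewrite lee_fin addr_ge0// ltW); try exact/measurable_EFinP.
    rewrite NE; apply: (@le_trans _ _ ((1 + d)%:E * N%:E + (1 + d^-1)%:E * e%:E)%E); last by rewrite -!EFinM -EFinD.
    apply: leeD => //.
    apply: lee_pmul => //; first by rewrite lee_fin addr_ge0// ltW.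
      by apply: integral_ge0 => w _; rewrite lee_fin power_ge0.
    by apply: (le_trans (power_le iFG sFG)); rewrite lee_fin.
  apply: (le_trans H1); rewrite lerD2r ler_wpM2l// addr_ge0// ltW//.
apply/ler_addgt0Pr => e e0.
(* As d <= 1, (1 + d)^2 N <= N + 3 d N <= N + e / 2, and the two error terms add up to (2 + d) e / 6
   <= e / 2. *)
pose d := Order.min 1 (e / (6 * (N + 1))).
have d0 : 0 < d by rewrite lt_min ltr01/= divr_gt0// mulr_gt0// ltr_wpDl.
have d1 : d <= 1 by rewrite ge_min lexx.
have dN : d * (6 * (N + 1)) <= e.
  by rewrite -ler_pdivlMr ?mulr_gt0 ?ltr_wpDl// ge_min lexx orbT.
have di0 : 0 < 1 + d^-1 by rewrite addr_gt0// invr_gt0.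
have e1 : 0 < e / (6 * (1 + d^-1)) by rewrite divr_gt0// mulr_gt0.
apply: (le_trans (key _ _ d0 e1)).
have -> : (1 + d^-1) * (e / (6 * (1 + d^-1))) = e / 6.
  by move: (1 + d^-1) di0 => q q0; field; rewrite gt_eqF.
nra.
Qed.

End Plancherel.

(** * Weighted Hermite functions *)

Section L2norm.
Context d (T : measurableType d) (R : realType).
Variable mu : {measure set T -> \bar R}.

Lemma Lnorm2E (f : T -> R) : sqint mu f ->
  'N[mu]_2%:E[EFin \o f]%E = (Num.sqrt (nrm2 mu f))%:E.
Proof.
move=> sf; rewrite unlock.
under eq_integral do rewrite /= powR_mulrn// real_normK ?num_real//.
by rewrite nrm2E// poweR_EFin powR12_sqrt// nrm2_ge0.
Qed.
End L2norm.

(** Pascal's rule as the induction step of a Leibniz formula. It serves both the Taylor expansion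
    [hpoly_add] and the higher derivatives in [hol_barg]. *)
Lemma sum_pascal (V : nmodType) (f : nat -> nat -> V) j :
  \sum_(k < j.+1) f k (j - k).+1 *+ 'C(j, k) +
  \sum_(k < j.+1) f k.+1 (j - k)%N *+ 'C(j, k) =
  \sum_(k < j.+2) f k (j.+1 - k)%N *+ 'C(j.+1, k).
Proof.
rewrite [X in X + _]big_ord_recl [RHS]big_ord_recl !bin0 subn0 -addrA; congr (_ + _).
have -> : \sum_(i < j) f (bump 0 i) (j - bump 0 i).+1 *+ 'C(j, bump 0 i) =
    \sum_(i < j.+1) f i.+1 (j - i)%N *+ 'C(j, i.+1).
  rewrite big_ord_recr/= bin_small// mulr0n addr0; apply: eq_bigr => i _.
  by rewrite /bump leq0n add1n subnSK.
rewrite -big_split/=; apply: eq_bigr => i _.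
by rewrite /bump leq0n add1n subSS binS mulrnDr.
Qed.

(** * Hermite polynomials with a scaling parameter *)

Section HermitePolynomials.
Variable K : comNzRingType.
Implicit Types a s u w : K.

(* Over the reals, (d/dt)^j exp(- a t^2 / 2) = hpoly a j * exp(- a t^2 / 2). *)
Fixpoint hpoly a (j : nat) : {poly K} :=
  if j is i.+1 then (hpoly a i)^`() - a *: 'X * hpoly a i else 1.

Lemma hpolyS a j : hpoly a j.+1 = (hpoly a j)^`() - a *: 'X * hpoly a j.
Proof. by []. Qed.

(** The lowering relation, which drives the induction in [hpoly_orthogonal]. *)
Lemma deriv_hpoly a j : (hpoly a j.+1)^`() = - (a * j.+1%:R) *: hpoly a j.
Proof.
elim: j => [|j IH].
  by rewrite /= derivC sub0r mulr1 derivN derivZ derivX mulr1 scaleNr alg_polyC.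
rewrite hpolyS derivB derivM derivZ derivX IH derivZ alg_polyC mul_polyC.
rewrite hpolyS -!mul_polyC -!natr1 !(polyCN, polyCM, polyCD); ring.
Qed.

(** With s = sqrt 2 it relates the parameter 4 pi of the Hermite functions to the parameter 2 pi of
    the Bargmann transform. *)
Lemma hpoly_scale a s j : hpoly (a * s ^+ 2) j = s ^+ j *: (hpoly a j \Po (s *: 'X)).
Proof.
elim: j => [|j IH]; first by rewrite expr0 scale1r comp_polyC.
rewrite hpolyS IH [in RHS]hpolyS comp_polyB comp_polyM comp_polyZ comp_polyX derivZ deriv_comp derivZ derivX.
rewrite scalerBr alg_polyC mulrC mul_polyC !scalerA -exprSr; congr (_ - _).
by rewrite -!mul_polyC !(polyCM, polyC_exp) exprS; ring.
Qed.

Lemma hpoly_add a u w j : (hpoly a j).[u + w] =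
  \sum_(k < j.+1) ((- (a * w)) ^+ k * (hpoly a (j - k)).[u]) *+ 'C(j, k).
Proof.
(* An identity of polynomials in u rather than of values, because the recursion of [hpoly]
   differentiates. *)
suff H : hpoly a j \Po ('X + w%:P) =
    \sum_(k < j.+1) ((- (a * w)) ^+ k *: hpoly a (j - k)) *+ 'C(j, k).
  have := congr1 (fun p => p.[u]) H; rewrite horner_comp !hornerE => ->.
  by rewrite horner_sum; apply: eq_bigr => k _; rewrite hornerMn hornerZ.
elim: j => [|j IH]; first by rewrite big_ord1 expr0 bin0 subnn mulr1n scale1r comp_polyC.
rewrite -(sum_pascal (fun k m => (- (a * w)) ^+ k *: hpoly a m)) hpolyS.
have -> : (((hpoly a j)^`() - a *: 'X * hpoly a j) \Po ('X + w%:P)) =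
   (hpoly a j \Po ('X + w%:P))^`() - a *: ('X + w%:P) * (hpoly a j \Po ('X + w%:P)).
  rewrite comp_polyB comp_polyM comp_polyZ comp_polyX deriv_comp derivD derivX derivC addr0 mulr1//.
rewrite IH raddf_sum mulr_sumr -sumrB -big_split/=; apply: eq_bigr => k _.
rewrite derivMn derivZ mulrnAr -mulrnBl -mulrnDl; congr (_ *+ _).
rewrite exprS -!mul_polyC !(polyCM, polyCN); ring.
Qed.

End HermitePolynomials.

Lemma map_hpoly (K L : comNzRingType) (f : {rmorphism K -> L}) a j :
  map_poly f (hpoly a j) = hpoly (f a) j.
Proof.
elim: j => [|j IH]; first by rewrite /= rmorph1.
by rewrite !hpolyS rmorphB rmorphM/= -deriv_map IH map_polyZ map_polyX.
Qed.

Section HermiteFunctions.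
Variable R : realType.
Local Notation mu := (@lebesgue_measure R).

Lemma derive1n_gauss a j (t : R) :
  derive1n j (fun s : R => expR (- (a * s ^+ 2)) : R^o) t =
  (hpoly (a *+ 2) j).[t] * expR (- (a * t ^+ 2)).
Proof.
elim: j t => [|j IH] t; first by rewrite /derive1n/= hornerC mul1r.
rewrite derive1nS.
have -> : derive1n j (fun s : R => expR (- (a * s ^+ 2)) : R^o) =
  (fun t => (hpoly (a *+ 2) j).[t] * expR (- (a * t ^+ 2))) by apply/funext.
have H := is_derive_mul (is_derive_poly (hpoly (a *+ 2) j) t)
  (is_derive_exp (is_derive_opp (is_derive_scale a (is_derive_sqr t)))).
rewrite derive1E; have [_ ->] := H.
by rewrite hpolyS hornerD hornerN hornerM hornerZ hornerX; ring.
Qed.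

Let J (p : {poly R}) := \int[mu]_t (p.[t] * expR (- (2 * pi * t ^+ 2))).

Let p0 : 0 < 2 * pi :> R. Proof. by rewrite mulr_gt0// pi_gt0. Qed.

Let JZ c p : J (c *: p) = c * J p.
Proof.
rewrite /J -RintegralZl//; last exact: integrable_poly_gauss.
by apply: eq_Rintegral => t _; rewrite hornerZ -[LHS]mulrA.
Qed.

Let JD p q : J (p + q) = J p + J q.
Proof.
rewrite /J -RintegralD//; [|exact: integrable_poly_gauss..].
by apply: eq_Rintegral => t _; rewrite hornerD mulrDl.
Qed.

Let a : R := (2 * pi) *+ 2.

(** Integration by parts: for the weight e^(- 2 pi t^2), the raising step of [hpoly] is the adjoint
    of - d/dt. *)
Let J_hpolyS p j : J (p * hpoly a j.+1) = - J (p^`() * hpoly a j).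
Proof.
have -> : p * hpoly a j.+1 = ((p * hpoly a j)^`() - (2 * pi) *+ 2 *: 'X * (p * hpoly a j)) +
  (- 1) *: (p^`() * hpoly a j).
  by rewrite hpolyS derivM scaleN1r /a -!mul_polyC; ring.
by rewrite JD JZ mulN1r /J Rintegral_poly_gauss_by_parts// add0r.
Qed.

(** Each integration by parts lowers both indices by one, on the diagonal with a factor 4 pi (j +
    1). The base case is the integral 1 / sqrt 2 of the weight; if one index reaches 0 first, the
    derivative of a constant gives 0. *)
Lemma hpoly_orthogonal j k :
  \int[mu]_t ((hpoly (4 * pi) k).[t] * (hpoly (4 * pi) j).[t] * expR (- (2 * pi * t ^+ 2))) =
  if k == j then (4 * pi) ^+ j * j`!%:R / Num.sqrt 2 else 0.
Proof.
have -> : 4 * pi = a by rewrite /a; ring.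
transitivity (J (hpoly a k * hpoly a j)).
  by apply: eq_Rintegral => t _; rewrite hornerM.
elim: j k => [|j IH] [|k].
- rewrite /= mul1r expr0 fact0 mulr1 div1r /J.
  under eq_Rintegral do rewrite hornerC mul1r.
  rewrite Rintegral_gauss// -sqrtrV//; congr Num.sqrt.
  have : (pi : R) != 0 by rewrite gt_eqF// pi_gt0.
  by move: (pi : R) => P P0; field.
- by rewrite mulrC J_hpolyS/= derivC mul0r /J; under eq_Rintegral do rewrite horner0 mul0r; rewrite /Rintegral integral0 oppr0.
- by rewrite J_hpolyS/= derivC mul0r /J; under eq_Rintegral do rewrite horner0 mul0r; rewrite /Rintegral integral0 oppr0.
- rewrite J_hpolyS deriv_hpoly -scalerAl JZ mulNr opprK IH eqSS.
  case: eqVneq => [->|_]; last by rewrite mulr0.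
  by rewrite exprS factS natrM; ring.
Qed.

Lemma hermite_funE j (t : R) :
  hermite_fun j t = (-1) ^+ j * ((hpoly (4 * pi) j).[t] * expR (- (pi * t ^+ 2))).
Proof.
rewrite /hermite_fun -mulrA; congr (_ * _).
rewrite (derive1n_gauss (2 * pi)) mulrCA -expRD; congr (_.[_] * expR _).
  by congr hpoly; ring.
by ring.
Qed.

Lemma measurable_hermite_fun j : measurable_fun setT (@hermite_fun R j).
Proof.
have -> : @hermite_fun R j = fun t => (-1) ^+ j * ((hpoly (4 * pi) j).[t] * expR (- (pi * t ^+ 2))).
  by apply/funext => t; exact: hermite_funE.
by apply: measurable_funM => //; apply: measurable_funM; [exact: measurable_horner|meas].
Qed.

Lemma hermite_fun_orthogonal j k :
  \int[mu]_t (hermite_fun k t * hermite_fun j t) =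
  if k == j then (4 * pi) ^+ j * j`!%:R / Num.sqrt 2 else 0.
Proof.
transitivity (\int[mu]_t ((-1) ^+ (k + j) * ((hpoly (4 * pi) k).[t] * (hpoly (4 * pi) j).[t] * expR (- (2 * pi * t ^+ 2))))).
  apply: eq_Rintegral => t _; rewrite !hermite_funE exprD.
  have -> : - (2 * pi * t ^+ 2) = - (pi * t ^+ 2) + - (pi * t ^+ 2) by ring.
  by rewrite expRD; ring.
rewrite RintegralZl//; last first.
  have := integrable_poly_gauss (hpoly (4 * pi) k * hpoly (4 * pi) j) p0.
  by under eq_fun do rewrite hornerM.
rewrite hpoly_orthogonal; case: eqP => [->|]; last by rewrite mulr0.
by rewrite addnn -mul2n exprM sqrrN expr1n expr1n mul1r.
Qed.

Lemma hermite_fun_sqint j : sqint mu (@hermite_fun R j).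
Proof.
split; first exact: measurable_hermite_fun.
have := integrable_poly_gauss (hpoly (4 * pi) j ^+ 2) p0.
apply: eq_integrable => // t _; rewrite /= hermite_funE; congr EFin.
have -> : - (2 * pi * t ^+ 2) = - (pi * t ^+ 2) + - (pi * t ^+ 2) by ring.
rewrite !exprMn -exprM mulnC exprM sqrrN expr1n expr1n mul1r expRD horner_exp; ring.
Qed.

Definition hnorm (j : nat) : R := Num.sqrt ((4 * pi) ^+ j * j`!%:R / Num.sqrt 2).

Lemma hnorm_gt0 j : 0 < hnorm j.
Proof.
rewrite sqrtr_gt0 divr_gt0 ?sqrtr_gt0// mulr_gt0 ?exprn_gt0 ?mulr_gt0 ?pi_gt0//.
Qed.

Lemma psiE j (t : R) : psi j t = hermite_fun j t / hnorm j.
Proof.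
rewrite /psi (Lnorm2E (hermite_fun_sqint j))/=; congr (_ / Num.sqrt _).
have := hermite_fun_orthogonal j j; rewrite eqxx => <-.
by apply: eq_Rintegral => s _; rewrite expr2.
Qed.

Lemma psi_orthonormal j k : \int[mu]_t (psi k t * psi j t) = (k == j)%:R.
Proof.
transitivity (\int[mu]_t ((hnorm k * hnorm j)^-1 * (hermite_fun k t * hermite_fun j t))).
  by apply: eq_Rintegral => t _; rewrite !psiE invfM; ring.
rewrite RintegralZl//; last by apply: sqint_mul; exact: hermite_fun_sqint.
rewrite hermite_fun_orthogonal; case: eqVneq => [->|_]; last by rewrite mulr0.
have h0 : 0 <= (4 * pi) ^+ j * j`!%:R / Num.sqrt 2 :> R.
  by rewrite divr_ge0// mulr_ge0// exprn_ge0// mulr_ge0// pi_ge0.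
rewrite -expr2 /hnorm sqr_sqrtr// mulVf//.
by have := hnorm_gt0 j; rewrite sqrtr_gt0 => /gt_eqF ->.
Qed.

Lemma psi_sqint j : sqint mu (@psi R j).
Proof.
have := sqintZ (hnorm j)^-1 (hermite_fun_sqint j).
by congr sqint; apply/funext => t; rewrite psiE mulrC.
Qed.

Lemma psi_bounded j : exists M : R, forall t, `|psi j t| <= M.
Proof.
have [C C0 CP] := poly_gauss_le (hpoly (4 * pi) j) (pi_gt0 R).
exists ((hnorm j)^-1 * C) => t; rewrite psiE hermite_funE mulrC normrM.
have h0 : 0 <= (hnorm j)^-1 by rewrite invr_ge0 ltW// hnorm_gt0.
rewrite (ger0_norm h0) ler_wpM2l//.
rewrite normrM normrX normrN normr1 expr1n mul1r (le_trans (CP t))//.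
by rewrite ler_piMr// -expR0 ler_expR oppr_le0 mulr_ge0 ?sqr_ge0// divr_ge0// pi_ge0.
Qed.

End HermiteFunctions.

(** * Quaternions and the slice of an imaginary unit *)

Section ExpPartialSums.
Variable K : numFieldType.
Implicit Types p r : K.

Lemma sum_triangle (f : nat -> nat -> K) n :
  \sum_(0 <= m < n) \sum_(i < m.+1) f i (m - i)%N =
  \sum_(0 <= i < n) \sum_(0 <= j < n - i) f i j.
Proof.
elim: n => [|n IH]; first by rewrite !big_geq.
rewrite big_nat_recr//= IH [RHS]big_nat_recr//= subSnn big_nat1.
rewrite big_ord_recr/= subnn addrA; congr (_ + _).
rewrite -(big_mkord xpredT (fun i => f i (n - i)%N)) -big_split/=.
by apply: eq_big_nat => i /andP[_ ni]; rewrite subSn 1?ltnW// big_nat_recr.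
Qed.

(** By the binomial theorem, the partial sum for [p + r] is the product of the two series restricted
    to the triangle i + j < n. *)
Lemma exp_partialD p r n :
  \sum_(0 <= k < n) (p + r) ^+ k / k`!%:R =
  \sum_(0 <= i < n) \sum_(0 <= j < n - i) (p ^+ i / i`!%:R) * (r ^+ j / j`!%:R).
Proof.
rewrite -(sum_triangle (fun i j => (p ^+ i / i`!%:R) * (r ^+ j / j`!%:R))).
apply: eq_bigr => k _; rewrite addrC exprDn mulr_suml; apply: eq_bigr => i _.
have ik : (i <= k)%N by rewrite -ltnS.
have f0 m : m`!%:R != 0 :> K by rewrite pnatr_eq0 -lt0n fact_gt0.
have kf : k`!%:R != 0 :> K by exact: f0.
have := bin_fact ik => /(congr1 (fun m => m%:R : K)); rewrite !natrM => H.
rewrite -mulr_natr; apply: (mulIf kf); rewrite mulfVK// -H.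
by field; rewrite !f0.
Qed.

End ExpPartialSums.

Notation cRe := (@complex.Re _).
Notation cIm := (@complex.Im _).

(** * The complex exponential and its power series *)

Section ComplexExp.
Variable R : realType.
Local Open Scope complex_scope.
Implicit Types z w : R[i].

Lemma complex_eq z w : cRe z = cRe w -> cIm z = cIm w -> z = w.
Proof. by case: z => ? ?; case: w => ? ? /= -> ->. Qed.

Lemma cReD z w : cRe (z + w) = cRe z + cRe w.
Proof. by case: z; case: w. Qed.
Lemma cImD z w : cIm (z + w) = cIm z + cIm w.
Proof. by case: z; case: w. Qed.
Lemma cReN z : cRe (- z) = - cRe z.
Proof. by case: z. Qed.
Lemma cImN z : cIm (- z) = - cIm z.
Proof. by case: z. Qed.
Lemma cReM z w : cRe (z * w) = cRe z * cRe w - cIm z * cIm w.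
Proof. by case: z; case: w. Qed.
Lemma cImM z w : cIm (z * w) = cRe z * cIm w + cIm z * cRe w.
Proof. by case: z; case: w. Qed.
Definition cE := (cReD, cImD, cReN, cImN, cReM, cImM).

Lemma complex_sum (s : seq nat) (P : pred nat) (F : nat -> R[i]) :
  \sum_(i <- s | P i) F i =
  (\sum_(i <- s | P i) cRe (F i)) +i* (\sum_(i <- s | P i) cIm (F i)).
Proof.
elim: s => [|i s IH]; first by rewrite !big_nil.
by rewrite !big_cons; case: (P i); rewrite // IH; case: (F i).
Qed.

(** Built from real functions whose derivatives are at hand; [cvg_cexp_re] and [cvg_cexp_im] connect
    it with the series that defines [qexp]. *)
Definition cexp z : R[i] :=
  (expR (cRe z) * cos (cIm z)) +i* (expR (cRe z) * sin (cIm z)).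

Lemma cexpD z w : cexp (z + w) = cexp z * cexp w.
Proof.
by apply: complex_eq; rewrite /= !cE expRD ?cosD ?sinD/=; ring.
Qed.

Lemma cexp_real (a : R) : cexp a%:C = (expR a)%:C.
Proof. by rewrite /cexp/= cos0 sin0 mulr1 mulr0. Qed.

Lemma cexp_coeff (b : R) j :
  (0 +i* b) ^+ j / j`!%:R = cos_coeff b j +i* sin_coeff b j.
Proof.
have E : (0 +i* b) ^+ j = ((~~ odd j)%:R * (-1) ^+ j./2 * b ^+ j) +i*
    ((odd j)%:R * (-1) ^+ j.-1./2 * b ^+ j).
  elim: j => [|j IH]; first by apply: complex_eq; rewrite /= !expr0; ring.
  rewrite exprS IH; apply: complex_eq; rewrite cE /= ?negbK exprS ?uphalf_half.
    case: (boolP (odd j)) => oj; last by rewrite /=; ring.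
    have -> : j.-1./2 = j./2.
      by case: j oj {IH} => //= k; rewrite uphalf_half => /negPf ->.
    by rewrite /= exprS; ring.
  by case: (odd j) => /=; ring.
rewrite E -(rmorph_nat (real_complex R)) -fmorphV; apply: complex_eq; rewrite cE/=.
  by rewrite mulr0 subr0 /cos_coeff/=.
by rewrite mulr0 add0r.
Qed.

Definition cexp_part z n : R[i] := \sum_(0 <= k < n) z ^+ k / k`!%:R.

Lemma cexp_partE (a b : R) n : cexp_part (a +i* b) n =
  (\sum_(0 <= i < n) \sum_(0 <= j < n - i) exp_coeff a i * cos_coeff b j) +i*
  (\sum_(0 <= i < n) \sum_(0 <= j < n - i) exp_coeff a i * sin_coeff b j).
Proof.
have -> : a +i* b = a%:C + (0 +i* b) by apply: complex_eq; rewrite cE/=; ring.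
rewrite /cexp_part exp_partialD complex_sum.
congr (_ +i* _); apply: eq_bigr => i _; rewrite complex_sum/=; apply: eq_bigr => j _;
  rewrite cexp_coeff cE -(rmorphXn (real_complex R)) -(rmorph_nat (real_complex R)) -fmorphV -rmorphM/= /exp_coeff/=; ring.
Qed.

(** The difference [D] between the sums over the square and over the triangle is dominated by the
    same difference for two real exponential series, which tends to 0 because exp(x) exp(y) = exp(x
    + y). *)
Lemma cvg_triangle (u v : nat -> R) (x y A B : R) :
  (forall i, `|u i| <= exp_coeff x i) -> (forall j, `|v j| <= exp_coeff y j) ->
  series u n @[n --> \oo] --> A -> series v n @[n --> \oo] --> B ->
  \sum_(0 <= i < n) \sum_(0 <= j < n - i) u i * v j @[n --> \oo] --> A * B.
Proof.
move=> ux vy uA vB.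
pose D (f g : nat -> R) n := \sum_(0 <= i < n) \sum_(n - i <= j < n) f i * g j.
have DE f g n : \sum_(0 <= i < n) \sum_(0 <= j < n - i) f i * g j = series f n * series g n - D f g n.
  rewrite /D /series/= big_distrlr/= -sumrB; apply: eq_bigr => i _.
  by rewrite (big_cat_nat (leq0n (n - i)) (leq_subr i n))/= addrK.
have Dle n : `|D u v n| <= D (exp_coeff x) (exp_coeff y) n.
  apply: (le_trans (ler_norm_sum _ _ _)); apply: ler_sum => i _.
  apply: (le_trans (ler_norm_sum _ _ _)); apply: ler_sum => j _.
  by rewrite normrM ler_pM.
have D0 : D (exp_coeff x) (exp_coeff y) n @[n --> \oo] --> 0.
  have -> : D (exp_coeff x) (exp_coeff y) = fun n =>
     series (exp_coeff x) n * series (exp_coeff y) n - series (exp_coeff (x + y)) n.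
    apply/funext => n; rewrite {3}/series/= [X in _ - X](_ : _ =
      \sum_(0 <= i < n) \sum_(0 <= j < n - i) exp_coeff x i * exp_coeff y j).
      by rewrite DE opprB addrC subrK.
    by rewrite -exp_partialD; apply: eq_bigr => k _.
  have -> : 0 = expR x * expR y - expR (x + y) by rewrite expRD subrr.
  apply: cvgB; last exact: is_cvg_series_exp_coeff.
  by apply: cvgM; exact: is_cvg_series_exp_coeff.
under eq_fun do rewrite DE.
rewrite -[A * B]subr0; apply: cvgB; first exact: cvgM.
apply: norm_cvg0; apply: (@squeeze_cvgr _ _ _ _ (cst 0) _ _ _ _ _ D0); last exact: cvg_cst.
by apply: nearW => n; rewrite normr_ge0 Dle.
Qed.

Lemma exp_coeff_norm (a : R) i : `|exp_coeff a i| <= exp_coeff `|a| i.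
Proof. by rewrite /exp_coeff/= normrM normrX [X in _ * X]ger0_norm ?invr_ge0. Qed.

Lemma cos_coeff_norm (b : R) j : `|cos_coeff b j| <= exp_coeff `|b| j.
Proof.
rewrite /cos_coeff /exp_coeff/= !normrM normrX (ger0_norm (_ : 0 <= _^-1)) ?invr_ge0//.
rewrite !normrX normrN normr1 expr1n mulr1 ler_wpM2r ?invr_ge0// ler_piMl//.
by case: (odd j); rewrite ?normr0 ?normr1.
Qed.

Lemma sin_coeff_norm (b : R) j : `|sin_coeff b j| <= exp_coeff `|b| j.
Proof.
rewrite /sin_coeff /exp_coeff/= !normrM normrX (ger0_norm (_ : 0 <= _^-1)) ?invr_ge0//.
rewrite !normrX normrN normr1 expr1n mulr1 ler_wpM2r ?invr_ge0// ler_piMl//.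
by case: (odd j); rewrite ?normr0 ?normr1.
Qed.

Lemma cvg_cexp_re z : cRe (cexp_part z n) @[n --> \oo] --> cRe (cexp z).
Proof.
case: z => a b; under eq_fun do rewrite cexp_partE/=.
apply: (cvg_triangle (exp_coeff_norm a) (cos_coeff_norm b)).
  exact: is_cvg_series_exp_coeff.
by rewrite /= cos.unlock; exact: is_cvg_series_cos_coeff.
Qed.

Lemma cvg_cexp_im z : cIm (cexp_part z n) @[n --> \oo] --> cIm (cexp z).
Proof.
case: z => a b; under eq_fun do rewrite cexp_partE/=.
apply: (cvg_triangle (exp_coeff_norm a) (sin_coeff_norm b)).
  exact: is_cvg_series_exp_coeff.
by rewrite /= sin.unlock; exact: is_cvg_series_sin_coeff.
Qed.

End ComplexExp.

(** * Coordinates of quaternions and the embedding of the complex numbers *)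

Section QuaternionBasics.
Variable R : realType.
Implicit Types (p q : quat R) (a : R).

Lemma quat_ext p q : qre p = qre q -> qi p = qi q -> qj p = qj q -> qk p = qk q -> p = q.
Proof. by case: p => ? ? ? ?; case: q => ? ? ? ? /= -> -> -> ->. Qed.

Lemma qreD p q : qre (p + q) = qre p + qre q. Proof. by []. Qed.
Lemma qiD p q : qi (p + q) = qi p + qi q. Proof. by []. Qed.
Lemma qjD p q : qj (p + q) = qj p + qj q. Proof. by []. Qed.
Lemma qkD p q : qk (p + q) = qk p + qk q. Proof. by []. Qed.
Lemma qreN p : qre (- p) = - qre p. Proof. by []. Qed.
Lemma qiN p : qi (- p) = - qi p. Proof. by []. Qed.
Lemma qjN p : qj (- p) = - qj p. Proof. by []. Qed.
Lemma qkN p : qk (- p) = - qk p. Proof. by []. Qed.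
Lemma qreZ a p : qre (a *: p) = a * qre p. Proof. by []. Qed.
Lemma qiZ a p : qi (a *: p) = a * qi p. Proof. by []. Qed.
Lemma qjZ a p : qj (a *: p) = a * qj p. Proof. by []. Qed.
Lemma qkZ a p : qk (a *: p) = a * qk p. Proof. by []. Qed.
Lemma qreM p q : qre (p * q) = qre p * qre q - qi p * qi q - qj p * qj q - qk p * qk q.
Proof. by case: p => ? ? ? ?; case: q. Qed.
Lemma qiM p q : qi (p * q) = qre p * qi q + qi p * qre q + qj p * qk q - qk p * qj q.
Proof. by case: p => ? ? ? ?; case: q. Qed.
Lemma qjM p q : qj (p * q) = qre p * qj q - qi p * qk q + qj p * qre q + qk p * qi q.
Proof. by case: p => ? ? ? ?; case: q. Qed.
Lemma qkM p q : qk (p * q) = qre p * qk q + qi p * qj q - qj p * qi q + qk p * qre q.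
Proof. by case: p => ? ? ? ?; case: q. Qed.

Definition qcE := (qreD, qiD, qjD, qkD, qreN, qiN, qjN, qkN, qreZ, qiZ, qjZ, qkZ,
  qreM, qiM, qjM, qkM).

Lemma qscalerAr a p q : a *: (p * q) = p * (a *: q).
Proof. by apply: quat_ext; rewrite !qcE; ring. Qed.

(** Coordinates are indexed by a finite type so that a quaternion-valued function becomes a finite
    family of real functions. *)
Definition qc (c : 'I_4) (q : quat R) : R :=
  match nat_of_ord c with 0%N => qre q | 1%N => qi q | 2%N => qj q | _ => qk q end.

Definition qe (c : 'I_4) : quat R :=
  match nat_of_ord c with 0%N => 1 | 1%N => Quat 0 1 0 0 | 2%N => Quat 0 0 1 0 | _ => Quat 0 0 0 1 end.

Lemma ord4P (P : 'I_4 -> Prop) : P (inord 0) -> P (inord 1) -> P (inord 2) -> P (inord 3) ->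
  forall c, P c.
Proof.
move=> P0 P1 P2 P3 [[|[|[|[|//]]]] cp].
- by rewrite (_ : Ordinal cp = inord 0)//; apply: val_inj; rewrite /= inordK.
- by rewrite (_ : Ordinal cp = inord 1)//; apply: val_inj; rewrite /= inordK.
- by rewrite (_ : Ordinal cp = inord 2)//; apply: val_inj; rewrite /= inordK.
- by rewrite (_ : Ordinal cp = inord 3)//; apply: val_inj; rewrite /= inordK.
Qed.

Lemma sum_ord4 (V : nmodType) (F : 'I_4 -> V) :
  \sum_c F c = F (inord 0) + F (inord 1) + F (inord 2) + F (inord 3).
Proof.
rewrite !big_ord_recr big_ord0/= add0r; congr (_ + _ + _ + _); congr F; apply: val_inj; by rewrite /= inordK.
Qed.

Lemma qc0 q : qc (inord 0) q = qre q. Proof. by rewrite /qc inordK. Qed.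
Lemma qc1 q : qc (inord 1) q = qi q. Proof. by rewrite /qc inordK. Qed.
Lemma qc2 q : qc (inord 2) q = qj q. Proof. by rewrite /qc inordK. Qed.
Lemma qc3 q : qc (inord 3) q = qk q. Proof. by rewrite /qc inordK. Qed.
Lemma qe0 : qe (inord 0) = 1. Proof. by rewrite /qe inordK. Qed.
Lemma qe1 : qe (inord 1) = Quat 0 1 0 0. Proof. by rewrite /qe inordK. Qed.
Lemma qe2 : qe (inord 2) = Quat 0 0 1 0. Proof. by rewrite /qe inordK. Qed.
Lemma qe3 : qe (inord 3) = Quat 0 0 0 1. Proof. by rewrite /qe inordK. Qed.

Lemma qc_ext p q : (forall c, qc c p = qc c q) -> p = q.
Proof.
move=> H; have := H (inord 0); have := H (inord 1); have := H (inord 2); have := H (inord 3).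
by rewrite !qc0 !qc1 !qc2 !qc3 => ? ? ? ?; exact: quat_ext.
Qed.

Lemma qcD c p q : qc c (p + q) = qc c p + qc c q.
Proof. by rewrite /qc; case: (nat_of_ord c) => [|[|[|]]]. Qed.
Lemma qcN c p : qc c (- p) = - qc c p.
Proof. by rewrite /qc; case: (nat_of_ord c) => [|[|[|]]]. Qed.
Lemma qcB c p q : qc c (p - q) = qc c p - qc c q.
Proof. by rewrite qcD qcN. Qed.
Lemma qcZ c a p : qc c (a *: p) = a * qc c p.
Proof. by rewrite /qc; case: (nat_of_ord c) => [|[|[|]]]. Qed.
Lemma qc_zero c : qc c 0 = 0.
Proof. by rewrite /qc; case: (nat_of_ord c) => [|[|[|]]]. Qed.
Lemma qc_sum c (J : Type) (s : seq J) (P : pred J) (F : J -> quat R) :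
  qc c (\sum_(i <- s | P i) F i) = \sum_(i <- s | P i) qc c (F i).
Proof.
elim: s => [|i s IH]; first by rewrite !big_nil qc_zero.
by rewrite !big_cons; case: (P i); rewrite ?qcD IH.
Qed.

Lemma qdecomp q : q = \sum_c qc c q *: qe c.
Proof.
rewrite sum_ord4 qc0 qc1 qc2 qc3 qe0 qe1 qe2 qe3.
by apply: quat_ext; rewrite !qcE/=; ring.
Qed.

Lemma qc_mul c p q : qc c (p * q) = \sum_d qc d q * qc c (p * qe d).
Proof.
rewrite {1}(qdecomp q) mulr_sumr qc_sum; apply: eq_bigr => d _.
by rewrite -qscalerAr qcZ.
Qed.

Variable I : quat R.
Hypothesis hI : I ^+ 2 = -1.

(** If the real part a were nonzero, its vanishing products with the other coordinates would make I
    real, with a^2 = -1. *)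
Lemma qre_I : qre I = 0.
Proof.
have := hI; case: I => a b c d; rewrite expr2 => /(congr1 (@quat_tuple R)) [].
rewrite /= !oppr0 => H1 H2 H3 H4; apply/eqP; apply: contraT => a0.
have z (x : R) : a * x = 0 -> x = 0.
  by move=> /eqP; rewrite mulf_eq0 (negPf a0)/= => /eqP.
have b0 : b = 0 by apply: z; lra.
have c0 : c = 0 by apply: z; lra.
have d0 : d = 0 by apply: z; lra.
by move: H1; rewrite b0 c0 d0 => H1; have := sqr_ge0 a; rewrite expr2; lra.
Qed.

Lemma norm_I : qi I ^+ 2 + qj I ^+ 2 + qk I ^+ 2 = 1.
Proof.
have := qre_I; have := hI; case: I => a b c d; rewrite expr2 => /(congr1 (@qre R)) /= H a0.
by move: H; rewrite a0 => H; rewrite !expr2; lra.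
Qed.

Lemma mulII : I * I = -1. Proof. by rewrite -expr2. Qed.

(** The identification of C with the slice R + R I, a ring morphism since [I ^+ 2 = -1]. *)
Definition emb (z : R[i]) : quat R := (cRe z)%:A + cIm z *: I.

Lemma embD z w : emb (z + w) = emb z + emb w.
Proof. by rewrite /emb !cE !scalerDl addrACA. Qed.
Lemma embN z : emb (- z) = - emb z.
Proof. by rewrite /emb !cE !scaleNr opprD. Qed.
Lemma emb0 : emb 0 = 0. Proof. by rewrite /emb/= !scale0r addr0. Qed.
Lemma emb1 : emb 1 = 1. Proof. by rewrite /emb/= scale0r addr0 scale1r. Qed.
Lemma embM z w : emb (z * w) = emb z * emb w.
Proof.
rewrite /emb !cE mulrDl !mulrDr -!scalerAl -!qscalerAr !mul1r mulr1 mulII !scalerA.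
by rewrite scalerN !scalerBl !scalerDl; apply: quat_ext; rewrite !qcE; ring.
Qed.
Lemma embX z n : emb (z ^+ n) = emb z ^+ n.
Proof. by elim: n => [|n IH]; rewrite ?expr0 ?emb1// !exprS embM IH. Qed.
Lemma emb_sum (J : Type) (s : seq J) (P : pred J) (F : J -> R[i]) :
  emb (\sum_(i <- s | P i) F i) = \sum_(i <- s | P i) emb (F i).
Proof.
elim: s => [|i s IH]; first by rewrite !big_nil emb0.
by rewrite !big_cons; case: (P i); rewrite ?embD IH.
Qed.
Lemma emb_real (a : R) : emb a%:C%C = a%:A.
Proof. by rewrite /emb/= scale0r addr0. Qed.
Lemma embZ (a : R) z : emb (a%:C%C * z) = a *: emb z.
Proof. by rewrite embM emb_real -scalerAl mul1r. Qed.
Lemma emb_nat n : emb n%:R = n%:R.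
Proof. by elim: n => [|n IH]; rewrite ?emb0// -!natr1 embD IH emb1. Qed.
Lemma emb_imag (b : R) : emb (Complex 0 b) = b *: I.
Proof. by rewrite /emb/= scale0r add0r. Qed.
Lemma emb_conj z : qconj (emb z) = emb (conjc z).
Proof.
case: z => a b; rewrite /emb/=; have := qre_I; move=> I0.
by apply: quat_ext; rewrite !qcE /= ?I0; ring.
Qed.

Lemma qc_emb c z : qc c (emb z) = cRe z * qc c 1 + cIm z * qc c I.
Proof. by rewrite /emb qcD !qcZ. Qed.

Lemma qabs_emb z : qabs (emb z) ^+ 2 = cRe z ^+ 2 + cIm z ^+ 2.
Proof.
rewrite /qabs sqr_sqrtr ?addr_ge0 ?sqr_ge0// !qcE /= qre_I.
have := norm_I; move: (qi I) (qj I) (qk I) => b c d H;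
transitivity (cRe z ^+ 2 + cIm z ^+ 2 * (b ^+ 2 + c ^+ 2 + d ^+ 2)); first by ring.
by rewrite H mulr1.
Qed.

Lemma qexp_emb z : qexp (emb z) = emb (cexp z).
Proof.
have E n : \sum_(0 <= k < n) (k`!%:R^-1 : R) *: emb z ^+ k = emb (cexp_part z n).
  rewrite /cexp_part emb_sum; apply: eq_bigr => k _.
  by rewrite -embX -embZ; congr emb; rewrite mulrC fmorphV rmorph_nat.
have c1 := @cvg_cexp_re R z; have c2 := @cvg_cexp_im R z.
have L (g : quat R -> R) (gl : forall w, g (emb w) = cRe w * g 1 + cIm w * g I) :
    limn (fun n => g (\sum_(0 <= k < n) (k`!%:R^-1 : R) *: emb z ^+ k)) = g (emb (cexp z)).
  apply/cvg_lim => //; under eq_fun do rewrite E gl.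
  rewrite gl; apply: cvgD; apply: cvgM; try exact: cvg_cst; [exact: c1|exact: c2].
rewrite /qexp /qlim; apply: quat_ext => /=.
- by apply: (L (@qre R)) => w; rewrite -!qc0 qc_emb.
- by apply: (L (@qi R)) => w; rewrite -!qc1 qc_emb.
- by apply: (L (@qj R)) => w; rewrite -!qc2 qc_emb.
- by apply: (L (@qk R)) => w; rewrite -!qc3 qc_emb.
Qed.

End QuaternionBasics.

(** * Slice derivatives of slice regular functions *)

Section Holomorphic.
Variable R : realType.
Local Open Scope complex_scope.
Implicit Types M N : R[i] -> R[i].

(* M' is the complex derivative of M (Cauchy-Riemann form). *)
Definition hol M M' : Prop := forall a b : R,
  [/\ is_derive a (1 : R) (fun s => cRe (M (s +i* b))) (cRe (M' (a +i* b))),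
      is_derive a (1 : R) (fun s => cIm (M (s +i* b))) (cIm (M' (a +i* b))),
      is_derive b (1 : R) (fun s => cRe (M (a +i* s))) (- cIm (M' (a +i* b))) &
      is_derive b (1 : R) (fun s => cIm (M (a +i* s))) (cRe (M' (a +i* b)))].

Lemma hol_eq M M' N' : hol M M' -> M' =1 N' -> hol M N'.
Proof. by move=> H /funext <-. Qed.

Lemma hol_add M M' N N' : hol M M' -> hol N N' ->
  hol (fun z => M z + N z) (fun z => M' z + N' z).
Proof.
move=> hM hN a b; have [m1 m2 m3 m4] := hM a b; have [n1 n2 n3 n4] := hN a b.
split; [move: m1 n1|move: m2 n2|move: m3 n3|move: m4 n4] => H1 H2;
  have H := is_derive_add H1 H2; apply: (is_derive_eq (f := fun s => _)).
- by under eq_fun do rewrite cE; exact: H.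
- by rewrite cE.
- by under eq_fun do rewrite cE; exact: H.
- by rewrite cE.
- by under eq_fun do rewrite cE; exact: H.
- by rewrite cE opprD.
- by under eq_fun do rewrite cE; exact: H.
- by rewrite cE.
Qed.

Lemma hol_cst c : hol (fun=> c) (fun=> 0).
Proof. by move=> a b; split => /=; rewrite ?oppr0; exact: is_derive_cst. Qed.

Lemma hol_id : hol id (fun=> 1).
Proof.
move=> a b; split => /=; rewrite ?oppr0;
  [exact: is_derive_id|exact: is_derive_cst|exact: is_derive_cst|exact: is_derive_id].
Qed.

Lemma hol_mul M M' N N' : hol M M' -> hol N N' ->
  hol (fun z => M z * N z) (fun z => M' z * N z + M z * N' z).
Proof.
move=> hM hN a b; have [m1 m2 m3 m4] := hM a b; have [n1 n2 n3 n4] := hN a b.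
split; apply: (is_derive_eq (f := fun s => _)).
- under eq_fun do rewrite cE.
  exact: (is_derive_sub (is_derive_mul m1 n1) (is_derive_mul m2 n2)).
- by rewrite !cE; ring.
- under eq_fun do rewrite cE.
  exact: (is_derive_add (is_derive_mul m1 n2) (is_derive_mul m2 n1)).
- by rewrite !cE; ring.
- under eq_fun do rewrite cE.
  exact: (is_derive_sub (is_derive_mul m3 n3) (is_derive_mul m4 n4)).
- by rewrite !cE; ring.
- under eq_fun do rewrite cE.
  exact: (is_derive_add (is_derive_mul m3 n4) (is_derive_mul m4 n3)).
- by rewrite !cE; ring.
Qed.

Lemma hol_scale c M M' : hol M M' -> hol (fun z => c * M z) (fun z => c * M' z).
Proof.
move=> hM; apply: hol_eq (hol_mul (hol_cst c) hM) _ => z.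
by rewrite mul0r add0r.
Qed.

Lemma hol_sum n (M M' : 'I_n -> R[i] -> R[i]) : (forall i, hol (M i) (M' i)) ->
  hol (fun z => \sum_i M i z) (fun z => \sum_i M' i z).
Proof.
elim: n M M' => [|n IH] M M' H.
  have -> : (fun z => \sum_(i < 0) M i z) = fun=> 0 by apply/funext => z; rewrite big_ord0.
  have -> : (fun z => \sum_(i < 0) M' i z) = fun=> 0 by apply/funext => z; rewrite big_ord0.
  exact: hol_cst.
have -> : (fun z => \sum_(i < n.+1) M i z) = fun z => M ord0 z + \sum_(i < n) M (lift ord0 i) z.
  by apply/funext => z; rewrite big_ord_recl.
have -> : (fun z => \sum_(i < n.+1) M' i z) = fun z => M' ord0 z + \sum_(i < n) M' (lift ord0 i) z.
  by apply/funext => z; rewrite big_ord_recl.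
apply: hol_add => //; exact: (IH (fun i => M (lift ord0 i)) (fun i => M' (lift ord0 i))).
Qed.

Lemma hol_horner (p : {poly R[i]}) : hol (fun z => p.[z]) (fun z => (p^`()).[z]).
Proof.
elim/poly_ind: p => [|p c IH].
  have z0 : (fun z : R[i] => (0 : {poly R[i]}).[z]) = fun=> 0.
    by apply/funext => z; rewrite horner0.
  by rewrite deriv0 z0; exact: hol_cst.
have -> : (fun z => (p * 'X + c%:P).[z]) = fun z => p.[z] * z + c.
  by apply/funext => z; rewrite hornerMXaddC.
apply: (hol_eq (hol_add (hol_mul IH hol_id) (hol_cst c))) => z.
by rewrite derivD derivC addr0 derivM derivX !mulr1 !addr0 hornerD hornerM hornerX.
Qed.

Lemma hol_cexp M M' : hol M M' -> hol (fun z => cexp (M z)) (fun z => M' z * cexp (M z)).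
Proof.
move=> hM a b; have [m1 m2 m3 m4] := hM a b.
split.
- apply: is_derive_eq (is_derive_mul (is_derive_exp m1) (is_derive_cosf m2)) _.
  by rewrite !cE/=; ring.
- apply: is_derive_eq (is_derive_mul (is_derive_exp m1) (is_derive_sinf m2)) _.
  by rewrite !cE/=; ring.
- apply: is_derive_eq (is_derive_mul (is_derive_exp m3) (is_derive_cosf m4)) _.
  by rewrite !cE/=; ring.
- apply: is_derive_eq (is_derive_mul (is_derive_exp m3) (is_derive_sinf m4)) _.
  by rewrite !cE/=; ring.
Qed.

End Holomorphic.

(** * The slice derivative through complex derivatives *)

Section SliceDerivative.
Variable R : realType.
Variable I : quat R.
Hypothesis hI : I ^+ 2 = -1.
Local Open Scope complex_scope.

Lemma qc_qderive1 c (g : R -> quat R) t :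
  qc c (qderive1 g t) = derive1 (fun s => qc c (g s) : R^o) t.
Proof. by rewrite /qc; case: (nat_of_ord c) => [|[|[|]]]. Qed.

Lemma qc_emb_sum d (z : 'I_4 -> R[i]) :
  qc d (\sum_c emb I (z c) * qe R c) =
  \sum_c (cRe (z c) * qc d (qe R c) + cIm (z c) * qc d (I * qe R c)).
Proof.
rewrite qc_sum; apply: eq_bigr => c _.
by rewrite /emb mulrDl -!scalerAl mul1r qcD !qcZ.
Qed.

Lemma qderive1_emb (U V : 'I_4 -> R -> R) (u v : 'I_4 -> R) (t : R) :
  (forall c, is_derive t (1 : R) (U c) (u c)) ->
  (forall c, is_derive t (1 : R) (V c) (v c)) ->
  qderive1 (fun s => \sum_c emb I (U c s +i* V c s) * qe R c) t =
  \sum_c emb I (u c +i* v c) * qe R c.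
Proof.
move=> hU hV; apply: qc_ext => d; rewrite qc_qderive1 qc_emb_sum derive1E.
have -> : (fun s => qc d (\sum_c emb I (U c s +i* V c s) * qe R c)) =
   (fun s => let F c := qc d (qe R c) * U c s + qc d (I * qe R c) * V c s in
     F (inord 0) + F (inord 1) + F (inord 2) + F (inord 3)).
  apply/funext => s; rewrite qc_emb_sum sum_ord4 /=; congr (_ + _ + _ + _); by rewrite ![_ * qc _ _]mulrC.
have H c := is_derive_add (is_derive_scale (qc d (qe R c)) (hU c)) (is_derive_scale (qc d (I * qe R c)) (hV c)).
have [_ ->] := is_derive_add (is_derive_add (is_derive_add (H (inord 0)) (H (inord 1))) (H (inord 2))) (H (inord 3)).
by rewrite sum_ord4/=; congr (_ + _ + _ + _); rewrite ![_ * qc _ _]mulrC.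
Qed.

(** The restriction of [f] to the slice of I, split into four complex functions with the units on
    the right. The slice derivative multiplies by J from the left, so it acts on each coefficient
    separately. *)
Definition slice_rep (f : quat R -> quat R) (M : 'I_4 -> R[i] -> R[i]) :=
  forall z, f (emb I z) = \sum_c emb I (M c z) * qe R c.

(** By the Cauchy-Riemann equations both the x-derivative and - J times the y-derivative have
    coefficients [M'], hence so does their mean; at real points the x-derivative alone is taken. *)
Lemma slice_derive_rep f M M' : slice_rep f M -> (forall c, hol (M c) (M' c)) ->
  slice_rep (slice_derive f) M'.
Proof.
move=> fM hM [x w]; rewrite /slice_derive.
have e1 : qre (emb I (x +i* w)) = x.
  by rewrite /emb !qcE/= (qre_I hI); ring.
have e2 : qim (emb I (x +i* w)) = w *: I.
  by apply: quat_ext; rewrite /emb !qcE/= ?(qre_I hI); ring.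
have e3 : qabs (w *: I) = `|w|.
  have := qabs_emb hI (0 +i* w); rewrite emb_imag /= expr0n add0r => H.
  by apply/eqP; rewrite -(@eqrXn2 _ 2) ?sqrtr_ge0// H real_normK ?num_real.
rewrite e1 e2 e3.
have dA : qderive1 (fun s => f (emb I (s +i* w))) x = \sum_c emb I (M' c (x +i* w)) * qe R c.
  have -> : (fun s => f (emb I (s +i* w))) =
    fun s => \sum_c emb I (cRe (M c (s +i* w)) +i* cIm (M c (s +i* w))) * qe R c.
    by apply/funext => s; rewrite fM; apply: eq_bigr => c _; case: (M c _).
  have h1 c : is_derive x (1 : R) (fun s => cRe (M c (s +i* w))) (cRe (M' c (x +i* w))).
    by have [] := hM c x w.
  have h2 c : is_derive x (1 : R) (fun s => cIm (M c (s +i* w))) (cIm (M' c (x +i* w))).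
    by have [] := hM c x w.
  rewrite (qderive1_emb h1 h2).
  by apply: eq_bigr => c _; case: (M' c _).
case: ifPn => [|w0].
  rewrite normr_eq0 => /eqP w0; rewrite -dA w0; congr (qderive1 _ x).
  by apply/funext => s; rewrite /emb/= scale0r addr0.
(* [slice_derive] uses y = [|w|] and J = sg I with sg the sign of w. The sign enters once through J
   and once through the chain rule, and sg^2 = 1. *)
rewrite normr_eq0 in w0; pose sg : R := `|w|^-1 * w.
have -> : `|w|^-1 *: (w *: I) = sg *: I by rewrite scalerA.
have sgw : `|w| * sg = w by rewrite /sg mulrA mulfV ?normr_eq0// mul1r.
have sg2 : sg * sg = 1.
  have n2 : w * w = `|w| * `|w| by rewrite -!expr2 real_normK// num_real.
  by rewrite /sg mulrACA n2 mulrACA mulVf ?normr_eq0// mulr1.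
have -> : (fun s : R => f (s%:A + `|w| *: (sg *: I))) = fun s => f (emb I (s +i* w)).
  by apply/funext => s; rewrite scalerA sgw.
rewrite dA.
have -> : qderive1 (fun s => f (x%:A + s *: (sg *: I))) `|w| =
    \sum_c emb I (sg%:C * ((0 +i* 1) * M' c (x +i* w))) * qe R c.
  have -> : (fun s => f (x%:A + s *: (sg *: I))) =
    fun s => \sum_c emb I (cRe (M c (x +i* (s * sg))) +i* cIm (M c (x +i* (s * sg)))) * qe R c.
    apply/funext => s; rewrite scalerA -[x%:A + _]/(emb I (x +i* (s * sg))) fM.
    by apply: eq_bigr => c _; case: (M c _).
  have dl : is_derive `|w| (1 : R) (fun s : R => s * sg) sg.
    have := is_derive_mul (is_derive_id `|w| 1) (is_derive_cst sg `|w| 1).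
    by rewrite mul1r mulr0 addr0.
  have h1 c : is_derive `|w| (1 : R) (fun s => cRe (M c (x +i* (s * sg)))) (- cIm (M' c (x +i* w)) * sg).
    apply: (is_derive_comp (f := fun r => cRe (M c (x +i* r))) _ dl).
    by rewrite sgw; have [] := hM c x w.
  have h2 c : is_derive `|w| (1 : R) (fun s => cIm (M c (x +i* (s * sg)))) (cRe (M' c (x +i* w)) * sg).
    apply: (is_derive_comp (f := fun r => cIm (M c (x +i* r))) _ dl).
    by rewrite sgw; have [] := hM c x w.
  rewrite (qderive1_emb h1 h2).
  by apply: eq_bigr => c _; congr (emb I _ * _); apply: complex_eq; rewrite !cE/=; ring.
rewrite mulr_sumr -sumrB scaler_sumr; apply: eq_bigr => c _.
rewrite (mulrA (sg *: I)) -mulrBl scalerAl; congr (_ * _).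
rewrite embZ// -scalerAl.
rewrite -qscalerAr scalerA sg2 scale1r.
rewrite (embM hI) -[emb I (0 +i* 1)]/(emb I (Complex 0 1)) emb_imag scale1r mulrA (mulII hI) mulN1r opprK.
by move: (emb I _) => q; apply: quat_ext; rewrite !qcE; field.
Qed.

Lemma iter_slice_derive_rep f (M : nat -> 'I_4 -> R[i] -> R[i]) :
  slice_rep f (M 0%N) -> (forall m c, hol (M m c) (M m.+1 c)) ->
  forall m, slice_rep (iter m (@slice_derive R) f) (M m).
Proof.
move=> f0 hM; elim=> [//|m IH] /=.
exact: (slice_derive_rep IH).
Qed.

End SliceDerivative.

(** * Integrals of complex-valued functions *)

Section ComplexIntegral.
Context d (T : measurableType d) (R : realType).
Variable mu : {measure set T -> \bar R}.
Local Open Scope complex_scope.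
Implicit Types g h : T -> R[i].

Definition cintegrable g := mu.-integrable setT (EFin \o (fun t => cRe (g t))) /\
  mu.-integrable setT (EFin \o (fun t => cIm (g t))).

Definition cint g : R[i] := (\int[mu]_t cRe (g t)) +i* (\int[mu]_t cIm (g t)).

Lemma cintegrableZ w g : cintegrable g -> cintegrable (fun t => w * g t).
Proof.
move=> [g1 g2]; split; under eq_fun do rewrite cE.
  by apply: integrableRB; exact: integrableRZ.
by apply: integrableRD; exact: integrableRZ.
Qed.

Lemma cintZ w g : cintegrable g -> cint (fun t => w * g t) = w * cint g.
Proof.
move=> [g1 g2]; apply: complex_eq; rewrite cE/=.
  under eq_Rintegral do rewrite cE.
  by rewrite RintegralB ?RintegralZl//; exact: integrableRZ.
under eq_Rintegral do rewrite cE.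
by rewrite RintegralD ?RintegralZl//; exact: integrableRZ.
Qed.

Lemma cint_sum n (g : 'I_n -> T -> R[i]) : (forall i, cintegrable (g i)) ->
  cintegrable (fun t => \sum_i g i t) /\ cint (fun t => \sum_i g i t) = \sum_i cint (g i).
Proof.
elim: n g => [|n IH] g ig.
  have -> : (fun t => \sum_(i < 0) g i t) = fun=> 0 by apply/funext => t; rewrite big_ord0.
  rewrite big_ord0; split; last first.
    by apply: complex_eq; rewrite /=/Rintegral integral0.
  by split => /=; exact: integrable0.
have -> : (fun t => \sum_(i < n.+1) g i t) = fun t => g ord0 t + \sum_(i < n) g (lift ord0 i) t.
  by apply/funext => t; rewrite big_ord_recl.
have [[i1 i2] s] := IH (fun i => g (lift ord0 i)) (fun i => ig _).
have [j1 j2] := ig ord0.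
rewrite big_ord_recl -s; split.
  by split; under eq_fun do rewrite cE; exact: integrableRD.
by apply: complex_eq; rewrite cE/=; under eq_Rintegral do rewrite cE; rewrite RintegralD.
Qed.

Lemma eq_cint g h : g =1 h -> cint g = cint h.
Proof. by move=> /funext ->. Qed.

End ComplexIntegral.

(** * Adjoints of multiples of isometries *)

Lemma cvg_sum0 (R : realType) (K : finType) (u : K -> nat -> R) :
  (forall k, u k n @[n --> \oo] --> 0) -> \sum_k u k n @[n --> \oo] --> 0.
Proof.
move=> u0; have := @cvg_big R K +%R (0 : R) xpredT (@add_continuous R) nat \oo (index_enum K) u (fun=> 0).
by rewrite [X in _ --> X]big1// => H; apply: H => k _; exact: u0.
Qed.

Section Families.
Context (K : finType) d (T : measurableType d) (R : realType).
Variable mu : {measure set T -> \bar R}.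
Implicit Types f g h : K -> T -> R.

(** Finite families of real functions model vectors of quaternion-valued ones: the index set is
    ['I_n.+1 * 'I_4] on the source side and ['I_4] on the target side. *)
Definition fsq f := forall k, sqint mu (f k).
Definition fdot f g := \sum_k \int[mu]_x (f k x * g k x).
Definition fn2 f := \sum_k nrm2 mu (f k).

Lemma fsqD f g : fsq f -> fsq g -> fsq (fun k x => f k x + g k x).
Proof. by move=> sf sg k; exact: sqintD. Qed.

Lemma fsqB f g : fsq f -> fsq g -> fsq (fun k x => f k x - g k x).
Proof. by move=> sf sg k; exact: sqintB. Qed.

Lemma fsqZ a f : fsq f -> fsq (fun k x => a * f k x).
Proof. by move=> sf k; exact: sqintZ. Qed.

Lemma fn2_ge0 f : 0 <= fn2 f.
Proof. by apply: sumr_ge0 => k _; exact: nrm2_ge0. Qed.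

Lemma fdotff f : fdot f f = fn2 f.
Proof. by apply: eq_bigr => k _; apply: eq_Rintegral => x _; rewrite expr2. Qed.

Lemma fdotZl a f g : fsq f -> fsq g -> fdot (fun k x => a * f k x) g = a * fdot f g.
Proof.
move=> sf sg; rewrite mulr_sumr; apply: eq_bigr => k _.
rewrite -RintegralZl//; last exact: sqint_mul.
by apply: eq_Rintegral => x _; rewrite mulrA.
Qed.

Lemma fdotBl f g h : fsq f -> fsq g -> fsq h ->
  fdot (fun k x => f k x - g k x) h = fdot f h - fdot g h.
Proof.
move=> sf sg sh; rewrite -sumrB; apply: eq_bigr => k _.
rewrite -RintegralB//; [|exact: sqint_mul..].
by apply: eq_Rintegral => x _; rewrite mulrBl.
Qed.

Lemma fn2_comb a b f g : fsq f -> fsq g -> fn2 (fun k x => a * f k x + b * g k x) =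
  a ^+ 2 * fn2 f + a * b *+ 2 * fdot f g + b ^+ 2 * fn2 g.
Proof.
move=> sf sg; rewrite /fn2 /fdot !mulr_sumr -!big_split/=.
by apply: eq_bigr => k _; rewrite nrm2_comb.
Qed.

Lemma fn2D f g : fsq f -> fsq g ->
  fn2 (fun k x => f k x + g k x) = fn2 f + 2 * fdot f g + fn2 g.
Proof.
move=> sf sg; have := fn2_comb 1 1 sf sg; rewrite expr1n !mul1r => <-.
by apply: eq_bigr => k _; apply: eq_Rintegral => x _; rewrite !mul1r.
Qed.

(** The parallelogram identity for f - h and g - h, with the nonnegative term dropped. *)
Lemma fn2B_le f g h : fsq f -> fsq g -> fsq h ->
  fn2 (fun k x => f k x - g k x) <=
  2 * fn2 (fun k x => f k x - h k x) + 2 * fn2 (fun k x => g k x - h k x).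
Proof.
move=> sf sg sh.
have H := fn2_comb 1 (-1) (fsqB sf sh) (fsqB sg sh).
have H' := fn2_comb 1 1 (fsqB sf sh) (fsqB sg sh).
have := fn2_ge0 (fun k x => 1 * (f k x - h k x) + 1 * (g k x - h k x)).
rewrite H' (_ : fn2 (fun k x => f k x - g k x) = fn2 (fun k x => 1 * (f k x - h k x) + -1 * (g k x - h k x))).
  by rewrite H; move: (fn2 _) (fn2 _) (fdot _ _) => a b c; lra.
by apply: eq_bigr => k _; apply: eq_Rintegral => x _; congr (_ ^+ 2); ring.
Qed.

Lemma nrm2_le_fn2 f k : nrm2 mu (f k) <= fn2 f.
Proof.
by rewrite /fn2 (bigD1 k)//= lerDl; apply: sumr_ge0 => i _; exact: nrm2_ge0.
Qed.

Lemma fn2_eq0 f : fsq f -> fn2 f = 0 -> forall k, {ae mu, forall x, f k x = 0}.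
Proof.
move=> sf f0 k; apply: nrm2_eq0 => //; apply/eqP.
by rewrite eq_le nrm2_ge0 andbT -f0 nrm2_le_fn2.
Qed.

Lemma fsq_complete (f : nat -> K -> T -> R) : (forall n, fsq (f n)) ->
  (forall e, 0 < e -> exists N, forall m n, (N <= m)%N -> (N <= n)%N ->
    fn2 (fun k x => f m k x - f n k x) <= e) ->
  exists2 g, fsq g & fn2 (fun k x => f n k x - g k x) @[n --> \oo] --> 0.
Proof.
move=> sf cf.
have ex k : exists g : T -> R, sqint mu g /\ nrm2 mu (fun x => f n k x - g x) @[n --> \oo] --> 0.
  have [|g sg gf] := @sqint_complete _ _ _ mu (fun n => f n k) (fun n => sf n k).
    move=> e /cf[N HN]; exists N => m n Nm Nn.
    by apply: le_trans (HN m n Nm Nn); exact: (nrm2_le_fn2 (fun k x => f m k x - f n k x)).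
  by exists g.
have [g gP] := choice ex; exists g => [k|]; first by have [] := gP k.
by apply: cvg_sum0 => k; have [] := gP k.
Qed.

(** The Cauchy-Schwarz inequality in each coordinate. *)
Lemma cvg_fdot (f : nat -> K -> T -> R) g h : (forall n, fsq (f n)) -> fsq g -> fsq h ->
  fn2 (fun k x => f n k x - g k x) @[n --> \oo] --> 0 ->
  fdot (f n) h @[n --> \oo] --> fdot g h.
Proof.
move=> sf sg sh fg.
have CS n : `|fdot (fun k x => f n k x - g k x) h| <=
    \sum_(k : K) Num.sqrt (fn2 (fun k x => f n k x - g k x) * fn2 h).
  apply: (le_trans (ler_norm_sum _ _ _)); apply: ler_sum => k _.
  rewrite -sqrtr_sqr ler_wsqrtr//; apply: (le_trans (cauchy_schwarz (sqintB (sf n k) (sg k)) (sh k))).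
  by rewrite ler_pM ?nrm2_ge0// ?(nrm2_le_fn2 (fun k x => f n k x - g k x))// nrm2_le_fn2.
have c0 : \sum_(k : K) Num.sqrt (fn2 (fun k x => f n k x - g k x) * fn2 h) @[n --> \oo] --> 0.
  apply: cvg_sum0 => k; rewrite -[X in _ --> X]sqrtr0 -(mul0r (fn2 h)).
  have H : fn2 (fun k0 x => f n k0 x - g k0 x) * fn2 h @[n --> \oo] --> 0 * fn2 h.
    by apply: cvgM => //; exact: cvg_cst.
  exact: (continuous_cvg _ (@sqrt_continuous R _) H).
have : fdot (fun k x => f n k x - g k x) h @[n --> \oo] --> 0.
  apply: norm_cvg0; apply: (@squeeze_cvgr _ _ _ _ (cst 0) _ _ _ _ _ c0); last exact: cvg_cst.
  by apply: nearW => n; rewrite normr_ge0 CS.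
move=> /(cvgD (cvg_cst (fdot g h))); rewrite addr0 => H.
have -> : (fun n => fdot (f n) h) = fun n => fdot g h + fdot (fun k x => f n k x - g k x) h.
  by apply/funext => n; rewrite fdotBl// addrC subrK.
exact: H.
Qed.

End Families.

(** * Abstract adjoint of an additive operator with |V h|^2 = 2 |h|^2 *)

Section IsometryAdjoint.
Context (K L : finType) d1 (T1 : measurableType d1) d2 (T2 : measurableType d2) (R : realType).
Variables (m1 : {measure set T1 -> \bar R}) (m2 : {measure set T2 -> \bar R}).
Variable V : (K -> T1 -> R) -> L -> T2 -> R.
Hypothesis V_fsq : forall h, fsq m1 h -> fsq m2 (V h).
Hypothesis V_iso : forall h, fsq m1 h -> fn2 m2 (V h) = 2 * fn2 m1 h.
Hypothesis V_add : forall f g, fsq m1 f -> fsq m1 g ->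
  V (fun k x => f k x + g k x) = fun l y => V f l y + V g l y.
Implicit Types (f g h : K -> T1 -> R) (u v : L -> T2 -> R).

(** Polarization, from the norm of f + g. *)
Lemma isometry_dot f g : fsq m1 f -> fsq m1 g -> fdot m2 (V f) (V g) = 2 * fdot m1 f g.
Proof.
move=> sf sg; have := V_iso (fsqD sf sg); rewrite V_add// !fn2D//; [|exact: V_fsq..].
by rewrite !V_iso//; move: (fdot _ _ _) (fdot _ _ _) (fn2 _ _) (fn2 _ _) => a b c e; lra.
Qed.

(* f is the value at u of the adjoint of V. *)
Definition adj u f := fsq m1 f /\ forall h, fsq m1 h -> fdot m1 f h = fdot m2 u (V h).

(* 0 <= |2 u - V f|^2 = 4 |u|^2 - 4 <u, V f> + 2 |f|^2 and <u, V f> = |f|^2. *)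
Lemma adj_bound u f : fsq m2 u -> adj u f -> fn2 m1 f <= 2 * fn2 m2 u.
Proof.
move=> su [sf uf]; have := fn2_ge0 m2 (fun k x => 2 * u k x + (-1) * V f k x).
rewrite fn2_comb//; last exact: V_fsq.
rewrite -uf// fdotff V_iso//; move: (fn2 _ _) (fn2 _ _) => a b; rewrite !expr2; lra.
Qed.

Lemma adjB u f v g : fsq m2 u -> fsq m2 v -> adj u f -> adj v g ->
  adj (fun l y => u l y - v l y) (fun k x => f k x - g k x).
Proof.
move=> su sv [sf uf] [sg vg]; split=> [|h sh]; first exact: fsqB.
by rewrite !fdotBl ?uf ?vg//; exact: V_fsq.
Qed.

(** The difference is an adjoint value at u - u = 0, so [adj_bound] gives it norm zero. *)
Lemma adj_unique u f g : fsq m2 u -> adj u f -> adj u g ->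
  forall k, {ae m1, forall x, f k x = g k x}.
Proof.
move=> su uf ug k; have ufg := adjB su su uf ug.
have : {ae m1, forall x, f k x - g k x = 0}.
  apply: (@fn2_eq0 _ _ _ _ m1 (fun k x => f k x - g k x)); first by have [] := ufg.
  apply/eqP; rewrite eq_le fn2_ge0 andbT (le_trans (adj_bound (fsqB su su) ufg))//.
  rewrite /fn2 big1 ?mulr0// => l _; rewrite /nrm2 /Rintegral.
  by under eq_integral do rewrite subrr expr0n/=; rewrite integral0.
by apply: filterS => x /eqP; rewrite subr_eq0 => /eqP.
Qed.

(** By [adj_bound] the adjoint values form a Cauchy sequence, and the adjoint relation passes to the
    limit by continuity of the inner products. *)
Lemma adj_closed (u : nat -> L -> T2 -> R) v (f : nat -> K -> T1 -> R) :
  (forall n, fsq m2 (u n)) -> fsq m2 v -> (forall n, adj (u n) (f n)) ->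
  fn2 m2 (fun l y => u n l y - v l y) @[n --> \oo] --> 0 ->
  exists2 g, adj v g & fn2 m1 (fun k x => f n k x - g k x) @[n --> \oo] --> 0.
Proof.
move=> su sv uf uv; have sf n : fsq m1 (f n) by have [] := uf n.
have [|g sg fg] := fsq_complete sf.
  (* 2 (2 e/8 + 2 e/8) = e: the outer factor comes from [adj_bound], the inner ones from
     [fn2B_le]. *)
  move=> e e0; have e8 : 0 < e / 8 by rewrite divr_gt0.
  have /cvgrPdist_le/(_ _ e8)[N _ HN] := uv; exists N => m n Nm Nn.
  have B := adj_bound (fsqB (su m) (su n)) (adjB (su m) (su n) (uf m) (uf n)).
  have := fn2B_le (su m) (su n) sv.
  have := HN _ Nm; have := HN _ Nn; rewrite /= !sub0r !normrN !ger0_norm ?fn2_ge0//.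
  by move: B; move: (fn2 _ _) (fn2 _ _) (fn2 _ _) (fn2 _ _) => a b c k; lra.
exists g => //; split=> // h sh.
have c1 := cvg_fdot sf sg sh fg; have c2 := cvg_fdot su sv (V_fsq sh) uv.
rewrite -(cvg_lim _ c1)// -(cvg_lim _ c2)//; congr (lim (_ @ \oo)).
by apply/funext => n; have [_ ->] := uf n.
Qed.

Lemma adj_isometry f : fsq m1 f -> adj (V f) (fun k x => 2 * f k x).
Proof.
move=> sf; split=> [|h sh]; first exact: fsqZ.
by rewrite fdotZl// isometry_dot.
Qed.

End IsometryAdjoint.

(** * Bargmann transform on a slice *)

Lemma Rintegral_sum d (T : measurableType d) (R : realType)
    (mu : {measure set T -> \bar R}) (K : finType) (f : K -> T -> R) :
  (forall i, mu.-integrable setT (EFin \o f i)) ->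
  mu.-integrable setT (EFin \o (fun t => \sum_i f i t)) /\
  \int[mu]_t (\sum_i f i t) = \sum_i \int[mu]_t f i t.
Proof.
move=> fi; rewrite -big_enum/=.
have -> : (fun t => \sum_i f i t) = fun t => \sum_(i <- enum K) f i t.
  by apply/funext => t; rewrite big_enum.
elim: (enum K) => [|k s [i1 s1]].
  under eq_fun do rewrite big_nil.
  by rewrite big_nil; split; [exact: integrable0|rewrite /Rintegral integral0].
under eq_fun do rewrite big_cons.
by rewrite big_cons -s1; split; [exact: integrableRD|rewrite RintegralD].
Qed.

Section BargmannKernel.
Variable R : realType.
Local Notation mu := (@lebesgue_measure R).
Local Open Scope complex_scope.

(** The coefficient of q t in the exponent of the Bargmann kernel. *)
Variable kap : R.
Hypothesis kapE : kap = 2 * pi * Num.sqrt 2.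

Let kap_gt0 : 0 < kap.
Proof. by rewrite kapE !mulr_gt0 ?pi_gt0// sqrtr_gt0. Qed.

Let kap_ge0 : 0 <= kap. Proof. exact: ltW. Qed.

(** One quarter of the exponent - pi t^2 absorbs the power of t, another quarter the linear term
    after completing the square. The bound is uniform for [|a| <= A], as differentiation under the
    integral requires. *)
Lemma kernel_bound r (A : R) : exists2 K, 0 <= K & forall t a, `|a| <= A ->
  `|t| ^+ r * expR (- (pi * t ^+ 2) + kap * t * a) <= K * expR (- (pi / 2 * t ^+ 2)).
Proof.
have p4 : 0 < pi / 4 :> R by rewrite divr_gt0// pi_gt0.
have [C C0 CP] := norm_pow_le_exp r p4.
exists (C * expR ((kap * A) ^+ 2 / pi)); first by rewrite mulr_ge0 ?expR_ge0.
move=> t a aA.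
apply: (le_trans (ler_wpM2r (expR_ge0 _) (CP t))).
rewrite -[leLHS]mulrA -[leRHS]mulrA -!expRD ler_wpM2l// ler_expR.
have H1 : kap * t * a <= kap * A * `|t|.
  rewrite (le_trans (ler_norm _))// !normrM (ger0_norm kap_ge0) mulrAC.
  by rewrite ler_wpM2r// ler_wpM2l// kap_ge0.
have H2 : kap * A * `|t| <= pi / 4 * t ^+ 2 + (kap * A) ^+ 2 / pi.
  have p0 := pi_gt0 R; rewrite -(real_normK (num_real t)).
  move: (kap * A) (pi : R) p0 => q P P0.
  have -> : P / 4 * `|t| ^+ 2 + q ^+ 2 / P = q * `|t| + P * (`|t| / 2 - q / P) ^+ 2.
    by field; rewrite gt_eqF.
  by rewrite lerDl mulr_ge0 ?sqr_ge0// ltW.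
move: (pi : R) H1 H2 => P; lra.
Qed.

Variable phi : R -> R.
Hypothesis sphi : sqint mu phi.

Let mphi : measurable_fun setT phi. Proof. by have [] := sphi. Qed.

Let iphi K : mu.-integrable setT (EFin \o (fun t => K * `|phi t * expR (- (pi / 2 * t ^+ 2))|)).
Proof.
apply: integrableRZ; apply: integrable_norm; apply: sqint_mul => //.
split; first by meas.
have p0 := pi_gt0 R; have := integrable_gauss_scaled p0.
apply: eq_integrable => // t _ /=; congr EFin; rewrite [RHS]expr2 -expRD; congr expR.
by move: (pi : R) => P; field.
Qed.

(** For g = cos and g = sin these are the real and imaginary parts of phi(t) t^r [kexp t (a +i* b)];
    g = - sin also occurs, as the derivative of cos. *)
Let kf (g : R -> R) r (a b t : R) :=
  phi t * (t ^+ r * (expR (- (pi * t ^+ 2) + kap * t * a) * g (kap * t * b))).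

Let kf_bound (g : R -> R) r A : (forall x, `|g x| <= 1) ->
  exists2 K, 0 <= K & forall a b t, `|a| <= A ->
  `|kap * kf g r a b t| <= K * `|phi t * expR (- (pi / 2 * t ^+ 2))|.
Proof.
move=> g1; have [K K0 KP] := kernel_bound r A.
exists (kap * K) => [|a b t aA]; first by rewrite mulr_ge0// kap_ge0.
rewrite normrM (ger0_norm kap_ge0) -[leRHS]mulrA ler_wpM2l// /kf !normrM [leRHS]mulrCA ler_wpM2l//.
rewrite normrX !(ger0_norm (expR_ge0 _)) mulrA.
by rewrite (le_trans _ (KP t a aA))// ler_piMr// mulr_ge0 ?expR_ge0 ?exprn_ge0.
Qed.

Let kap_neq0 : kap != 0.
Proof. by rewrite gt_eqF. Qed.

Let kf_integrable (g : R -> R) r a b : (forall x, `|g x| <= 1) ->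
  measurable_fun setT g -> mu.-integrable setT (EFin \o kf g r a b).
Proof.
move=> g1 mg; have [K K0 KP] := kf_bound r `|a| g1.
have : mu.-integrable setT (EFin \o (fun t => kap * kf g r a b t)).
  apply: (@integrableR_le _ _ _ mu _ _ _ (fun t => KP a b t (lexx _))).
    by rewrite /kf; meas.
  exact: iphi.
move=> /(integrableRZ kap^-1); apply: eq_integrable => // t _ /=.
by rewrite mulKf.
Qed.

Let U (g : R -> R) r a b := \int[mu]_t kf g r a b t.

Let dU_a (g : R -> R) r (a b : R) : (forall x, `|g x| <= 1) ->
  measurable_fun setT g -> is_derive a (1 : R) (fun a => U g r a b) (kap * U g r.+1 a b).
Proof.
move=> g1 mg; have [K K0 KP] := kf_bound r.+1 (`|a| + 1) g1.
rewrite -RintegralZl//; last exact: kf_integrable.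
apply: (@is_derive_under_integral _ _ _ mu (fun x t => kf g r x b t) (fun x t => kap * kf g r.+1 x b t) (fun t => K * `|phi t * expR (- (pi / 2 * t ^+ 2))|)) => //.
- by move=> x _; exact: kf_integrable.
- move=> x t _; rewrite /kf.
  have d1 : is_derive x (1 : R) (fun x => - (pi * t ^+ 2) + kap * t * x) (kap * t).
    apply: is_derive_eq (is_derive_add (is_derive_cst _ x 1) (is_derive_scale (kap * t) (is_derive_id x 1))) _.
    by rewrite add0r mulr1.
  apply: is_derive_eq (is_derive_scale (phi t) (is_derive_scale (t ^+ r) (is_derive_mul (is_derive_exp d1) (is_derive_cst (g (kap * t * b)) x 1)))) _.
  by rewrite (exprS t r) /cst; move: (expR _) (g _) (t ^+ r) (phi t) => e1 e2 e3 e4; ring.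
- by move=> t; rewrite mulr_ge0.
- move=> x t xa; apply: KP; have := ler_normD (x - a) a; rewrite subrK => /le_trans; apply.
  by rewrite [leRHS]addrC lerD2r ltW.
Qed.

Let dU_b (g g' : R -> R) r (a b : R) : (forall x, `|g x| <= 1) -> (forall x, `|g' x| <= 1) ->
  measurable_fun setT g -> measurable_fun setT g' ->
  (forall x : R, is_derive x (1 : R) g (g' x)) ->
  is_derive b (1 : R) (fun b => U g r a b) (kap * U g' r.+1 a b).
Proof.
move=> g1 g'1 mg mg' dg; have [K K0 KP] := kf_bound r.+1 `|a| g'1.
rewrite -RintegralZl//; last exact: kf_integrable.
apply: (@is_derive_under_integral _ _ _ mu (fun x t => kf g r a x t) (fun x t => kap * kf g' r.+1 a x t) (fun t => K * `|phi t * expR (- (pi / 2 * t ^+ 2))|)) => //.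
- by move=> x _; exact: kf_integrable.
- move=> x t _; rewrite /kf.
  have d1 : is_derive x (1 : R) (fun x => kap * t * x) (kap * t).
    by apply: is_derive_eq (is_derive_scale (kap * t) (is_derive_id x 1)) _; rewrite mulr1.
  apply: is_derive_eq (is_derive_scale (phi t) (is_derive_scale (t ^+ r) (is_derive_scale _ (is_derive_comp (dg _) d1)))) _.
  by rewrite (exprS t r); move: (expR _) (g' _) (t ^+ r) (phi t) => e1 e2 e3 e4; ring.
- by move=> t; rewrite mulr_ge0.
- by move=> x t xa; exact: KP.
Qed.

Definition kexp (t : R) (z : R[i]) : R[i] := cexp (- (pi * t ^+ 2)%:C + (kap * t)%:C * z).

Lemma kexpE t a b : kexp t (a +i* b) =
  (expR (- (pi * t ^+ 2) + kap * t * a) * cos (kap * t * b)) +i*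
  (expR (- (pi * t ^+ 2) + kap * t * a) * sin (kap * t * b)).
Proof.
have E : - (pi * t ^+ 2)%:C + (kap * t)%:C * (a +i* b) =
   (- (pi * t ^+ 2) + kap * t * a) +i* (kap * t * b).
  by apply: complex_eq; rewrite !cE/=; ring.
by rewrite /kexp E /cexp.
Qed.

Definition moment r z : R[i] := cint mu (fun t => (phi t * t ^+ r)%:C * kexp t z).

Lemma moment_integrable r z : cintegrable mu (fun t => (phi t * t ^+ r)%:C * kexp t z).
Proof.
case: z => a b; split.
- have := kf_integrable r a b (@cos_max R) (continuous_measurable_fun (@continuous_cos R)).
  by apply: eq_integrable => // t _; rewrite /comp cE kexpE/= /kf; congr EFin; ring.
- have := kf_integrable r a b (@sin_max R) (continuous_measurable_fun (@continuous_sin R)).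
  by apply: eq_integrable => // t _; rewrite /comp cE kexpE/= /kf; congr EFin; ring.
Qed.

Let momentE r a b : moment r (a +i* b) = U cos r a b +i* U sin r a b.
Proof.
by apply: complex_eq; apply: eq_Rintegral => t _; rewrite cE kexpE/= /kf; ring.
Qed.

(** The kernel depends on z through e^(kap t z), so a derivative brings down the factor kap t and
    raises the order of the moment. *)
Lemma hol_moment r : hol (moment r) (fun z => kap%:C * moment r.+1 z).
Proof.
have mc := continuous_measurable_fun (@continuous_cos R).
have ms := continuous_measurable_fun (@continuous_sin R).
have mns : measurable_fun setT (fun x : R => - sin x) by meas.
have c1 := @cos_max R; have s1 := @sin_max R.
have ns1 (x : R) : `|- sin x| <= 1 by rewrite normrN.
have UN r' a b : U (fun x => - sin x) r' a b = - U sin r' a b.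
  rewrite /U -mulN1r -RintegralZl//; last exact: kf_integrable.
  by apply: eq_Rintegral => t _; rewrite /kf; ring.
move=> a b; split.
- have H := dU_a r a b c1 mc; under eq_fun do rewrite momentE/=.
  by apply: is_derive_eq H _; rewrite cE momentE/=; ring.
- have H := dU_a r a b s1 ms; under eq_fun do rewrite momentE/=.
  by apply: is_derive_eq H _; rewrite cE momentE/=; ring.
- have H := dU_b r a b c1 ns1 mc mns (fun x => is_derive_cos x); under eq_fun do rewrite momentE/=.
  by apply: is_derive_eq H _; rewrite UN cE momentE/=; ring.
- have H := dU_b r a b s1 c1 ms mc (fun x => is_derive_sin x); under eq_fun do rewrite momentE/=.
  by apply: is_derive_eq H _; rewrite cE momentE/=; ring.
Qed.

Local Notation twopi := ((2 * pi)%:C : R[i]).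
Local Notation He := (hpoly twopi).

(* The m-th complex derivative of the Bargmann transform of phi is
   2^(3/4) exp(- pi z^2) (msum m z). *)
Definition msum m (z : R[i]) : R[i] :=
  \sum_(k < m.+1) ((He (m - k)).[z] * (kap%:C ^+ k * moment k z)) *+ 'C(m, k).

Definition barg m (z : R[i]) : R[i] :=
  (2 `^ (3 / 4))%:C * (cexp (- (pi%:C * z ^+ 2)) * msum m z).

(** The derivative - 2 pi z of the Gaussian exponent and the derivative of [He] combine to the next
    [He], while the moments move up by one; Pascal's rule regroups the two sums. *)
Lemma hol_barg m : hol (barg m) (barg m.+1).
Proof.
apply: hol_scale.
have h1 : hol (fun z : R[i] => - (pi%:C * z ^+ 2)) (fun z => - (twopi * z)).
  have := hol_horner (- (pi%:C *: 'X^2) : {poly R[i]}).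
  have -> : (fun z => (- (pi%:C *: 'X^2) : {poly R[i]}).[z]) = fun z => - (pi%:C * z ^+ 2).
    by apply/funext => z; rewrite hornerN hornerZ hornerXn.
  move/hol_eq; apply => z; rewrite derivN derivZ derivXn hornerN hornerZ hornerMn hornerXn/= expr1.
  by rewrite rmorphM/= rmorph_nat mulr2n; ring.
have h2 : hol (msum m) (fun z => \sum_(k < m.+1)
   (((He (m - k))^`()).[z] * (kap%:C ^+ k * moment k z) +
    (He (m - k)).[z] * (kap%:C ^+ k.+1 * moment k.+1 z)) *+ 'C(m, k)).
  apply: hol_sum => k.
  have := hol_scale ('C(m, k)%:R) (hol_mul (hol_horner (He (m - k))) (hol_scale (kap%:C ^+ k) (hol_moment k))).
  have -> : (fun z => 'C(m, k)%:R * ((He (m - k)).[z] * (kap%:C ^+ k * moment k z))) =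
    (fun z => ((He (m - k)).[z] * (kap%:C ^+ k * moment k z)) *+ 'C(m, k)).
    by apply/funext => z; rewrite mulr_natl.
  by move/hol_eq; apply => z; rewrite mulr_natl exprSr; congr (_ *+ _); ring.
apply: (hol_eq (hol_mul (hol_cexp h1) h2)) => z.
have -> : msum m.+1 z = - (twopi * z) * msum m z + \sum_(k < m.+1)
   (((He (m - k))^`()).[z] * (kap%:C ^+ k * moment k z) +
    (He (m - k)).[z] * (kap%:C ^+ k.+1 * moment k.+1 z)) *+ 'C(m, k).
  rewrite /msum -(sum_pascal (fun k n => (He n).[z] * (kap%:C ^+ k * moment k z))).
  rewrite mulr_sumr -!big_split/=; apply: eq_bigr => k _.
  rewrite hornerD hornerN hornerM hornerZ hornerX.
  move: twopi ((He (m - k))^`().[z]) ((He (m - k)).[z]) (kap%:C ^+ k * moment k z)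
    (kap%:C ^+ k.+1 * moment k.+1 z) ('C(m, k)) => tp d h P Q n.
  by rewrite mulrnAr -[RHS]mulrnDl -[LHS]mulrnDl; congr (_ *+ _); ring.
ring.
Qed.

(** [hpoly_add] with the shift - sqrt 2 t: its powers of - (2 pi)(- sqrt 2 t) = kap t are exactly
    the factors that occur in the moments. *)
Lemma msumE m z : msum m z = cint mu (fun t => (He m).[z - (Num.sqrt 2 * t)%:C] * ((phi t)%:C * kexp t z)) /\
  cintegrable mu (fun t => (He m).[z - (Num.sqrt 2 * t)%:C] * ((phi t)%:C * kexp t z)).
Proof.
have E : (fun t => (He m).[z - (Num.sqrt 2 * t)%:C] * ((phi t)%:C * kexp t z)) =
  fun t => \sum_(k < m.+1) (((He (m - k)).[z] * kap%:C ^+ k) *+ 'C(m, k)) * ((phi t * t ^+ k)%:C * kexp t z).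
  apply/funext => t; rewrite hpoly_add mulr_suml; apply: eq_bigr => k _.
  have -> : - (twopi * - (Num.sqrt 2 * t)%:C) = (kap * t)%:C.
    by rewrite mulrN opprK -rmorphM/=; rewrite kapE; congr (_%:C); ring.
  rewrite -!mulrnAl !mulrnAl; congr (_ *+ _).
  by rewrite !rmorphM/= !rmorphXn/= exprMn; ring.
rewrite E; have ik (k : 'I_m.+1) := cintegrableZ (((He (m - k)).[z] * kap%:C ^+ k) *+ 'C(m, k)) (moment_integrable k z).
have [ii ->] := cint_sum ik; split=> //.
apply: eq_bigr => k _; rewrite cintZ; last exact: moment_integrable.
by rewrite -mulrnAl mulrA mulrnAl.
Qed.

(* By hpoly_add the sum over k is a Taylor expansion at z - sqrt 2 t; its
   argument z + conj z - sqrt 2 t is real. *)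
Lemma barg_umbral j z :
  \sum_(k < j.+1) ((- (2 * pi))%:C * conjc z) ^+ k * barg (j - k) z *+ 'C(j, k) =
  (2 `^ (3 / 4))%:C * (cexp (- (pi%:C * z ^+ 2)) *
    cint mu (fun t => ((hpoly (2 * pi) j).[2 * cRe z - Num.sqrt 2 * t] * phi t)%:C * kexp t z)).
Proof.
transitivity ((2 `^ (3 / 4))%:C * (cexp (- (pi%:C * z ^+ 2)) *
  \sum_(k < j.+1) (((- (twopi * conjc z)) ^+ k) *+ 'C(j, k)) * msum (j - k) z)).
  rewrite !mulr_sumr; apply: eq_bigr => k _.
  rewrite /barg rmorphN/= mulNr.
  move: ((2 `^ (3 / 4))%:C) (cexp _) (_ ^+ k) (msum _ z) ('C(j, k)) => p1 p2 p3 p4 n.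
  by rewrite mulrnAl !mulrnAr; congr (_ *+ _); ring.
congr (_ * (_ * _)).
have ik (k : 'I_j.+1) := cintegrableZ (((- (twopi * conjc z)) ^+ k) *+ 'C(j, k)) (msumE (j - k) z).2.
transitivity (cint mu (fun t => \sum_(k < j.+1) ((- (twopi * conjc z)) ^+ k *+ 'C(j, k)) *
    ((He (j - k)).[z - (Num.sqrt 2 * t)%:C] * ((phi t)%:C * kexp t z)))).
  rewrite (cint_sum ik).2; apply: eq_bigr => k _.
  by rewrite (msumE (j - k) z).1 cintZ//; exact: (msumE (j - k) z).2.
apply: eq_cint => t.
transitivity (((He j).[z - (Num.sqrt 2 * t)%:C + conjc z]) * ((phi t)%:C * kexp t z)).
  rewrite hpoly_add mulr_suml; apply: eq_bigr => k _.
  by rewrite mulrA mulrnAl.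
have -> : z - (Num.sqrt 2 * t)%:C + conjc z = (2 * cRe z - Num.sqrt 2 * t)%:C.
  by case: (z) => a b; apply: complex_eq; rewrite !cE/=; ring.
rewrite -(map_hpoly (real_complex R)) horner_map/= rmorphM/=; ring.
Qed.

End BargmannKernel.

(** * Closed form of the full-poly QSTFT *)

Section ClosedForm.
Variable R : realType.
Local Notation mu := (@lebesgue_measure R).
Local Open Scope complex_scope.
Variable I : quat R.
Hypothesis hI : I ^+ 2 = -1.

Lemma qc_qintegral d (T : measurableType d) (m : {measure set T -> \bar R}) c (f : T -> quat R) :
  qc c (qintegral m setT f) = \int[m]_t qc c (f t).
Proof. by rewrite /qc; case: (nat_of_ord c) => [|[|[|]]]. Qed.

Lemma emb_mul_decomp z (q : quat R) :
  emb I z * q = \sum_c emb I ((qc c q)%:C * z) * qe R c.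
Proof.
rewrite {1}(qdecomp q) mulr_sumr; apply: eq_bigr => c _.
by rewrite embZ// -qscalerAr -scalerAl.
Qed.

Lemma qintegral_emb d (T : measurableType d) (m : {measure set T -> \bar R})
    (g : 'I_4 -> T -> R[i]) : (forall c, cintegrable m (g c)) ->
  qintegral m setT (fun t => \sum_c emb I (g c t) * qe R c) =
  \sum_c emb I (cint m (g c)) * qe R c.
Proof.
move=> ig; apply: qc_ext => e; rewrite qc_qintegral qc_emb_sum.
under eq_Rintegral do rewrite qc_emb_sum.
have igc c : m.-integrable setT (EFin \o (fun t => cRe (g c t) * qc e (qe R c) + cIm (g c t) * qc e (I * qe R c))).
  have [i1 i2] := ig c; under eq_fun do rewrite ![_ * qc _ _]mulrC.
  by apply: integrableRD; exact: integrableRZ.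
rewrite (Rintegral_sum igc).2; apply: eq_bigr => c _.
have [i1 i2] := ig c.
under eq_Rintegral do rewrite ![_ * qc _ _]mulrC.
by rewrite RintegralD ?RintegralZl//=; [rewrite ![_ * qc _ _]mulrC|exact: integrableRZ..].
Qed.

Let kap : R := 2 * pi * Num.sqrt 2.
Let kapE : kap = 2 * pi * Num.sqrt 2. Proof. by []. Qed.

Lemma bargmann_rep (phi : R -> quat R) : (forall c, sqint mu (fun t => qc c (phi t))) ->
  slice_rep I (bargmann phi) (fun c => barg kap (fun t => qc c (phi t)) 0).
Proof.
move=> sphi z; rewrite /bargmann.
have E t : qexp (- (pi *: (emb I z ^+ 2 + (t ^+ 2)%:A)) + (2 * pi * Num.sqrt 2 * t) *: emb I z) * phi t =
   \sum_c emb I (cexp (- (pi%:C * z ^+ 2)) * ((qc c (phi t) * t ^+ 0)%:C * kexp kap t z)) * qe R c.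
  have -> : - (pi *: (emb I z ^+ 2 + (t ^+ 2)%:A)) + (2 * pi * Num.sqrt 2 * t) *: emb I z =
    emb I (- (pi%:C * z ^+ 2) + (- (pi * t ^+ 2)%:C + (kap * t)%:C * z)).
    rewrite -(embX hI) -(emb_real I (t ^+ 2)) -embD -(embZ hI) -embN -(embZ hI) -embD; congr emb.
    by rewrite mulrDr opprD -addrA [(pi * _)%:C]rmorphM.
  rewrite (qexp_emb hI) emb_mul_decomp; apply: eq_bigr => c _.
  by rewrite cexpD expr0 mulr1 mulrCA.
under [X in qintegral _ _ X]eq_fun do rewrite E.
rewrite qintegral_emb; last first.
  by move=> c; apply: cintegrableZ; exact: moment_integrable.
rewrite scaler_sumr; apply: eq_bigr => c _.
rewrite scalerAl -(embZ hI) cintZ; last exact: moment_integrable.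
by rewrite /barg /msum big_ord_recl big_ord0 addr0 /= hornerC expr0 !mul1r.
Qed.

Lemma true_bargmann_rep j (phi : R -> quat R) : (forall c, sqint mu (fun t => qc c (phi t))) ->
  slice_rep I (true_bargmann j phi) (fun c z =>
    ((-1) ^+ j * Num.sqrt (1 / ((2 * pi) ^+ j * j`!%:R)) * 2 `^ (3 / 4))%:C *
    (cexp (- (pi%:C * z ^+ 2)) * cint mu (fun t =>
      ((hpoly (2 * pi) j).[2 * cRe z - Num.sqrt 2 * t] * qc c (phi t))%:C * kexp kap t z))).
Proof.
move=> sphi z; rewrite /true_bargmann.
have Hit := iter_slice_derive_rep hI (bargmann_rep sphi) (fun m c => hol_barg kapE (sphi c) m).
rewrite big_mkord.
transitivity (((-1) ^+ j * Num.sqrt (1 / ((2 * pi) ^+ j * j`!%:R))) *: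
  \sum_(k < j.+1) \sum_c emb I (((- (2 * pi))%:C * conjc z) ^+ k * barg kap (fun t => qc c (phi t)) (j - k) z *+ 'C(j, k)) * qe R c).
  congr (_ *: _); apply: eq_bigr => k _.
  rewrite (Hit (j - k)%N z) mulr_sumr; apply: eq_bigr => c _.
  rewrite (emb_conj hI) -(embZ hI) -(embX hI) -(emb_nat I) -(embM hI) mulrA -(embM hI).
  by rewrite -mulrA mulr_natl.
rewrite exchange_big scaler_sumr; apply: eq_bigr => c _.
rewrite -mulr_suml -emb_sum barg_umbral// scalerAl -(embZ hI).
by rewrite [in RHS]rmorphM/= -!mulrA.
Qed.

(** At z = (x - i w) / sqrt 2 the phases - pi x w and + pi x w cancel, the terms in w^2 cancel, and
    the remaining real exponents complete the square - pi (x - t)^2. *)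
Lemma qstft_kernel (x w t : R) :
  (expR (- ((x ^+ 2 + w ^+ 2) * pi / 2)))%:C * (cexp (0 +i* (- (pi * x * w))) *
    (cexp (- (pi%:C * (((Num.sqrt 2)^-1)%:C * (x +i* (- w))) ^+ 2)) *
     kexp kap t (((Num.sqrt 2)^-1)%:C * (x +i* (- w))))) =
  (expR (- (pi * (x - t) ^+ 2)))%:C * (cos (2 * pi * w * t) +i* (- sin (2 * pi * w * t))).
Proof.
have s2 : (Num.sqrt 2 : R) != 0 by rewrite gt_eqF// sqrtr_gt0.
have E2 : (((Num.sqrt 2)^-1)%:C * (x +i* (- w))) ^+ 2 =
    ((x ^+ 2 - w ^+ 2) / 2) +i* (- (x * w)) :> R[i].
  have i2 : (Num.sqrt 2)^-1 * (Num.sqrt 2)^-1 = 2^-1 :> R.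
    by rewrite -invfM -expr2 sqr_sqrtr.
  rewrite exprMn -rmorphXn/= expr2 i2.
  by rewrite [(_ +i* _) ^+ 2]expr2; apply: complex_eq; rewrite !cE/= ?expr2; field.
have E1 : (kap * t)%:C * (((Num.sqrt 2)^-1)%:C * (x +i* (- w))) =
   (2 * pi * t * x) +i* (- (2 * pi * w * t)) :> R[i].
  rewrite mulrA -rmorphM/= /kap.
  have -> : 2 * pi * Num.sqrt 2 * t * (Num.sqrt 2)^-1 = 2 * pi * t :> R.
    by rewrite mulrAC (mulfK s2).
  by apply: complex_eq; rewrite !cE/=; ring.
rewrite /kexp E1 E2 -!cexp_real -!cexpD -[RHS](_ : cexp ((- (pi * (x - t) ^+ 2)) +i* (- (2 * pi * w * t))) = _); last first.
  by rewrite {1}/cexp cosN sinN; apply: complex_eq; rewrite cE cexp_real/=; ring.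
congr cexp; apply: complex_eq; rewrite !cE/=; move: (pi : R) => P; by field.
Qed.

(** Squaring the product of the constants with [hnorm R j] gives 2^(3/2) (4 pi)^j j! / ((2 pi)^j j!
    sqrt 2) = 2 2^j. The factor 2^j is the square of the one from [hpoly_scale], and sqrt 2
    remains. *)
Lemma psi_const j (s : R) :
  (-1) ^+ j * Num.sqrt (1 / ((2 * pi) ^+ j * j`!%:R)) * 2 `^ (3 / 4) *
    ((hpoly (2 * pi) j).[Num.sqrt 2 * s] * expR (- (pi * s ^+ 2))) =
  Num.sqrt 2 * psi j s.
Proof.
have p0 : 0 < pi :> R := pi_gt0 R.
have f0 : 0 < j`!%:R :> R by rewrite ltr0n fact_gt0.
have H : (hpoly (4 * pi) j).[s] = Num.sqrt 2 ^+ j * (hpoly (2 * pi) j).[Num.sqrt 2 * s].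
  have -> : 4 * pi = 2 * pi * Num.sqrt 2 ^+ 2 :> R by rewrite sqr_sqrtr//; ring.
  by rewrite hpoly_scale hornerZ horner_comp hornerZ hornerX.
rewrite psiE hermite_funE H.
have C : Num.sqrt (1 / ((2 * pi) ^+ j * j`!%:R)) * 2 `^ (3 / 4) * hnorm R j = Num.sqrt 2 * Num.sqrt 2 ^+ j.
  have h0 := hnorm_gt0 R j.
  apply/eqP; rewrite -(@eqrXn2 _ 2)// ?mulr_ge0 ?exprn_ge0 ?powR_ge0 ?sqrtr_ge0 ?(ltW h0)//.
  have E1 : Num.sqrt (1 / ((2 * pi) ^+ j * j`!%:R)) ^+ 2 = ((2 * pi) ^+ j * j`!%:R)^-1 :> R.
    by rewrite sqr_sqrtr div1r// invr_ge0 mulr_ge0 ?exprn_ge0 ?mulr_ge0 ?ltW.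
  have E2 : (2 `^ (3 / 4)) ^+ 2 = 2 * Num.sqrt 2 :> R.
    rewrite -powR_mulrn ?powR_ge0// -powRrM -powR12_sqrt// -[X in _ = X * _](powRr1 (ler0n R 2)) -powRD; last by rewrite pnatr_eq0 implybT.
    by congr (_ `^ _); field.
  have E3 : hnorm R j ^+ 2 = (2 * pi) ^+ j * 2 ^+ j * j`!%:R / Num.sqrt 2.
    rewrite sqr_sqrtr -?exprMn; last by rewrite divr_ge0 ?sqrtr_ge0// mulr_ge0 ?exprn_ge0 ?mulr_ge0 ?ltW.
    by congr (_ ^+ _ * _ / _); ring.
  have E4 : (Num.sqrt 2 * Num.sqrt 2 ^+ j) ^+ 2 = 2 * 2 ^+ j :> R.
    by rewrite -exprS -exprM mulnC exprM sqr_sqrtr// exprS.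
  rewrite 2!exprMn E1 E2 E3 E4; have : (2 * pi) ^+ j != 0 :> R by rewrite expf_neq0// gt_eqF// mulr_gt0.
  have s2 : (Num.sqrt 2 : R) != 0 by rewrite gt_eqF// sqrtr_gt0.
  move: ((2 * pi) ^+ j) (2 ^+ j) (Num.sqrt 2) s2 (j`!%:R) f0 => a b s' s2 f f0 a0; apply/eqP.
  by field; rewrite s2 a0 gt_eqF.
have h0 : hnorm R j != 0 by rewrite gt_eqF// hnorm_gt0.
apply: (mulIf h0).
transitivity ((-1) ^+ j * (Num.sqrt (1 / ((2 * pi) ^+ j * j`!%:R)) * 2 `^ (3 / 4) * hnorm R j) *
   ((hpoly (2 * pi) j).[Num.sqrt 2 * s] * expR (- (pi * s ^+ 2)))).
  by move: (hnorm R j) (_ `^ _) (Num.sqrt (_ / _)) ((-1) ^+ j) (horner _ _) (expR _) => a b c d e f; ring.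
rewrite C; move: (Num.sqrt 2) (Num.sqrt 2 ^+ j) (hnorm R j) h0 ((-1) ^+ j) (horner _ _) (expR _) => h g a a0 d e f.
by field.
Qed.

Variable n : nat.
Local Notation KT := ('I_n.+1 * 'I_4)%type.
Implicit Types (phi : 'I_n.+1 -> R -> quat R) (h : KT -> R -> R).

Definition vcomps phi (k : KT) (t : R) : R := qc k.2 (phi k.1 t).

(** A coordinate of the windowed signal at position x, as a function of t: the integrand of a
    convolution. Its Fourier transform in t gives the operator at (x, w). *)
Definition conv h (x : R) (c : 'I_4) (t : R) : R :=
  \sum_(j < n.+1) psi j (x - t) * h (j, c) t.

Lemma psi_shift_sqint j x : sqint mu (fun t => @psi R j (x - t)).
Proof.
have [mp ip] := psi_sqint R j; split.
  by apply: (measurable_fun_comp_hyp mp); meas.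
have := @integrable_affine R (-1) x (fun t => psi j t ^+ 2).
rewrite oppr_eq0 oner_eq0 => /(_ isT ip); congr (_.-integrable _ _).
by apply/funext => t /=; congr EFin; congr (psi _ _ ^+ _); ring.
Qed.

Lemma conv_term_integrable h x c (j : 'I_n.+1) : fsq mu h ->
  mu.-integrable setT (EFin \o (fun t => psi j (x - t) * h (j, c) t)).
Proof. by move=> sh; apply: sqint_mul => //; exact: psi_shift_sqint. Qed.

Lemma conv_integrable h x c : fsq mu h -> mu.-integrable setT (EFin \o conv h x c).
Proof.
by move=> sh; have [] := Rintegral_sum (fun j => conv_term_integrable x c j sh).
Qed.

(** The windows are bounded, so the product stays in L^2. With [conv_integrable] both hypotheses of
    [plancherel] are available. *)
Lemma conv_sqint h x c : fsq mu h -> sqint mu (conv h x c).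
Proof.
move=> sh; apply: sqint_sum => j; have [M MP] := psi_bounded R j.
apply: (sqint_bounded (M := M)) => //; by have [] := psi_shift_sqint j x.
Qed.

(* sqrt 2 sum_j int e^(- 2 pi I w t) psi_j(x - t) phi_j(t) dt, in coordinates. *)
Definition qop h (p : R * R) : quat R := Num.sqrt 2 *: \sum_c
  emb I (cosT (conv h p.1 c) p.2 +i* (- sinT (conv h p.1 c) p.2)) * qe R c.

Lemma full_qstft_qop phi p : fsq mu (vcomps phi) -> full_qstft I phi p = qop (vcomps phi) p.
Proof.
case: p => x w sphi; rewrite /full_qstft /qop/=.
pose z : R[i] := ((Num.sqrt 2)^-1)%:C * (x +i* (- w)).
have -> : qabs (x%:A + w *: I) ^+ 2 = x ^+ 2 + w ^+ 2 by exact: (qabs_emb hI (x +i* w)).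
have -> : (Num.sqrt 2)^-1 *: qconj (x%:A + w *: I) = emb I z.
  by rewrite -[x%:A + _]/(emb I (x +i* w)) (emb_conj hI) -(embZ hI).
have -> : qexp (- (pi * x * w) *: I) = emb I (cexp (0 +i* (- (pi * x * w)))).
  by rewrite -(qexp_emb hI) emb_imag.
(* The real argument of the Hermite polynomial in [true_bargmann_rep] thereby becomes sqrt 2 (x -
   t), as in [psi_const]. *)
have zRe : 2 * cRe z = Num.sqrt 2 * x.
  rewrite /z cE/= mul0r subr0 mulrA; congr (_ * _).
  have s2 : (Num.sqrt 2 : R) != 0 by rewrite gt_eqF// sqrtr_gt0.
  by apply: (mulIf s2); rewrite mulfVK// -expr2 sqr_sqrtr.
rewrite /full_bargmann mulr_sumr.
under [X in _ *: X = _]eq_bigr => j _ do rewrite (@true_bargmann_rep j (phi j) (fun c => sphi (j, c))) mulr_sumr.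
rewrite exchange_big !scaler_sumr; apply: eq_bigr => c _.
under [X in _ *: X = _]eq_bigr => j _ do rewrite mulrA -(embM hI).
rewrite -mulr_suml -emb_sum !scalerAl -!(embZ hI); congr (emb I _ * _).
have osc (j : 'I_n.+1) : cintegrable mu (fun t => (psi j (x - t) * qc c (phi j t))%:C *
     (cos (2 * pi * w * t) +i* (- sin (2 * pi * w * t)))).
  have ip := conv_term_integrable x c j sphi.
  split; under eq_fun do rewrite cE/= mul0r ?subr0 ?addr0 ?mulrN.
    exact: integrable_mul_cos.
  have := integrableRZ (-1) (integrable_mul_sin w ip); under eq_fun do rewrite mulN1r.
  exact.
transitivity ((Num.sqrt 2)%:C * \sum_(j < n.+1) cint mu (fun t => (psi j (x - t) * qc c (phi j t))%:C *
     (cos (2 * pi * w * t) +i* (- sin (2 * pi * w * t))))).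
  rewrite !mulr_sumr; apply: eq_bigr => j _.
  pose g t : R[i] := ((hpoly (2 * pi) j).[2 * cRe z - Num.sqrt 2 * t] * qc c (phi j t))%:C * kexp kap t z.
  rewrite -/(cint mu g).
  pose A : R := (-1) ^+ j * Num.sqrt (1 / ((2 * pi) ^+ j * j`!%:R)) * 2 `^ (3 / 4).
  (* All factors independent of t. Since [K0] is nonzero, the integrand can be rewritten after
     multiplication by it, where [qstft_kernel] and [psi_const] apply. *)
  pose K0 : R[i] := (expR (- ((x ^+ 2 + w ^+ 2) * pi / 2)))%:C * (cexp (0 +i* (- (pi * x * w))) *
    (A%:C * cexp (- (pi%:C * z ^+ 2)))).
  have cexp_neq0 (y : R[i]) : cexp y != 0.
    apply/eqP => y0; have := cexpD y (- y); rewrite y0 mul0r subrr.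
    by rewrite -[0]/((0 : R)%:C) cexp_real expR0 => /eqP; rewrite oner_eq0.
  have K00 : K0 != 0.
    rewrite !mulf_neq0// -?cexp_real// /A !rmorphM/= !mulf_neq0// ?fmorph_eq0 ?signr_eq0//.
    by rewrite gt_eqF// sqrtr_gt0 div1r invr_gt0 mulr_gt0 ?exprn_gt0 ?mulr_gt0 ?pi_gt0// ltr0n fact_gt0.
  have gE : g = fun t => (K0^-1 * (Num.sqrt 2)%:C) * ((psi j (x - t) * qc c (phi j t))%:C *
     (cos (2 * pi * w * t) +i* (- sin (2 * pi * w * t)))).
    apply/funext => t; apply: (mulfI K00); rewrite [RHS]mulrA (mulVKf K00).
    have -> : (Num.sqrt 2)%:C * ((psi j (x - t) * qc c (phi j t))%:C *
         (cos (2 * pi * w * t) +i* (- sin (2 * pi * w * t)))) =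
       (A * (hpoly (2 * pi) j).[Num.sqrt 2 * (x - t)] * qc c (phi j t))%:C * ((expR (- (pi * (x - t) ^+ 2)))%:C * (cos (2 * pi * w * t) +i* (- sin (2 * pi * w * t)))).
      rewrite [LHS]mulrA [RHS]mulrA -!rmorphM/=; congr (_%:C * _).
      rewrite [LHS]mulrA -psi_const -/A; move: (A) (horner _ _) (expR _) (qc _ _) => a b d e; ring.
    rewrite -qstft_kernel -/z /g zRe -mulrBr /K0 (rmorphM _ (A * _)) (rmorphM _ A)/= (rmorphM _ (horner _ _))/=.
    move: (A%:C) (horner _ _)%:C (cexp (- _)) (cexp _) ((expR _)%:C) ((qc _ _)%:C) (kexp _ _ _) => a1 a2 a3 a4 a5 a6 a7; ring.
  transitivity (K0 * cint mu g).
    rewrite /K0 -/A; move: (A%:C) (cint _ _) (cexp (- _)) (cexp _) ((expR _)%:C) => a1 a2 a3 a4 a5; ring.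
  by rewrite gE cintZ// mulrA [_ * (K0^-1 * _)]mulrA mulfV// mul1r.
congr (_ * _); rewrite -(cint_sum osc).2; apply: complex_eq => /=; rewrite /cosT /sinT.
  apply: eq_Rintegral => t _; rewrite (raddf_sum (@complex.Re R : R[i] -> R)) /conv /vcomps mulr_suml.
  by apply: eq_bigr => j _; rewrite /= ?cE/=; ring.
rewrite -mulN1r -RintegralZl//; last by apply: integrable_mul_sin; exact: conv_integrable.
apply: eq_Rintegral => t _; rewrite (raddf_sum (@complex.Im R)) /conv /vcomps mulr_suml mulr_sumr.
by apply: eq_bigr => j _; rewrite /= ?cE/=; ring.
Qed.

End ClosedForm.

(** * Isometry property *)

Section SliceOperator.
Variable R : realType.
Local Notation mu := (@lebesgue_measure R).
Local Open Scope complex_scope.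
Variable I : quat R.
Hypothesis hI : I ^+ 2 = -1.
Variable n : nat.
Local Notation KT := ('I_n.+1 * 'I_4)%type.
Implicit Types h : KT -> R -> R.

Definition qn2 (q : quat R) : R := \sum_c qc c q ^+ 2.

Lemma qn2E q : qn2 q = qre q ^+ 2 + qi q ^+ 2 + qj q ^+ 2 + qk q ^+ 2.
Proof. by rewrite /qn2 sum_ord4 qc0 qc1 qc2 qc3. Qed.

Lemma qn2_ge0 q : 0 <= qn2 q.
Proof. by apply: sumr_ge0 => c _; exact: sqr_ge0. Qed.

Lemma qn2M p q : qn2 (p * q) = qn2 p * qn2 q.
Proof. by rewrite !qn2E !qcE; ring. Qed.

Lemma qn2Z a q : qn2 (a *: q) = a ^+ 2 * qn2 q.
Proof. by rewrite !qn2E !qcE; ring. Qed.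

Lemma qn2_parallelogram p q : qn2 (p - q) + qn2 (p + q) = 2 * (qn2 p + qn2 q).
Proof. by rewrite !qn2E !qcE; ring. Qed.

Lemma qn2_sum (a : 'I_4 -> R) : qn2 (\sum_c a c *: qe R c) = \sum_c a c ^+ 2.
Proof.
rewrite !sum_ord4 qe0 qe1 qe2 qe3 qn2E !qcE/=; ring.
Qed.

(** The transform in real coordinates; it is the operator to which the abstract results on adjoints
    are applied. *)
Definition rop h (l : 'I_4) (p : R * R) : R := qc l (qop I h p).

Lemma qopE h p : qop I h p = Num.sqrt 2 *:
  (\sum_c cosT (conv h p.1 c) p.2 *: qe R c - I * \sum_c sinT (conv h p.1 c) p.2 *: qe R c).
Proof.
rewrite /qop mulr_sumr -sumrB; congr (_ *: _); apply: eq_bigr => c _.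
by rewrite /emb/= scaleNr mulrBl -!scalerAl mul1r qscalerAr.
Qed.

Lemma cosT_opp F (w : R) : cosT F (- w) = cosT F w.
Proof. by apply: eq_Rintegral => t _; rewrite mulrN mulNr cosN. Qed.

Lemma sinT_opp F (w : R) : mu.-integrable setT (EFin \o F) -> sinT F (- w) = - sinT F w.
Proof.
move=> iF; rewrite /sinT -[RHS]mulN1r -RintegralZl//; last exact: integrable_mul_sin.
by apply: eq_Rintegral => t _; rewrite mulrN mulNr sinN mulrN mulN1r.
Qed.

(* With C even and S odd in w, this is |C - I S|^2 + |C + I S|^2 = 2 (|C|^2 + |S|^2). *)
Lemma qn2_qop_sym h x w : fsq mu h -> qn2 (qop I h (x, w)) + qn2 (qop I h (x, - w)) =
  4 * \sum_c power (conv h x c) w.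
Proof.
move=> sh; rewrite !qopE/= !qn2Z sqr_sqrtr// -mulrDr.
set C := \sum_c cosT _ w *: _; set S := \sum_c sinT _ w *: _.
have -> : \sum_c cosT (conv h x c) (- w) *: qe R c = C.
  by apply: eq_bigr => c _; rewrite cosT_opp.
have -> : \sum_c sinT (conv h x c) (- w) *: qe R c = - S.
  by rewrite -sumrN; apply: eq_bigr => c _; rewrite sinT_opp ?scaleNr//; exact: conv_integrable.
rewrite mulrN opprK qn2_parallelogram qn2M.
have -> : qn2 I = 1 by rewrite qn2E (qre_I hI) expr0n/= add0r norm_I.
rewrite mul1r !qn2_sum -big_split/= mulrA -natrM.
by congr (_ * _).
Qed.

Lemma measurable_psi j : measurable_fun setT (@psi R j).
Proof. by have [] := psi_sqint R j. Qed.

Lemma measurable_sum_ord d (T : measurableType d) m (f : 'I_m -> T -> R) :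
  (forall i, measurable_fun setT (f i)) -> measurable_fun setT (fun x => \sum_i f i x).
Proof.
elim: m f => [|m IH] f mf.
  by under eq_fun do rewrite big_ord0; exact: measurable_cst.
under eq_fun do rewrite big_ord_recl.
apply: measurable_funD => //; exact: (IH (fun i => f (lift ord0 i))).
Qed.

Section Measurability.
Variable h : KT -> R -> R.
Hypothesis mh : forall k, measurable_fun setT (h k).

Lemma measurable_conv c d (T : measurableType d) (f g : T -> measurableTypeR R) :
  measurable_fun setT f -> measurable_fun setT g ->
  measurable_fun setT (fun p => conv h (f p) c (g p)).
Proof.
move=> mf mg; apply: measurable_sum_ord => j; have mp := measurable_psi j; have mhj := mh (j, c).
by meas.
Qed.

Lemma measurable_rop l : measurable_fun setT
  (rop h l : measurableTypeR R * measurableTypeR R -> R).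
Proof.
pose T3 := ((measurableTypeR R * measurableTypeR R) * measurableTypeR R)%type.
have m0 : measurable_fun setT (fun p : T3 => p.1.1) := measurableT_comp measurable_fst measurable_fst.
have m1 : measurable_fun setT (fun p : T3 => p.1.2) := measurableT_comp measurable_snd measurable_fst.
have mc c : measurable_fun setT (fun p : T3 => conv h p.1.1 c p.2).
  by apply: measurable_conv => //; exact: measurable_snd.
have mC c : measurable_fun setT (fun p : measurableTypeR R * measurableTypeR R => cosT (conv h p.1 c) p.2).
  apply: (@measurable_Rintegral_param _ _ _ _ _ mu (fun p : T3 => conv h p.1.1 c p.2 * cos (2 * pi * p.1.2 * p.2))).
  by have m := mc c; meas.
have mS c : measurable_fun setT (fun p : measurableTypeR R * measurableTypeR R => sinT (conv h p.1 c) p.2).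
  apply: (@measurable_Rintegral_param _ _ _ _ _ mu (fun p : T3 => conv h p.1.1 c p.2 * sin (2 * pi * p.1.2 * p.2))).
  by have m := mc c; meas.
rewrite /rop /qop; under eq_fun do rewrite qcZ qc_emb_sum.
apply: measurable_funM => //; apply: measurable_sum_ord => c /=.
by have m2 := mC c; have m3 := mS c; meas.
Qed.

End Measurability.

Lemma Rintegral_EFin d (T : measurableType d) (m : {measure set T -> \bar R}) (f : T -> R) :
  m.-integrable setT (EFin \o f) -> (\int[m]_x (f x)%:E)%E = (\int[m]_x f x)%:E.
Proof. by move=> iff; rewrite /Rintegral fineK//; exact: (integrable_fin_num measurableT). Qed.

(** The mixed terms of |C - I S|^2 need not vanish at a given w. They cancel after the reflection w
    -> - w, under which the integral is invariant; what is left is a sum of squared moduli of real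
    Fourier transforms. *)
Lemma integral_qn2_qop h x : fsq mu h ->
  (\int[mu]_w (qn2 (qop I h (x, w)))%:E)%E = (2 * \sum_c nrm2 mu (conv h x c))%:E.
Proof.
move=> sh; have mh k : measurable_fun setT (h k) by have [] := sh k.
have mq : measurable_fun setT (fun w : measurableTypeR R => qn2 (qop I h (x, w))).
  apply: measurable_sum_ord => l.
  by apply: measurable_funX; exact: (measurableT_comp (measurable_rop mh l) (pair1_measurable x)).
set A := (\int[mu]_w _)%E.
have A0 : (0 <= A)%E by apply: integral_ge0 => w _; rewrite lee_fin qn2_ge0.
have E : (A + A = (4 * \sum_c nrm2 mu (conv h x c))%:E)%E.
  have B : (\int[mu]_w (qn2 (qop I h (x, - w)))%:E = A)%E.
    have H : (-1 : R) != 0 by rewrite oppr_eq0 oner_eq0.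
    have mq' : measurable_fun setT (fun w : measurableTypeR R => (qn2 (qop I h (x, w)))%:E) by exact/measurable_EFinP.
    have := ge0_integral_affine 0 H mq' (fun w => qn2_ge0 _ : (0 <= (qn2 (qop I h (x, w)))%:E)%E).
    rewrite normrN normr1 invr1 mul1e -/A => <-.
    by apply: eq_integral => w _; rewrite mulN1r addr0.
  transitivity (A + \int[mu]_w (qn2 (qop I h (x, - w)))%:E)%E; first by rewrite B.
  have q0 (w : measurableTypeR R) : setT w -> (0 <= (qn2 (qop I h (x, w)))%:E)%E by rewrite lee_fin qn2_ge0.
  have q0' (w : measurableTypeR R) : setT w -> (0 <= (qn2 (qop I h (x, - w)))%:E)%E by rewrite lee_fin qn2_ge0.
  have mq1 : measurable_fun setT (fun w : measurableTypeR R => (qn2 (qop I h (x, w)))%:E) by exact/measurable_EFinP.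
  have mq2 : measurable_fun setT (fun w : measurableTypeR R => (qn2 (qop I h (x, - w)))%:E).
    apply/measurable_EFinP.
    have mN : measurable_fun setT (fun w : measurableTypeR R => - w : measurableTypeR R) by meas.
    exact: (measurableT_comp mq mN).
  rewrite -(ge0_integralD mu measurableT q0 mq1 q0' mq2).
  transitivity (\int[mu]_w (4 * \sum_c power (conv h x c) w)%:E)%E.
    by apply: eq_integral => w _; exact: (congr1 EFin (qn2_qop_sym x w sh)).
  have mP c : measurable_fun setT (power (conv h x c)).
    by apply: measurable_power; have [] := conv_sqint x c sh.
  under eq_integral do rewrite EFinM.
  have mPs : measurable_fun setT (fun w : measurableTypeR R => (\sum_c power (conv h x c) w)%:E).
    by apply/measurable_EFinP; exact: measurable_sum_ord.
  have Ps0 (w : measurableTypeR R) : setT w -> (0 <= (\sum_c power (conv h x c) w)%:E)%E.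
    move=> _; rewrite lee_fin; apply: sumr_ge0 => c _; exact: power_ge0.
  rewrite (ge0_integralZl_EFin mu measurableT Ps0 mPs (ler0n R 4)).
  rewrite (_ : (\int[mu]_w (\sum_c power (conv h x c) w)%:E)%E = (\sum_c nrm2 mu (conv h x c))%:E); first by rewrite -EFinM.
  transitivity (\int[mu]_w (\sum_c (power (conv h x c) w)%:E))%E.
    by apply: eq_integral => w _; rewrite sumEFin.
  have mPE c : measurable_fun setT (fun w : measurableTypeR R => (power (conv h x c) w)%:E).
    by apply/measurable_EFinP; exact: (mP c).
  have P0 c (w : measurableTypeR R) : setT w -> (0 <= (power (conv h x c) w)%:E)%E.
    by move=> _; rewrite lee_fin; exact: power_ge0.
  rewrite (@ge0_integral_sum _ _ _ mu _ measurableT _ _ mPE P0) -sumEFin; apply: eq_bigr => c _.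
  by apply: plancherel; [exact: conv_integrable|exact: conv_sqint].
(* Finiteness is needed to halve the equation A + A = 4 (...) in the extended reals. *)
have fA : A \is a fin_num.
  rewrite ge0_fin_numE//; apply: (@le_lt_trans _ _ (A + A)%E); first by rewrite leeDl.
  by rewrite E ltry.
move: E; rewrite -(fineK fA) -EFinD => -[] E; congr EFin; lra.
Qed.

Lemma psi_orthonormal_shift j k (t : R) :
  mu.-integrable setT (EFin \o (fun x => psi k (x - t) * psi j (x - t))) /\
  \int[mu]_x (psi k (x - t) * psi j (x - t)) = (k == j)%:R.
Proof.
have ip := sqint_mul (psi_sqint R k) (psi_sqint R j).
have c1 : (1 : R) != 0 by rewrite oner_eq0.
split.
  have := integrable_affine (- t) c1 ip; congr (_.-integrable _ _).
  by apply/funext => x /=; rewrite mul1r.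
have := Rintegral_affine (- t) c1 (integrable_measurable ip).
rewrite psi_orthonormal normr1 invr1 mul1r => <-.
by apply: eq_Rintegral => x _; rewrite mul1r.
Qed.

(** For fixed t, [conv h x c t] is a linear combination of the functions psi_j(x - t) of x, which
    are orthonormal. *)
Lemma integral_conv_sqr h c t : (\int[mu]_x (conv h x c t ^+ 2)%:E)%E = (\sum_(j < n.+1) h (j, c) t ^+ 2)%:E.
Proof.
pose g (j k : 'I_n.+1) x := (h (j, c) t * h (k, c) t) * (psi j (x - t) * psi k (x - t)).
have ig j k : mu.-integrable setT (EFin \o g j k).
  by apply: integrableRZ; have [] := psi_orthonormal_shift k j t.
have gE : (fun x => conv h x c t ^+ 2) = fun x => \sum_j \sum_k g j k x.
  apply/funext => x; rewrite expr2 /conv big_distrlr/=; apply: eq_bigr => j _; apply: eq_bigr => k _.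
  by rewrite /g; ring.
have igs j := Rintegral_sum (ig j).
have igss := Rintegral_sum (fun j => (igs j).1).
rewrite -(_ : (\int[mu]_x (\sum_j \sum_k g j k x)%:E)%E = (\int[mu]_x (conv h x c t ^+ 2)%:E)%E); last first.
  by apply: eq_integral => x _; rewrite -[_ ^+ 2]/((fun x => conv h x c t ^+ 2) x) gE.
rewrite Rintegral_EFin ?igss.1// igss.2; congr EFin; apply: eq_bigr => j _.
rewrite (igs j).2 (bigD1 j)//= big1 => [|k kj].
  rewrite addr0 RintegralZl// ?(psi_orthonormal_shift _ _ _).2 ?(psi_orthonormal_shift _ _ _).1//.
  by rewrite eqxx mulr1 expr2.
rewrite RintegralZl// ?(psi_orthonormal_shift _ _ _).2 ?(psi_orthonormal_shift _ _ _).1//.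
by rewrite eq_sym (inj_eq val_inj) (negPf kj) mulr0.
Qed.

Lemma integral_qn2_rop h : fsq mu h ->
  (\int[(@leb2 R)]_p (qn2 (qop I h p))%:E)%E = (2 * fn2 mu h)%:E.
Proof.
move=> sh; have mh k : measurable_fun setT (h k) by have [] := sh k.
have mq : measurable_fun setT (fun p : measurableTypeR R * measurableTypeR R => qn2 (qop I h p)).
  by apply: measurable_sum_ord => l; apply: measurable_funX; exact: measurable_rop.
rewrite /leb2 fubini_tonelli1//; last 2 first.
- exact/measurable_EFinP.
- by move=> p; rewrite lee_fin qn2_ge0.
rewrite /fubini_F; under eq_integral do rewrite integral_qn2_qop//.
have mc : measurable_fun setT (fun p : measurableTypeR R * measurableTypeR R => \sum_c conv h p.1 c p.2 ^+ 2).
  by apply: measurable_sum_ord => c; apply: measurable_funX; apply: measurable_conv; meas.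
have mcE : measurable_fun setT (fun p : measurableTypeR R * measurableTypeR R => (\sum_c conv h p.1 c p.2 ^+ 2)%:E).
  exact/measurable_EFinP.
have c0 (p : measurableTypeR R * measurableTypeR R) : (0 <= (\sum_c conv h p.1 c p.2 ^+ 2)%:E)%E.
  by rewrite lee_fin sumr_ge0// => c _; exact: sqr_ge0.
have E x : ((2 * \sum_c nrm2 mu (conv h x c))%:E = 2%:E * \int[mu]_t (\sum_c conv h x c t ^+ 2)%:E)%E.
  rewrite EFinM; congr (_ * _)%E; rewrite -sumEFin.
  transitivity (\sum_c \int[mu]_t (conv h x c t ^+ 2)%:E)%E.
    by apply: eq_bigr => c _; rewrite nrm2E//; exact: conv_sqint.
  rewrite -ge0_integral_sum//.
  - by apply: eq_integral => t _; rewrite sumEFin.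
  - move=> c; apply/measurable_EFinP; apply: measurable_funX; apply: measurable_conv => //.
  - by move=> c t _; rewrite lee_fin sqr_ge0.
under eq_integral do rewrite E.
rewrite ge0_integralZl//; last 2 first.
- have H := @measurable_fun_fubini_tonelli_F _ _ _ _ R mu _ mcE c0; exact: H.
- by move=> x _; apply: integral_ge0 => t _; exact: (c0 (x, t)).
have -> := @fubini_tonelli _ _ _ _ R mu mu _ mcE c0.
rewrite EFinM; congr (_ * _)%E => /=.
have mhs (t : measurableTypeR R) c j : measurable_fun setT (fun x : measurableTypeR R => (conv h x c t ^+ 2)%:E).
  by apply/measurable_EFinP; apply: measurable_funX; apply: measurable_conv; meas.
have F t : (\int[mu]_x (\sum_c conv h x c t ^+ 2)%:E = (\sum_k h k t ^+ 2)%:E)%E.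
  transitivity (\sum_c \int[mu]_x (conv h x c t ^+ 2)%:E)%E.
    rewrite -ge0_integral_sum//; first by apply: eq_integral => x _; rewrite sumEFin.
    - by move=> c; apply/measurable_EFinP; apply: measurable_funX; apply: measurable_conv; meas.
    - by move=> c x _; rewrite lee_fin sqr_ge0.
  under eq_bigr => c _ do rewrite integral_conv_sqr.
  rewrite sumEFin exchange_big/= pair_big/=; congr EFin.
  by apply: eq_bigr => -[].
under eq_integral do rewrite F.
under eq_integral do rewrite -sumEFin.
rewrite ge0_integral_sum//; last 2 first.
- by move=> k; apply/measurable_EFinP; have mk := mh k; meas.
- by move=> k t _; rewrite lee_fin sqr_ge0.
by rewrite -sumEFin; apply: eq_bigr => k _; rewrite nrm2E.
Qed.

Lemma rop_fsq_fn2 h : fsq mu h ->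
  fsq (@leb2 R) (rop h) /\ fn2 (@leb2 R) (rop h) = 2 * fn2 mu h.
Proof.
move=> sh; have mh k : measurable_fun setT (h k) by have [] := sh k.
have mr := measurable_rop mh.
have H := integral_qn2_rop sh.
have sr : fsq (@leb2 R) (rop h).
  move=> l; suff lt : ((\int[(@leb2 R)]_p (rop h l p ^+ 2)%:E)%E < +oo)%E by exact: (@sqintP _ _ _ (@leb2 R) (rop h l) (mr l) lt).
  apply: (@le_lt_trans _ _ (2 * fn2 mu h)%:E); last exact: ltry.
  rewrite -H; apply: ge0_le_integral => //.
  - by move=> p _; rewrite lee_fin sqr_ge0.
  - by apply/measurable_EFinP; apply: measurable_funX; exact: mr.
  - apply/measurable_EFinP; apply: measurable_sum_ord => c; apply: measurable_funX; exact: mr.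
  - move=> p _; rewrite lee_fin /qn2 (bigD1 l)//= lerDl.
    by apply: sumr_ge0 => c _; exact: sqr_ge0.
split=> //; apply: EFin_inj; rewrite -H -sumEFin.
under eq_bigr => l _ do rewrite -(nrm2E (sr l)).
rewrite -ge0_integral_sum//; last 2 first.
- by move=> k; apply/measurable_EFinP; apply: measurable_funX; exact: mr.
- by move=> k t _; rewrite lee_fin sqr_ge0.
by apply: eq_integral => p _; rewrite sumEFin.
Qed.

Lemma cosT_sum m (a : 'I_m -> R) (F : 'I_m -> R -> R) w :
  (forall i, mu.-integrable setT (EFin \o F i)) ->
  cosT (fun t => \sum_i a i * F i t) w = \sum_i a i * cosT (F i) w.
Proof.
move=> iF; have iZ i := integrableRZ (a i) (integrable_mul_cos w (iF i)).
rewrite -[LHS](_ : \int[mu]_t (\sum_i a i * (F i t * cos (2 * pi * w * t))) = _).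
  rewrite (Rintegral_sum iZ).2; apply: eq_bigr => i _.
  by rewrite RintegralZl//; exact: integrable_mul_cos.
by apply: eq_Rintegral => t _; rewrite mulr_suml; apply: eq_bigr => i _; rewrite mulrA.
Qed.

Lemma sinT_sum m (a : 'I_m -> R) (F : 'I_m -> R -> R) w :
  (forall i, mu.-integrable setT (EFin \o F i)) ->
  sinT (fun t => \sum_i a i * F i t) w = \sum_i a i * sinT (F i) w.
Proof.
move=> iF; have iZ i := integrableRZ (a i) (integrable_mul_sin w (iF i)).
rewrite -[LHS](_ : \int[mu]_t (\sum_i a i * (F i t * sin (2 * pi * w * t))) = _).
  rewrite (Rintegral_sum iZ).2; apply: eq_bigr => i _.
  by rewrite RintegralZl//; exact: integrable_mul_sin.
by apply: eq_Rintegral => t _; rewrite mulr_suml; apply: eq_bigr => i _; rewrite mulrA.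
Qed.

Lemma rop_add f g : fsq mu f -> fsq mu g ->
  rop (fun k t => f k t + g k t) = fun l p => rop f l p + rop g l p.
Proof.
move=> sf sg; apply/funext => l; apply/funext => p.
rewrite /rop -qcD !qopE -scalerDr; congr (qc l (_ *: _)).
(* A sum over two indices, so that [cosT_sum] and [sinT_sum] give additivity. *)
have cE' c : conv (fun k t => f k t + g k t) p.1 c = fun t => \sum_(i < 2) 1 * (if i == ord0 then conv f p.1 c t else conv g p.1 c t).
  apply/funext => t; rewrite !big_ord_recl big_ord0/= !mul1r addr0 /conv -big_split/=.
  by apply: eq_bigr => j _; rewrite mulrDr.
have iF c (i : 'I_2) : mu.-integrable setT (EFin \o (fun t => if i == ord0 then conv f p.1 c t else conv g p.1 c t)).
  by case: (i == ord0); exact: conv_integrable.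
rewrite addrACA -opprD -mulrDr -!big_split/=; congr (_ - _ * _); apply: eq_bigr => c _;
  by rewrite cE' ?(cosT_sum _ _ (iF c)) ?(sinT_sum _ _ (iF c)) !big_ord_recl big_ord0/= !mul1r addr0 scalerDl.
Qed.

End SliceOperator.

(** * Adjoint on L^1 and L^2 *)

Section Swap.
Context d1 d2 (T1 : measurableType d1) (T2 : measurableType d2) (R : realType).
Variable m1 : {sigma_finite_measure set T1 -> \bar R}.
Variable m2 : {sigma_finite_measure set T2 -> \bar R}.

Lemma Rfubini_dominated (f : T1 * T2 -> R) (C : T1 -> R) : measurable_fun setT f ->
  m1.-integrable setT (EFin \o C) ->
  (forall x, (\int[m2]_y `|f (x, y)|%:E <= (C x)%:E)%E) ->
  (forall y, m1.-integrable setT (EFin \o (fun x => f (x, y)))) ->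
  [/\ m1.-integrable setT (EFin \o (fun x => \int[m2]_y f (x, y))),
    m2.-integrable setT (EFin \o (fun y => \int[m1]_x f (x, y))) &
    \int[m1]_x \int[m2]_y f (x, y) = \int[m2]_y \int[m1]_x f (x, y)].
Proof.
move=> mf iC fC i1; have iff := integrable_prod_le mf iC fC.
have mf' := measurable_int _ iff.
have i2 x : m2.-integrable setT (EFin \o (fun y => f (x, y))).
  apply/integrableP; split; first exact: (measurableT_comp mf' (pair1_measurable x)).
  exact: (le_lt_trans (fC x) (ltry _)).
split; last exact: Rfubini.
  have := integrable_fubini_F iff; congr (_.-integrable _ _).
  by apply/funext => x /=; rewrite -Rintegral_EFin.
have E : (fun y => (\int[m1]_x f (x, y))%:E) = fun y => (\int[m1]_x (f (x, y))%:E)%E.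
  by apply/funext => y; rewrite -Rintegral_EFin.
have mG : measurable_fun setT (fun y => (\int[m1]_x f (x, y))%:E).
  by rewrite E; exact: (measurable_fubini_G iff).
apply/integrableP; split; first exact: mG.
apply: le_lt_trans ((integrable21ltyP _ _ mf').1 iff).
apply: ge0_le_integral => //.
- by apply: measurableT_comp => //; exact: mG.
- have mabs : measurable_fun setT (fun z => `|f z|%:E) by apply/measurable_EFinP; meas.
  have abs0 z : (0 <= (`|f z|)%:E)%E by rewrite lee_fin.
  exact: (@measurable_fun_fubini_tonelli_G _ _ _ _ R m1 _ mabs abs0).
- move=> y _; have -> : (EFin \o (fun y => \int[m1]_x f (x, y))) y = (\int[m1]_x (f (x, y))%:E)%E.
    by rewrite Rintegral_EFin.
  apply: le_abse_integral => //.
  exact: (measurableT_comp mf' (pair2_measurable y)).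
Qed.

End Swap.

(** * Lebesgue measure of the plane and its exhaustion by squares *)

Section PlaneMeasure.
Variable R : realType.
Local Notation mu := (@lebesgue_measure R).

Definition square (N : nat) : set (measurableTypeR R * measurableTypeR R) :=
  `[- N%:R, N%:R]%classic `*` `[- N%:R, N%:R]%classic.

Lemma square_exhaustion : exhaustion square.
Proof.
split.
- by move=> N; apply: measurableX; exact: measurable_itv.
- move=> N; pose J : set (measurableTypeR R) := `[- N%:R, N%:R]%classic.
  have mJ : measurable J by exact: measurable_itv.
  have -> : (leb2 R (square N) = mu J * mu J)%E by exact: product_measure1E.
  by rewrite lebesgue_measure_itv/= lte_fin; case: ifP => _; rewrite -?EFinD -?EFinM ?mul0e ltry.
- move=> m n mn; apply/subsetPset => -[x y] [] /=; rewrite !in_itv/= => /andP[x1 x2] /andP[y1 y2].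
  have mn' : m%:R <= n%:R :> R by rewrite ler_nat.
  by split; rewrite /= in_itv/=; apply/andP; split; lra.
- apply/seteqP; split=> // -[x y] _.
  have B (u : R) N : (Num.bound `|u| <= N)%N -> `[- N%:R, N%:R]%classic u.
    move=> uN; have := archi_boundP (normr_ge0 u); have : (Num.bound `|u|)%:R <= N%:R :> R by rewrite ler_nat.
    move=> H1 H2; have := ltW (lt_le_trans H2 H1); rewrite ler_norml => uP.
    by rewrite /= in_itv.
  by exists (maxn (Num.bound `|x|) (Num.bound `|y|)) => //; split; apply: B; [exact: leq_maxl|exact: leq_maxr].
Qed.

(* A copy of leb2, for which HB does not infer a sigma-finite structure. *)
Definition plane_measure : set (measurableTypeR R * measurableTypeR R) -> \bar R := @leb2 R.

HB.instance Definition _ := Measure.on plane_measure.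

Lemma plane_measure_sigma_finite : sigma_finite setT plane_measure.
Proof.
have [mE fE _ UE] := square_exhaustion.
by exists square => //.
Qed.

HB.instance Definition _ := Measure_isSigmaFinite.Build _ _ _ plane_measure plane_measure_sigma_finite.

End PlaneMeasure.

(** * The kernel of the adjoint formula in real coordinates *)

Section FubiniAdjoint.
Variable R : realType.
Local Notation mu := (@lebesgue_measure R).
Local Notation R2 := (measurableTypeR R * measurableTypeR R)%type.
Local Open Scope complex_scope.
Variable I : quat R.
Hypothesis hI : I ^+ 2 = -1.

Lemma qc_emb_mul c z q : qc c (emb I z * q) = cRe z * qc c q + cIm z * qc c (I * q).
Proof. by rewrite /emb mulrDl -!scalerAl mul1r qcD !qcZ. Qed.

Lemma psi_integrable j : mu.-integrable setT (EFin \o @psi R j).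
Proof.
have := integrableRZ ((hnorm R j)^-1 * (-1) ^+ j) (integrable_poly_gauss (hpoly (4 * pi) j) (pi_gt0 R)).
congr (_.-integrable _ _); apply/funext => t /=; congr EFin.
by rewrite psiE hermite_funE -mulrA mulrC.
Qed.

(** A unit quaternion preserves the Euclidean norm, which lies between the modulus of a coordinate
    and the sum of all moduli. *)
Lemma qc_unit_mul_le u q c : qn2 u = 1 -> `|qc c (u * q)| <= \sum_(d < 4) `|qc d q| :> R.
Proof.
move=> u1; rewrite -(@ler_pXn2r _ 2) ?nnegrE ?sumr_ge0//.
rewrite real_normK ?num_real//; apply: (@le_trans _ _ (qn2 (u * q))).
  by rewrite /qn2 (bigD1 c)//= lerDl sumr_ge0// => d _; exact: sqr_ge0.
rewrite qn2M u1 mul1r expr2 big_distrlr/=; apply: ler_sum => d _.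
rewrite (bigD1 d)//= -normrM -expr2 ger0_norm ?sqr_ge0// lerDl; exact: sumr_ge0.
Qed.

Definition rker (j : nat) (L : R * R -> quat R) (c : 'I_4) (y : R) (p : R * R) : R :=
  psi j (p.1 - y) * (cos (2 * pi * p.2 * y) * qc c (L p) + sin (2 * pi * p.2 * y) * qc c (I * L p)).

Lemma adjoint_kernelE j L c y p : qc c (adjoint_kernel I j L y p) = rker j L c y p.
Proof.
by rewrite /adjoint_kernel qcZ -(emb_imag I) (qexp_emb hI) qc_emb_mul /cexp/= expR0 !mul1r.
Qed.

(** The first bound keeps the window, which is then integrated in y; the second is uniform in y and
    gives integrability over the plane. *)
Lemma rker_bound j : exists2 M, 0 <= M & forall L c y p,
  `|rker j L c y p| <= `|psi j (p.1 - y)| * \sum_d `|qc d (L p)| /\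
  `|psi j (p.1 - y)| * \sum_d `|qc d (L p)| <= M * \sum_d `|qc d (L p)|.
Proof.
have [M MP] := psi_bounded R j; exists M => [|L c y p]; first exact: (le_trans (normr_ge0 _) (MP 0)).
split; last by apply: ler_wpM2r; [exact: sumr_ge0|exact: MP].
rewrite /rker normrM; apply: ler_wpM2l => //.
have := @qc_unit_mul_le (emb I (cexp (0 +i* (2 * pi * p.2 * y)))) (L p) c.
rewrite qc_emb_mul /cexp/= expR0 !mul1r; apply.
have := qabs_emb hI (cos (2 * pi * p.2 * y) +i* sin (2 * pi * p.2 * y)).
rewrite /= cos2Dsin2 /qabs sqr_sqrtr => [|]; last by rewrite !addr_ge0 ?sqr_ge0.
by rewrite qn2E.
Qed.

Section Kernel.
Variable L : R2 -> quat R.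
Hypothesis mL : forall c, measurable_fun setT (fun p => qc c (L p)).

Let mIL c : measurable_fun setT (fun p => qc c (I * L p)).
Proof.
under eq_fun do rewrite qc_mul; apply: measurable_sum_ord => d.
by have m := mL d; meas.
Qed.

Lemma measurable_rker j c d (T : measurableType d) (f : T -> measurableTypeR R) (g : T -> R2) :
  measurable_fun setT f -> measurable_fun setT g ->
  measurable_fun setT (fun z => rker j L c (f z) (g z)).
Proof.
move=> mf mg; have mp := @measurable_psi R j.
have m1 : measurable_fun setT (fun z => (g z).1) := measurableT_comp measurable_fst mg.
have m2 : measurable_fun setT (fun z => (g z).2) := measurableT_comp measurable_snd mg.
have m3 : measurable_fun setT (fun z => qc c (L (g z))) := measurableT_comp (mL c) mg.
have m4 : measurable_fun setT (fun z => qc c (I * L (g z))) := measurableT_comp (mIL c) mg.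
by rewrite /rker; meas.
Qed.

Hypothesis iL : forall c, (@leb2 R).-integrable setT (EFin \o (fun p => qc c (L p))).

Let N p := \sum_d `|qc d (L p)|.

Let iN : (@leb2 R).-integrable setT (EFin \o N).
Proof.
by have [] := Rintegral_sum (fun d => integrable_norm (iL d)).
Qed.

Lemma rker_integrable j c y : (@leb2 R).-integrable setT (EFin \o rker j L c y).
Proof.
have [M M0 MP] := rker_bound j.
apply: (@integrableR_le _ _ _ (@leb2 R) _ (fun p => M * N p)).
- by apply: measurable_rker => //; exact: measurable_id.
- by move=> p; have [a b] := MP L c y p; exact: (le_trans a b).
- exact: integrableRZ.
Qed.

(** Used twice: g = 1 shows that the plane integral is integrable in y, and g a component of h
    proves the adjoint relation. *)
Lemma rker_swap j c (g : R -> R) C : measurable_fun setT g ->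
  (forall x, (\int[mu]_y (`|psi j (x - y) * g y|)%:E <= C%:E)%E) ->
  [/\ (@leb2 R).-integrable setT (EFin \o (fun p => \int[mu]_y (rker j L c y p * g y))),
    mu.-integrable setT (EFin \o (fun y => \int[@leb2 R]_p (rker j L c y p * g y))) &
    \int[@leb2 R]_p \int[mu]_y (rker j L c y p * g y) =
    \int[mu]_y \int[@leb2 R]_p (rker j L c y p * g y)].
Proof.
move=> mg gC; have [M M0 MP] := rker_bound j.
have mr : measurable_fun setT (fun z : R2 * measurableTypeR R => rker j L c z.2 z.1).
  by apply: measurable_rker; [exact: measurable_snd|exact: measurable_fst].
have mF : measurable_fun setT (fun z : R2 * measurableTypeR R => rker j L c z.2 z.1 * g z.2) by meas.
have iC := integrableRZ C iN.
have FC p : (\int[mu]_y `|rker j L c y p * g y|%:E <= (C * N p)%:E)%E.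
  have [m0 m1] : measurable_fun setT (fun y : measurableTypeR R => rker j L c y p) /\
      measurable_fun setT (fun y : measurableTypeR R => psi j (p.1 - y)).
    have mp := @measurable_psi R j; split; last by meas.
    by apply: measurable_rker; [exact: measurable_id|exact: measurable_cst].
  apply: (@le_trans _ _ (\int[mu]_y ((N p)%:E * (`|psi j (p.1 - y) * g y|)%:E))%E).
    apply: ge0_le_integral => //.
    - by apply/measurable_EFinP; meas.
    - by apply/measurable_EFinP; apply: measurable_funM => //; meas.
    - move=> y _; rewrite lee_fin; have [+ _] := MP L c y p; rewrite -/(N p).
      move: (rker _ _ _ _ _) (psi _ _) (g y) (N p) => a b e K aK.
      by rewrite !normrM mulrA ler_wpM2r// mulrC.
  have N0 : 0 <= N p by exact: sumr_ge0.
  rewrite ge0_integralZl_EFin//; last by apply/measurable_EFinP; meas.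
  by rewrite mulrC EFinM; apply: lee_wpmul2l => //; rewrite lee_fin.
have i1 y : (@leb2 R).-integrable setT (EFin \o (fun p => rker j L c y p * g y)).
  by under eq_fun do rewrite mulrC; apply: integrableRZ; exact: rker_integrable.
have H := @Rfubini_dominated _ _ _ _ R (@plane_measure R) mu _ _ mF iC FC i1.
exact: H.
Qed.

Lemma integral_psi_shift j : exists C, forall x,
  (\int[mu]_y (`|psi j (x - y)|)%:E <= C%:E)%E.
Proof.
exists (\int[mu]_y `|psi j y|) => x.
have H : (-1 : R) != 0 by rewrite oppr_eq0 oner_eq0.
have mp := @measurable_psi R j.
have ip := integrable_norm (psi_integrable j).
have mq : measurable_fun setT (fun w : measurableTypeR R => (`|psi j w|)%:E).
  by apply/measurable_EFinP; meas.
have := ge0_integral_affine x H mq (fun y => normr_ge0 _ : (0 <= (`|psi j y|)%:E)%E).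
rewrite normrN normr1 invr1 mul1e => E.
rewrite -(Rintegral_EFin ip) /comp -E le_eqVlt; apply/orP; left; apply/eqP.
by apply: eq_integral => y _; rewrite mulN1r addrC.
Qed.

Definition radj (k : nat) (c : 'I_4) (y : R) : R := Num.sqrt 2 * \int[(@leb2 R)]_p rker k L c y p.

(** The plane integral is both bounded and integrable in y, hence square-integrable. *)
Lemma radj_sqint j c : sqint mu (radj j c).
Proof.
have [C CP] := integral_psi_shift j; have [M M0 MP] := rker_bound j.
apply: sqintZ; set W := fun y => _.
have iW : mu.-integrable setT (EFin \o W).
  have [|x|] := @rker_swap j c (fun=> 1) C; [exact: measurable_cst| |].
    by under eq_integral do rewrite mulr1; exact: CP.
  by move=> _ + _; congr (_.-integrable _ _); apply/funext => y /=; congr EFin; apply: eq_Rintegral => p _; rewrite mulr1.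
have mW := integrable_measurable iW.
have WM y : `|W y| <= M * \int[(@leb2 R)]_p N p.
  apply: (le_trans (le_normr_Rintegral measurableT (rker_integrable j c y))).
  rewrite -RintegralZl//; apply: le_Rintegral => //.
  - exact: integrable_norm (rker_integrable j c y).
  - exact: integrableRZ.
  - by move=> p _; have [a b] := MP L c y p; exact: (le_trans a b).
split=> //; have := @integrableR_bounded _ _ _ mu W W _ mW WM iW.
by congr (_.-integrable _ _); apply/funext => y /=; rewrite expr2.
Qed.

Variable n : nat.
Local Notation KT := ('I_n.+1 * 'I_4)%type.
Implicit Types h : KT -> R -> R.

(** Left multiplication by I is skew-symmetric for the Euclidean inner product of H, so the phase
    e^(- 2 pi I w t) on h becomes e^(2 pi I w t) on L. *)
Lemma rop_pairing h p : fsq mu h -> \sum_l qc l (L p) * rop I h l p =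
  Num.sqrt 2 * \sum_(k : KT) \int[mu]_t (rker k.1 L k.2 t p * h k t).
Proof.
move=> sh; rewrite /rop /qop.
have E (A B : 'I_4 -> R) : \sum_l qc l (L p) * qc l (Num.sqrt 2 *: \sum_c emb I (A c +i* (- B c)) * qe R c) =
   Num.sqrt 2 * \sum_c (A c * qc c (L p) + B c * qc c (I * L p)).
  rewrite !sum_ord4 qe0 qe1 qe2 qe3 /emb !qc0 !qc1 !qc2 !qc3 !qcE/= (qre_I hI); ring.
rewrite E; congr (_ * _); rewrite [RHS](_ : _ =
  \sum_(j < n.+1) \sum_(c < 4) \int[mu]_t (rker j L c t p * h (j, c) t)); last first.
  by rewrite pair_big/=; apply: eq_bigr => -[j c] _.
rewrite exchange_big; apply: eq_bigr => c _.
have ih (j : 'I_n.+1) : mu.-integrable setT (EFin \o (fun t => psi j (p.1 - t) * h (j, c) t)).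
  by apply: sqint_mul => //; exact: psi_shift_sqint.
have ic j := integrableRZ (qc c (L p)) (integrable_mul_cos p.2 (ih j)).
have iS j := integrableRZ (qc c (I * L p)) (integrable_mul_sin p.2 (ih j)).
rewrite /cosT /sinT mulrC [X in _ + X]mulrC -!RintegralZl//; last 2 first.
- by apply: integrable_mul_sin; exact: conv_integrable.
- by apply: integrable_mul_cos; exact: conv_integrable.
rewrite -RintegralD//; last 2 first.
- by apply: integrableRZ; apply: integrable_mul_cos; exact: conv_integrable.
- by apply: integrableRZ; apply: integrable_mul_sin; exact: conv_integrable.
have ir (j : 'I_n.+1) : mu.-integrable setT (EFin \o (fun t => rker j L c t p * h (j, c) t)).
  have := integrableRD (ic j) (iS j); congr (_.-integrable _ _).
  by apply/funext => t /=; congr EFin; rewrite /rker; ring.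
transitivity (\int[mu]_t (\sum_(j < n.+1) rker j L c t p * h (j, c) t)).
  2: exact: (Rintegral_sum ir).2.
apply: eq_Rintegral => t _; rewrite /conv !mulr_suml !mulr_sumr -big_split/=; apply: eq_bigr => j _.
by rewrite /rker; ring.
Qed.

Hypothesis sL : forall c, sqint (@leb2 R) (fun p => qc c (L p)).

Lemma radj_adj : adj mu (@leb2 R) (rop I (n := n)) (fun c p => qc c (L p))
  (fun k => radj k.1 k.2).
Proof.
split=> [k|h sh]; first exact: radj_sqint.
have [sr _] := rop_fsq_fn2 hI sh.
rewrite /fdot; have il l := sqint_mul (sL l) (sr l).
rewrite -(Rintegral_sum il).2.
under [RHS]eq_Rintegral do rewrite rop_pairing//.
have gC (j : 'I_n.+1) c : exists C, forall x, (\int[mu]_y (`|psi j (x - y) * h (j, c) y|)%:E <= C%:E)%E.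
  (* [|psi h| <= psi^2 + h^2], and the integral of psi_j(x - y)^2 over y does not depend on x. *)
  exists (nrm2 mu (@psi R j) + nrm2 mu (h (j, c))) => x.
  have ip := sqint_mul (psi_shift_sqint j x) (sh (j, c)).
  have [_ i1] := psi_shift_sqint j x; have [_ i2] := sh (j, c).
  have H : (-1 : R) != 0 by rewrite oppr_eq0 oner_eq0.
  have ms : measurable_fun setT (fun y : measurableTypeR R => @psi R j y ^+ 2).
    by apply: measurable_funX; exact: measurable_psi.
  have -> : nrm2 mu (@psi R j) = nrm2 mu (fun y => psi j (x - y)).
    have := Rintegral_affine x H ms; rewrite normrN normr1 invr1 mul1r /nrm2 => <-.
    by apply: eq_Rintegral => y _; rewrite mulN1r addrC.
  rewrite /nrm2 -RintegralD// -Rintegral_EFin; last exact: integrableRD.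
  apply: ge0_le_integral => //.
  - by have := measurable_int _ (integrable_norm ip).
  - by have := measurable_int _ (integrableRD i1 i2).
  - move=> y _; rewrite lee_fin; move: (psi j _) (h _ _) => u v; rewrite normrM.
    rewrite -(real_normK (num_real u)) -(real_normK (num_real v)).
    have := normr_ge0 u; have := normr_ge0 v; move: `|u| `|v| => {}u {}v u0 v0; nra.
have sw (k : KT) :
  [/\ (@leb2 R).-integrable setT (EFin \o (fun p => \int[mu]_y (rker k.1 L k.2 y p * h k y))),
    mu.-integrable setT (EFin \o (fun y => \int[@leb2 R]_p (rker k.1 L k.2 y p * h k y))) &
    \int[@leb2 R]_p \int[mu]_y (rker k.1 L k.2 y p * h k y) =
    \int[mu]_y \int[@leb2 R]_p (rker k.1 L k.2 y p * h k y)].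
  case: k => j c; have [C CP] := gC j c.
  by apply: (rker_swap c _ CP); have [] := sh (j, c).
have i0 (k : KT) : (@leb2 R).-integrable setT (EFin \o (fun p => \int[mu]_y (rker k.1 L k.2 y p * h k y))).
  by have [] := sw k.
have [isum E] := Rintegral_sum i0.
rewrite RintegralZl// E mulr_sumr; apply: eq_bigr => -[j c] _.
have [_ i1 ->] := sw (j, c); rewrite -RintegralZl//; apply: eq_Rintegral => y _.
rewrite /radj -mulrA; congr (_ * _).
rewrite mulrC -RintegralZl//; last exact: rker_integrable.
by apply: eq_Rintegral => p _; rewrite mulrC.
Qed.

End Kernel.

End FubiniAdjoint.

(** * Adjoint on L^2 *)

Definition comps (R : realType) (T : Type) (f : T -> quat R) (c : 'I_4) (x : T) : R := qc c (f x).

Section QuaternionL2.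
Context d (T : measurableType d) (R : realType).
Variable mu : {measure set T -> \bar R}.
Implicit Types f g : T -> quat R.

Lemma qc_mull c p e : qc c (p * e) = \sum_d qc d p * qc c (qe R d * e).
Proof.
rewrite {1}(qdecomp p) mulr_suml qc_sum; apply: eq_bigr => d' _.
by rewrite -scalerAl qcZ.
Qed.

Lemma qabs_sqr (q : quat R) : qabs q ^+ 2 = qn2 q.
Proof. by rewrite /qabs sqr_sqrtr -?qn2E// qn2_ge0. Qed.

Lemma qmeasurableP f : qmeasurable f <-> forall c, measurable_fun setT (comps f c).
Proof.
split=> [[f0 f1 f2 f3]|mf].
  by apply: ord4P; rewrite /comps; [under eq_fun do rewrite qc0|under eq_fun do rewrite qc1|
    under eq_fun do rewrite qc2|under eq_fun do rewrite qc3].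
have f0 := mf (inord 0); have f1 := mf (inord 1); have f2 := mf (inord 2); have f3 := mf (inord 3).
split; [move: f0|move: f1|move: f2|move: f3]; congr (measurable_fun _ _);
  by apply/funext => x; rewrite /comps ?qc0 ?qc1 ?qc2 ?qc3.
Qed.

Lemma measurable_qabs f : (forall c, measurable_fun setT (comps f c)) ->
  measurable_fun setT (fun x => qabs (f x)).
Proof.
move=> mf; have -> : (fun x => qabs (f x)) = fun x => Num.sqrt (\sum_c comps f c x ^+ 2).
  by apply/funext => x; rewrite -[qabs _]ger0_norm ?sqrtr_ge0// -sqrtr_sqr qabs_sqr.
have ms : measurable_fun setT (@Num.sqrt R : measurableTypeR R -> R).
  exact: continuous_measurable_fun (@sqrt_continuous R).
apply: (measurableT_comp ms); apply: measurable_sum_ord => c; exact: measurable_funX.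
Qed.

Lemma fsq_qabs f : fsq mu (comps f) -> sqint mu (fun x => qabs (f x)) /\
  nrm2 mu (fun x => qabs (f x)) = fn2 mu (comps f).
Proof.
move=> sf; have [i s] := Rintegral_sum (fun c => (sf c).2); split; last first.
  by rewrite /fn2 /nrm2 -s; apply: eq_Rintegral => x _; rewrite qabs_sqr.
split; first by apply: measurable_qabs => c; have [] := sf c.
by move: i; congr (_.-integrable _ _); apply/funext => x /=; rewrite qabs_sqr.
Qed.

Lemma L2normE f : fsq mu (comps f) -> L2norm mu f = (Num.sqrt (fn2 mu (comps f)))%:E.
Proof. by move=> /fsq_qabs[s <-]; exact: Lnorm2E. Qed.

Lemma L2P f : L2 mu f <-> fsq mu (comps f).
Proof.
split=> [[mf fy]|sf]; last first.
  split; last by rewrite L2normE ?ltry.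
  by apply/qmeasurableP => c; have [] := sf c.
move/qmeasurableP in mf => c.
have mq := measurable_qabs mf.
suff lt : (\int[mu]_x (qabs (f x) ^+ 2)%:E < +oo)%E.
  apply: sqintP => //; apply: le_lt_trans lt; apply: ge0_le_integral => //.
  - by move=> x _; rewrite lee_fin sqr_ge0.
  - by apply/measurable_EFinP; apply: measurable_funX.
  - by apply/measurable_EFinP; apply: measurable_funX.
  - move=> x _; rewrite lee_fin qabs_sqr /qn2 (bigD1 c)//= lerDl.
    by apply: sumr_ge0 => e _; exact: sqr_ge0.
move: fy; rewrite /L2norm unlock.
under eq_integral do rewrite /= powR_mulrn// ger0_norm ?sqrtr_ge0//.
by move=> /lty_poweRy; apply; rewrite invr_eq0 pnatr_eq0.
Qed.

(** The coordinate d' of conj(q) p is the Euclidean inner product of p with q e_d', so right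
    multiplication by the units recovers the quaternionic inner product from the real one. *)
Lemma qc_L2dot d' f g : fsq mu (comps f) -> fsq mu (comps (fun x => g x * qe R d')) ->
  qc d' (L2dot mu f g) = fdot mu (comps f) (comps (fun x => g x * qe R d')).
Proof.
move=> sf sg; rewrite /L2dot qc_qintegral /fdot -(Rintegral_sum (fun c => sqint_mul (sf c) (sg c))).2.
apply: eq_Rintegral => x _; rewrite /comps; move: d' {sg} (f x) (g x); apply: ord4P => p q;
  rewrite sum_ord4 ?qe0 ?qe1 ?qe2 ?qe3 ?qc0 ?qc1 ?qc2 ?qc3 !qcE/=; ring.
Qed.

Lemma fsq_mulr f e : fsq mu (comps f) -> fsq mu (comps (fun x => f x * e)).
Proof.
move=> sf c; rewrite /comps; under eq_fun do rewrite qc_mull.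
apply: sqint_sum => i; under eq_fun do rewrite mulrC.
exact: sqintZ (sf i).
Qed.

Lemma qintegrableP D f : qintegrable mu D f <->
  forall c, mu.-integrable D (EFin \o comps f c).
Proof.
split=> [[f0 f1 f2 f3]|mf].
  by apply: ord4P; [move: f0|move: f1|move: f2|move: f3]; congr (_.-integrable _ _);
    apply/funext => x /=; rewrite /comps ?qc0 ?qc1 ?qc2 ?qc3.
have f0 := mf (inord 0); have f1 := mf (inord 1); have f2 := mf (inord 2); have f3 := mf (inord 3).
split; [move: f0|move: f1|move: f2|move: f3]; congr (_.-integrable _ _);
  by apply/funext => x /=; rewrite /comps ?qc0 ?qc1 ?qc2 ?qc3.
Qed.

Lemma restrict_indic D (f : T -> R) : (EFin \o f) \_ D = EFin \o (fun x => \1_D x * f x).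
Proof.
apply/funext => x; rewrite patchE/= indicE; case: ifPn => _; first by rewrite mul1r.
by rewrite mul0r.
Qed.

Lemma Rintegral_restrict D (f : T -> R) : \int[mu]_(x in D) f x = \int[mu]_x (\1_D x * f x).
Proof. by rewrite /Rintegral integral_mkcond restrict_indic. Qed.

Lemma integrable_restrict D (f : T -> R) : measurable D ->
  mu.-integrable D (EFin \o f) <-> mu.-integrable setT (EFin \o (fun x => \1_D x * f x)).
Proof. by move=> mD; rewrite (integrable_mkcond _ mD) restrict_indic. Qed.

Lemma qc_qintegral_set D c f : qc c (qintegral mu D f) = \int[mu]_(x in D) comps f c x.
Proof. by rewrite /comps /qc; case: (nat_of_ord c) => [|[|[|]]]. Qed.

End QuaternionL2.

Lemma ae_imply d (T : measurableType d) (R : realType) (mu : {measure set T -> \bar R})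
    (P Q : T -> Prop) : (forall x, P x -> Q x) -> {ae mu, forall x, P x} -> {ae mu, forall x, Q x}.
Proof. by move=> PQ; exact: filterS. Qed.

Lemma ae_forall_ord d (T : measurableType d) (R : realType) (mu : {measure set T -> \bar R})
    n (P : 'I_n -> T -> Prop) : (forall c, {ae mu, forall x, P c x}) ->
  {ae mu, forall x, forall c, P c x}.
Proof. exact: filter_forall. Qed.

(** * The adjoint of the full-poly QSTFT and its approximation by cut-offs *)

Section Adjoint.
Variable R : realType.
Local Notation mu := (@lebesgue_measure R).
Local Notation R2 := (measurableTypeR R * measurableTypeR R)%type.
Variable I : quat R.
Hypothesis hI : I ^+ 2 = -1.
Variable n : nat.
Local Notation KT := ('I_n.+1 * 'I_4)%type.
Implicit Types (phi : 'I_n.+1 -> R -> quat R) (h : KT -> R -> R).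

Definition of_vcomps h (j : 'I_n.+1) (t : R) : quat R := \sum_c h (j, c) t *: qe R c.

Lemma of_vcompsK h : vcomps (of_vcomps h) = h.
Proof.
apply/funext => -[j c]; apply/funext => t; rewrite /vcomps /of_vcomps/=.
have H : forall c, qc c (\sum_d h (j, d) t *: qe R d) = h (j, c) t.
  by apply: ord4P; rewrite sum_ord4 qe0 qe1 qe2 qe3 ?qc0 ?qc1 ?qc2 ?qc3 !qcE/=; ring.
exact: H.
Qed.

Lemma L2vecP phi : L2vec phi <-> fsq mu (vcomps phi).
Proof.
split=> [L [j c]|s j]; first exact: ((L2P (@leb1 R) (phi j)).1 (L j) c).
by apply/L2P => c; exact: (s (j, c)).
Qed.

Lemma vcomps_mulr phi e : fsq mu (vcomps phi) -> fsq mu (vcomps (fun j t => phi j t * e)).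
Proof. by move=> s [j c]; apply: (@fsq_mulr _ _ _ mu (phi j)) => d; exact: (s (j, d)). Qed.

Lemma qc_L2vec_dot d (f g : 'I_n.+1 -> R -> quat R) : fsq mu (vcomps f) -> fsq mu (vcomps g) ->
  qc d (L2vec_dot f g) = fdot mu (vcomps f) (vcomps (fun j t => g j t * qe R d)).
Proof.
move=> sf sg; rewrite /L2vec_dot qc_sum.
transitivity (\sum_(j < n.+1) \sum_c \int[mu]_t (qc c (f j t) * qc c (g j t * qe R d))).
  apply: eq_bigr => j _; rewrite qc_L2dot//; first by move=> c; exact: (sf (j, c)).
  by apply: fsq_mulr => c; exact: (sg (j, c)).
by rewrite pair_big/=; apply: eq_bigr => -[j c].
Qed.

Lemma comps_full_qstft phi : fsq mu (vcomps phi) ->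
  comps (full_qstft I phi) = rop I (vcomps phi).
Proof. by move=> s; apply/funext => c; apply/funext => p; rewrite /comps full_qstft_qop. Qed.

Lemma full_qstft_fsq phi : fsq mu (vcomps phi) -> fsq (@leb2 R) (comps (full_qstft I phi)).
Proof. by move=> s; rewrite comps_full_qstft//; have [] := rop_fsq_fn2 hI s. Qed.

(** Right multiplication mixes only the real coordinates, linearly, while the phases act from the
    left. This is what passes from the real to the quaternionic adjoint relation. *)
Lemma full_qstft_mulr phi e p : fsq mu (vcomps phi) ->
  full_qstft I (fun j t => phi j t * e) p = full_qstft I phi p * e.
Proof.
move=> s; rewrite !full_qstft_qop//; last exact: vcomps_mulr.
rewrite !qopE -scalerAl mulrBl -mulrA; congr (_ *: _).
have E c : conv (vcomps (fun j t => phi j t * e)) p.1 c =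
    fun t => \sum_d qc c (qe R d * e) * conv (vcomps phi) p.1 d t.
  apply/funext => t; rewrite /conv/vcomps/=.
  under [RHS]eq_bigr do rewrite mulr_sumr.
  rewrite exchange_big; apply: eq_bigr => j _; rewrite qc_mull mulr_sumr.
  by apply: eq_bigr => d _; move: (psi _ _) (qc _ _) (qc _ _) => a b c'; ring.
have F (a : 'I_4 -> R) : \sum_c (\sum_d qc c (qe R d * e) * a d) *: qe R c = (\sum_d a d *: qe R d) * e.
  rewrite mulr_suml; under eq_bigr do rewrite scaler_suml.
  rewrite exchange_big; apply: eq_bigr => d _.
  rewrite -scalerAl [X in _ *: X]qdecomp scaler_sumr; apply: eq_bigr => c _.
  by rewrite scalerA mulrC.
have iC d := conv_integrable p.1 d s.
by congr (_ - _ * _); rewrite -F; apply: eq_bigr => c _; rewrite E ?cosT_sum ?sinT_sum.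
Qed.

Local Notation Adj := (adj mu (@leb2 R) (rop I (n := n))).

Lemma is_adjointP Vstar : is_adjoint (@full_qstft R I n) Vstar <->
  forall L, L2 (@leb2 R) L -> Adj (comps L) (vcomps (Vstar L)).
Proof.
split=> H L L2L.
  have [/L2vecP sV HV] := H L L2L; split=> // h sh.
  have sh' : fsq mu (vcomps (of_vcomps h)) by rewrite of_vcompsK.
  (* The real part of the quaternionic relation is the real one. *)
  have := congr1 (qc (inord 0)) (HV _ ((L2vecP (of_vcomps h)).2 sh')).
  rewrite qc_L2vec_dot// qc_L2dot; last 2 first.
  - exact/L2P.
  - exact: (fsq_mulr _ (full_qstft_fsq sh')).
  rewrite qe0; under eq_fun do under eq_fun do rewrite mulr1.
  under [in RHS]eq_fun do rewrite mulr1.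
  have := comps_full_qstft sh'; rewrite of_vcompsK => E1 HH; rewrite -E1.
  exact: HH.
have [sV HV] := H L L2L; split=> [|h /L2vecP sh]; first exact/L2vecP.
apply: qc_ext => d; rewrite qc_L2vec_dot//.
(* Conversely, the real relation tested against h e_d is the d-th coordinate of the quaternionic
   relation. *)
have shd := vcomps_mulr (qe R d) sh.
rewrite HV// -comps_full_qstft// qc_L2dot; last 2 first.
- exact/L2P.
- exact: (fsq_mulr _ (full_qstft_fsq sh)).
by congr (fdot _ _ (comps _)); apply/funext => p; rewrite full_qstft_mulr.
Qed.

Definition cutoff (D : set R2) (L : R * R -> quat R) (p : R * R) : quat R := \1_D p *: L p.

Lemma cutoff_fsq D L : measurable D -> fsq (@leb2 R) (comps L) ->
  fsq (@leb2 R) (comps (cutoff D L)).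
Proof.
move=> mD sL c; rewrite /comps; under eq_fun do rewrite qcZ.
have m1 : measurable_fun setT (\1_D : R2 -> R) by exact: measurable_indic.
apply: (sqint_bounded m1 (M := 1) _ (sL c)).
by move=> p; rewrite indicE; case: (_ \in _); rewrite ?normr1 ?normr0.
Qed.

(** On a set of finite measure, [|u| <= 1 + u^2] places the cut-off in L^1 as well, where [radj_adj]
    applies. *)
Lemma cutoff_integrable D L c : measurable D -> (@leb2 R D < +oo)%E ->
  fsq (@leb2 R) (comps L) -> (@leb2 R).-integrable setT (EFin \o comps (cutoff D L) c).
Proof.
move=> mD fD sL; have [mc ic] := cutoff_fsq mD sL c.
have i1 : (@leb2 R).-integrable setT (EFin \o (\1_D : R2 -> R)).
  apply/integrableP; split; first by apply/measurable_EFinP; exact: measurable_indic.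
  rewrite (eq_integral (fun x => (\1_D x)%:E)) => [|p _]; last by rewrite gee0_abs// lee_fin.
  by rewrite integral_indic// setIT.
apply: (integrableR_le mc _ (integrableRD i1 ic)) => p /=.
rewrite /comps qcZ indicE; case: (_ \in _); rewrite /= ?mul1r ?mul0r ?normr0 ?expr0n/= ?addr0//.
move: (qc _ _) => u; rewrite -(real_normK (num_real u)); have := normr_ge0 u; move: `|u| => {}u u0.
by have := sqr_ge0 (u - 1); nra.
Qed.

Lemma cutoff_adj D L : measurable D -> (@leb2 R D < +oo)%E -> fsq (@leb2 R) (comps L) ->
  Adj (comps (cutoff D L)) (fun k => radj I (cutoff D L) k.1 k.2).
Proof.
move=> mD fD sL; apply: radj_adj => //.
- by move=> c; have [] := cutoff_fsq mD sL c.
- by move=> c; exact: cutoff_integrable.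
- exact: cutoff_fsq.
Qed.

Lemma cvg_cutoff E L : exhaustion E -> fsq (@leb2 R) (comps L) ->
  fn2 (@leb2 R) (fun c p => comps (cutoff (E N) L) c p - comps L c p) @[N --> \oo] --> 0.
Proof.
move=> [mE fE ndE UE] sL; apply: cvg_sum0 => c; have [mL iL] := sL c.
have -> : 0 = \int[@leb2 R]_x (0 : R) by rewrite /Rintegral integral0.
apply: (@Rdominated_cvg _ _ _ (@leb2 R) _ _ (fun p => comps L c p ^+ 2)) => //.
- move=> N; have [mN _] := cutoff_fsq (mE N) sL c; have mL' : measurable_fun setT (comps L c) := mL.
  by meas.
- apply: aeW => p; have [N0 _ EN0] : (\bigcup_N E N) p by rewrite UE.
  apply: cvg_near_cst; exists N0 => // N /= N0N; rewrite /comps qcZ indicE mem_set.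
    by rewrite mul1r subrr expr0n.
  by move: EN0; apply/subsetPset/ndE.
- move=> N p; rewrite /comps qcZ ger0_norm ?sqr_ge0// indicE; case: (_ \in _).
    by rewrite mul1r subrr expr0n/= sqr_ge0.
  by rewrite mul0r sub0r sqrrN.
Qed.

Lemma exists_adj L : fsq (@leb2 R) (comps L) -> exists f, Adj (comps L) f.
Proof.
move=> sL; have ex := square_exhaustion R; have [mE fE _ _] := ex.
have V1 := fun h (s : fsq mu h) => (rop_fsq_fn2 hI s).1.
have V2 := fun h (s : fsq mu h) => (rop_fsq_fn2 hI s).2.
have [f fP _] := @adj_closed _ _ _ _ _ _ R mu (@leb2 R) (rop I (n := n)) V1 V2 _ _ _ (fun N => cutoff_fsq (mE N) sL) sL
  (fun N => cutoff_adj (mE N) (fE N) sL) (cvg_cutoff ex sL).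
by exists f.
Qed.

End Adjoint.

(** * Integral formula for the adjoint *)

Section KernelIntegral.
Variable R : realType.
Local Notation mu := (@lebesgue_measure R).
Local Notation R2 := (measurableTypeR R * measurableTypeR R)%type.
Variable I : quat R.
Hypothesis hI : I ^+ 2 = -1.
Variable n : nat.
Local Notation KT := ('I_n.+1 * 'I_4)%type.
Local Notation Adj := (adj mu (@leb2 R) (rop I (n := n))).

Variable L : R * R -> quat R.
Hypothesis sL : fsq (@leb2 R) (comps L).
Variable j : 'I_n.+1.
Local Notation K := (adjoint_kernel I j L).

Let s2 : Num.sqrt 2 != 0 :> R. Proof. by rewrite gt_eqF// sqrtr_gt0. Qed.
Let is2 : (Num.sqrt 2)^-1 ^+ 2 = 2^-1 :> R. Proof. by rewrite exprVn sqr_sqrtr. Qed.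

Lemma rker_cutoff D c y p : rker I j (cutoff D L) c y p = \1_D p * rker I j L c y p.
Proof. by rewrite /rker /cutoff -qscalerAr !qcZ; ring. Qed.

Lemma kernel_integrable D y : measurable D -> (@leb2 R D < +oo)%E ->
  qintegrable (@leb2 R) D (K y).
Proof.
move=> mD fD; apply/qintegrableP => c; apply/integrable_restrict => //.
have mc c' : measurable_fun setT (fun p => qc c' (cutoff D L p)) := (cutoff_fsq mD sL c').1.
have := rker_integrable hI mc (fun c => cutoff_integrable c mD fD sL) j c y.
by congr (_.-integrable _ _); apply/funext => p /=; rewrite rker_cutoff /comps adjoint_kernelE.
Qed.

Lemma comps_kernel_integral D c y :
  comps (fun y => qintegral (@leb2 R) D (K y)) c y = (Num.sqrt 2)^-1 * radj I (cutoff D L) j c y.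
Proof.
rewrite /radj mulKf// /comps qc_qintegral_set Rintegral_restrict.
by apply: eq_Rintegral => p _; rewrite rker_cutoff /comps adjoint_kernelE.
Qed.

Lemma kernel_integral_fsq D : measurable D -> (@leb2 R D < +oo)%E ->
  fsq mu (comps (fun y => qintegral (@leb2 R) D (K y))).
Proof.
move=> mD fD c; have [sr _] := cutoff_adj hI n mD fD sL.
have := sqintZ (Num.sqrt 2)^-1 (sr (j, c)).
by congr sqint; apply/funext => y; rewrite comps_kernel_integral.
Qed.

Variable f : KT -> R -> R.
Hypothesis Lf : Adj (comps L) f.

Let F (c : 'I_4) (y : R) := (Num.sqrt 2)^-1 * f (j, c) y.

Let sF : fsq mu F. Proof. by move=> c; apply: sqintZ; have [sf _] := Lf; exact: sf. Qed.

(** The factor 2 of [adj_bound] cancels against the square of [(Num.sqrt 2)^-1]; the other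
    components of the adjoint only enlarge the right-hand side of the estimate. *)
Lemma kernel_integral_dist D : measurable D -> (@leb2 R D < +oo)%E ->
  fn2 mu (fun c y => comps (fun y => qintegral (@leb2 R) D (K y)) c y - F c y) <=
  fn2 (@leb2 R) (fun c p => comps (cutoff D L) c p - comps L c p).
Proof.
move=> mD fD.
have V1 := fun h (s : fsq mu h) => (rop_fsq_fn2 (n := n) hI s).1.
have V2 := fun h (s : fsq mu h) => (rop_fsq_fn2 (n := n) hI s).2.
have aD := cutoff_adj hI n mD fD sL; have sD := cutoff_fsq mD sL.
have B := adj_bound V1 V2 (fsqB sD sL) (adjB V1 sD sL aD Lf).
have [sr _] := aD; have [sf _] := Lf.
have E : fn2 mu (fun c y => comps (fun y => qintegral (@leb2 R) D (K y)) c y - F c y) =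
   2^-1 * \sum_c nrm2 mu (fun y => radj I (cutoff D L) j c y - f (j, c) y).
  rewrite mulr_sumr; apply: eq_bigr => c _; rewrite /nrm2 -RintegralZl//; last first.
    by have [] := sqintB (sr (j, c)) (sf (j, c)).
  by apply: eq_Rintegral => y _; rewrite comps_kernel_integral /F -mulrBr exprMn is2.
rewrite E ler_pdivrMl//; apply: le_trans B.
rewrite [leRHS](_ : _ = \sum_(i < n.+1) \sum_(c < 4)
    nrm2 mu (fun y => radj I (cutoff D L) i c y - f (i, c) y)); last first.
  by rewrite pair_big/=; apply: eq_bigr => -[i c].
rewrite (bigD1 j)//= lerDl.
by apply: sumr_ge0 => i _; apply: sumr_ge0 => c _; exact: nrm2_ge0.
Qed.

Lemma cvg_kernel_integral E : exhaustion E ->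
  fn2 mu (fun c y => comps (fun y => qintegral (@leb2 R) (E N) (K y)) c y - F c y) @[N --> \oo] --> 0.
Proof.
move=> exE; have [mE fE _ _] := exE.
apply: (@squeeze_cvgr _ _ _ _ (cst 0) _ _ _ _ _ (cvg_cutoff exE sL)); last exact: cvg_cst.
by apply: nearW => N; rewrite fn2_ge0 kernel_integral_dist.
Qed.

Let D : set (measurableTypeR R) := [set y | qintegrable (@leb2 R) setT (K y)].

Let mL c : measurable_fun setT (fun p => qc c (L p)). Proof. exact: (sL c).1. Qed.

(** Integrability at y is finiteness of four integrals that depend measurably on y by Tonelli's
    theorem, which makes [D] measurable. *)
Let DE : D = \bigcap_(c in [set: 'I_4]) [set y | (\int[@leb2 R]_p `|rker I j L c y p|%:E < +oo)%E].
Proof.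
have E c y : comps (K y) c = rker I j L c y by apply/funext => p; rewrite /comps adjoint_kernelE.
apply/seteqP; split=> y /=.
  by move=> /qintegrableP H c _; have := H c; rewrite E => /integrableP[].
move=> H; apply/qintegrableP => c; rewrite E; apply/integrableP; split; last exact: H.
apply/measurable_EFinP; apply: measurable_rker => //; exact: measurable_id.
Qed.

Let mD : measurable D.
Proof.
rewrite DE; apply: fin_bigcap_measurable => // c _.
have mr : measurable_fun setT (fun z : R2 * measurableTypeR R => `|rker I j L c z.2 z.1|%:E).
  apply/measurable_EFinP.
  have mr : measurable_fun setT (fun z : R2 * measurableTypeR R => rker I j L c z.2 z.1).
    by apply: measurable_rker; [exact: mL|exact: measurable_snd|exact: measurable_fst].
  by meas.
have abs0 z : (0 <= (`|rker I j L c z.2 z.1|)%:E)%E by rewrite lee_fin.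
have mG := @measurable_fun_fubini_tonelli_G _ _ _ _ R (@plane_measure R) _ mr abs0.
have := emeasurable_neq measurableT mG +oo%E; rewrite setTI; congr measurable.
by apply/seteqP; split=> y /=; rewrite ltey.
Qed.

(** The representative that [is_L2_integral] asks for: the Lebesgue integral wherever it exists, and
    elsewhere the L^2 limit, which is the adjoint value divided by sqrt 2. *)
Definition kernel_integral (y : R) : quat R :=
  if pselect (qintegrable (@leb2 R) setT (K y)) then qintegral (@leb2 R) setT (K y)
  else (Num.sqrt 2)^-1 *: of_vcomps f j y.

Lemma comps_of_vcomps c y : qc c (of_vcomps f j y) = f (j, c) y.
Proof. by have := congr1 (fun g => g (j, c) y) (of_vcompsK f). Qed.

Let GE c y : comps kernel_integral c y =
  \1_D y * (\int[@leb2 R]_p rker I j L c y p - F c y) + F c y.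
Proof.
rewrite /kernel_integral /comps indicE; case: pselect => H.
  rewrite (mem_set (H : D y)) mul1r subrK qc_qintegral_set.
  by apply: eq_Rintegral => p _; rewrite /comps adjoint_kernelE.
by rewrite memNset//= mul0r add0r qcZ comps_of_vcomps.
Qed.

Let mG c : measurable_fun setT (comps kernel_integral c).
Proof.
have -> : comps kernel_integral c = fun y => \1_D y * (\int[@leb2 R]_p rker I j L c y p - F c y) + F c y.
  by apply/funext => y; exact: GE.
have [mF _] := sF c; have m1 : measurable_fun setT (\1_D : measurableTypeR R -> R) by exact: measurable_indic.
have mW : measurable_fun setT (fun y : measurableTypeR R => \int[@leb2 R]_p rker I j L c y p).
  apply: (@measurable_Rintegral_param _ _ _ _ _ (@plane_measure R) (fun z : measurableTypeR R * R2 => rker I j L c z.1 z.2)).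
  by apply: measurable_rker; [exact: mL|exact: measurable_fst|exact: measurable_snd].
by meas.
Qed.

Let cvg_pointwise c y : D y ->
  comps (fun y => qintegral (@leb2 R) (@square R N) (K y)) c y @[N --> \oo] --> \int[@leb2 R]_p rker I j L c y p.
Proof.
move=> Dy; have [mE fE ndE UE] := square_exhaustion R.
have ir : (@leb2 R).-integrable setT (EFin \o rker I j L c y).
  have /qintegrableP/(_ c) := Dy; congr (_.-integrable _ _).
  by apply/funext => p /=; rewrite /comps adjoint_kernelE.
have -> : (fun N => comps (fun y => qintegral (@leb2 R) (@square R N) (K y)) c y) =
    fun N => \int[@leb2 R]_p (\1_(@square R N) p * rker I j L c y p).
  apply/funext => N; rewrite comps_kernel_integral /radj mulKf//.
  by apply: eq_Rintegral => p _; rewrite rker_cutoff.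
have mr : measurable_fun setT (rker I j L c y) by apply: measurable_rker => //; exact: measurable_id.
apply: (@Rdominated_cvg _ _ _ (@leb2 R) _ _ (fun p => `|rker I j L c y p|)) => //.
- move=> N; have m1 : measurable_fun setT (\1_(@square R N) : R2 -> R) by exact: measurable_indic.
  by meas.
- apply: aeW => p; have [N0 _ EN0] : (\bigcup_N @square R N) p by rewrite UE.
  apply: cvg_near_cst; exists N0 => // N /= N0N; rewrite indicE mem_set ?mul1r//.
  by move: EN0; apply/subsetPset/ndE.
- exact: integrable_norm.
- by move=> N p; rewrite indicE normrM; case: (_ \in _); rewrite ?normr1 ?mul1r// normr0 mul0r.
Qed.

(* Along the squares, the integrals tend to F in L^2 and, where K y is
   integrable, pointwise to the Lebesgue integral; Fatou's lemma compares both. *)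
Lemma kernel_integral_nrm2 c : sqint mu (fun y => comps kernel_integral c y - F c y) /\
  nrm2 mu (fun y => comps kernel_integral c y - F c y) = 0.
Proof.
have [mE fE _ _] := square_exhaustion R.
have [mF _] := sF c; have mg := mG c.
have mGF : measurable_fun setT (fun y => comps kernel_integral c y - F c y) by meas.
have m1 : measurable_fun setT (\1_D : measurableTypeR R -> R) by exact: measurable_indic.
have le e : 0 < e -> (\int[mu]_y ((comps kernel_integral c y - F c y) ^+ 2)%:E <= e%:E)%E.
  move=> e0; have /cvgrPdist_le/(_ _ e0)[N0 _ HN] := cvg_kernel_integral (square_exhaustion R).
  pose S N := comps (fun y => qintegral (@leb2 R) (@square R N) (K y)) c.
  have sS N : sqint mu (S N) := kernel_integral_fsq (mE N) (fE N) c.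
  (* Restricted to [D], where the pointwise limit is the Lebesgue integral; off [D] both the
     sequence and, by [GE], the limit vanish. *)
  apply: (@fatou_sqr _ _ _ mu (fun N y => \1_D y * (S N y - F c y))) => //.
  - by move=> N; have [mS _] := sS N; meas.
  - apply: aeW => y; rewrite GE addrK indicE; have [Dy|Dy] := pselect (D y).
      rewrite mem_set//; under eq_fun do rewrite mul1r.
      by rewrite mul1r; apply: cvgB; [exact: cvg_pointwise|exact: cvg_cst].
    by rewrite memNset// mul0r; under eq_fun do rewrite mul0r; exact: cvg_cst.
  - exists N0 => // N /= N0N.
    apply: (@le_trans _ _ (nrm2 mu (fun y => S N y - F c y))%:E).
      rewrite -nrm2E; last exact: sqintB.
      have [mS _] := sS N; apply: ge0_le_integral => //.
      + by move=> y _; rewrite lee_fin sqr_ge0.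
      + by apply/measurable_EFinP; meas.
      + by apply/measurable_EFinP; meas.
      + move=> y _; rewrite lee_fin exprMn indicE; case: (_ \in _); rewrite ?expr1n ?mul1r//.
        by rewrite expr0n mul0r sqr_ge0.
    rewrite lee_fin; have := HN _ N0N; rewrite /= sub0r normrN ger0_norm ?fn2_ge0//.
    apply: le_trans; exact: (@nrm2_le_fn2 _ _ _ _ mu (fun c y => comps (fun y => qintegral (@leb2 R) (@square R N) (K y)) c y - F c y) c).
have sGF : sqint mu (fun y => comps kernel_integral c y - F c y).
  by apply: sqintP => //; apply: le_lt_trans (le 1 ltr01) (ltry _).
split=> //; apply/eqP; rewrite eq_le nrm2_ge0 andbT; apply/ler_addgt0Pr => e e0.
by rewrite add0r -lee_fin -nrm2E//; exact: le.
Qed.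

Lemma kernel_integral_ae : {ae mu, forall y, of_vcomps f j y = Num.sqrt 2 *: kernel_integral y}.
Proof.
have ae c : {ae mu, forall y, comps kernel_integral c y - F c y = 0}.
  by have [s z] := kernel_integral_nrm2 c; exact: nrm2_eq0.
have H : {ae mu, forall y, forall c, comps kernel_integral c y - F c y = 0}.
  exact: ae_forall_ord.
apply: ae_imply H => y H; apply: qc_ext => c; rewrite comps_of_vcomps qcZ.
by move/eqP: (H c); rewrite subr_eq0 => /eqP; rewrite /comps => ->; rewrite /F mulVKf.
Qed.

Lemma kernel_integralP : is_L2_integral K kernel_integral.
Proof.
have sGF : fsq mu (fun c y => comps kernel_integral c y - F c y).
  by move=> c; have [] := kernel_integral_nrm2 c.
have sG : fsq mu (comps kernel_integral).
  move=> c; have := sqintD (sGF c) (sF c); congr sqint.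
  by apply/funext => y; rewrite subrK.
split.
- by apply/L2P; exact: sG.
- move=> E exE; have [mE fE _ _] := exE; split.
  + by move=> N y; exact: kernel_integrable.
  + by move=> N; apply/L2P; exact: kernel_integral_fsq.
  + have sS N := kernel_integral_fsq (mE N) (fE N).
    have E1 N : L2norm (@leb1 R) (fun y => kernel_integral y - qintegral (@leb2 R) (E N) (K y)) =
      (Num.sqrt (fn2 mu (fun c y => comps kernel_integral c y - comps (fun y => qintegral (@leb2 R) (E N) (K y)) c y)))%:E.
      have H : comps (fun y => kernel_integral y - qintegral (@leb2 R) (E N) (K y)) =
         fun c y => comps kernel_integral c y - comps (fun y => qintegral (@leb2 R) (E N) (K y)) c y.
        by apply/funext => c; apply/funext => y; rewrite /comps qcB.
      rewrite L2normE H//; exact: fsqB sG (sS N).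
    under eq_fun do rewrite E1.
    apply: cvg_EFin; first exact: nearW.
    rewrite -[X in _ --> X]sqrtr0; apply: (continuous_cvg _ (@sqrt_continuous R _)).
    (* The distance to [kernel_integral] is estimated through [F] with [fn2B_le]; the other term is
       0 because the two agree almost everywhere. *)
    have c0 : 2 * fn2 mu (fun c y => comps (fun y => qintegral (@leb2 R) (E N) (K y)) c y - F c y) @[N --> \oo] --> 0.
      by rewrite -[X in _ --> X](mulr0 (2 : R)); apply: cvgM; [exact: cvg_cst|exact: cvg_kernel_integral].
    apply: (@squeeze_cvgr _ _ _ _ (cst 0) _ _ _ _ _ c0); last exact: cvg_cst.
    apply: nearW => N; rewrite fn2_ge0/=; have := fn2B_le sG (sS N) sF.
    have -> : fn2 mu (fun c y => comps kernel_integral c y - F c y) = 0.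
      by apply: big1 => c _; have [] := kernel_integral_nrm2 c.
    by rewrite mulr0 add0r.
- by move=> y H; rewrite /kernel_integral; case: pselect.
Qed.

End KernelIntegral.

Theorem theorem6p16 (R : realType) (I : quat R) (hI : I ^+ 2 = -1) (n : nat) :
  (forall phi : 'I_n.+1 -> R -> quat R,
     L2vec phi -> L2 (@leb2 R) (full_qstft I phi)) /\
  (exists Vstar, is_adjoint (@full_qstft R I n) Vstar) /\
  (forall Vstar : (R * R -> quat R) -> 'I_n.+1 -> R -> quat R,
     is_adjoint (@full_qstft R I n) Vstar ->
     (forall Lambda : R * R -> quat R, L2 (@leb2 R) Lambda ->
        forall j : 'I_n.+1,
          exists2 G : R -> quat R,
            is_L2_integral (adjoint_kernel I j Lambda) G &
            {ae @leb1 R, forall y, Vstar Lambda j y = Num.sqrt 2 *: G y}) /\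
     (forall phi : 'I_n.+1 -> R -> quat R, L2vec phi ->
        forall j : 'I_n.+1,
          {ae @leb1 R, forall y, Vstar (full_qstft I phi) j y = 2 *: phi j y})).
Proof.
have V1 := fun h (s : fsq (@lebesgue_measure R) h) => (rop_fsq_fn2 (n := n) hI s).1.
have V2 := fun h (s : fsq (@lebesgue_measure R) h) => (rop_fsq_fn2 (n := n) hI s).2.
split=> [phi /L2vecP sphi|]; first by apply/L2P; exact: full_qstft_fsq.
split.
  (* Outside L^2 the adjoint is given the value 0; [is_adjoint] constrains only arguments in L^2. *)
  have ex L : exists g : 'I_n.+1 -> R -> quat R, L2 (@leb2 R) L ->
      adj (@lebesgue_measure R) (@leb2 R) (rop I (n := n)) (comps L) (vcomps g).
    have [sL|sL] := pselect (L2 (@leb2 R) L); last by exists (fun _ _ => 0).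
    have [f Lf] := exists_adj hI n ((L2P _ _).1 sL).
    by exists (of_vcomps f) => _; rewrite of_vcompsK.
  have [Vstar VP] := choice ex; exists Vstar; exact/(is_adjointP hI).
move=> Vstar /(is_adjointP hI) H; split.
  move=> L L2L j; have LV := H L L2L; have sL := (L2P _ _).1 L2L.
  exists (kernel_integral I L j (vcomps (Vstar L))); first exact: kernel_integralP.
  have := kernel_integral_ae hI sL j LV; apply: ae_imply => y <-.
  by apply: qc_ext => c; rewrite comps_of_vcomps.
move=> phi /L2vecP sphi j; have L2V := (L2P _ _).2 (full_qstft_fsq hI sphi).
(* V phi has two adjoint values, the given one and 2 phi; [adj_unique] identifies them almost
   everywhere. *)
have A1 := H _ L2V; rewrite (comps_full_qstft hI)// in A1.
have A2 := adj_isometry V1 V2 (@rop_add _ I n) sphi.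
have U := adj_unique V1 V2 (V1 _ sphi) A1 A2.
have : {ae @lebesgue_measure R, forall y, forall c, vcomps (Vstar (full_qstft I phi)) (j, c) y = 2 * vcomps phi (j, c) y}.
  by apply: ae_forall_ord => c; exact: U.
by apply: ae_imply => y Hy; apply: qc_ext => c; rewrite qcZ; exact: Hy.
Qed.
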